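(* Let $N\ge 2$ and $s\in(0,1)$. For any $p>\frac{N+s}{N-s}$ there exists a function $u\in C^2(\mathbb{R}^N_+)\cap\mathcal{L}_s$ with $u>0$ in $\mathbb{R}^N_+$ such that $$(-\Delta)^s u(x)\ge u(x)^p\quad\text{for all }x\in\mathbb{R}^N_+,\qquad u=0\quad\text{in }\mathbb{R}^N_-.$$
   Context: $\mathbb{R}^N_+=\{x\in\mathbb{R}^N: x_N>0\}$ and $\mathbb{R}^N_-=\{x\in\mathbb{R}^N: x_N<0\}$. The fractional Laplacian is $$(-\Delta)^s u(x)=-c_{N,s}\int_{\mathbb{R}^N}\frac{u(x+y)+u(x-y)-2u(x)}{|y|^{N+2s}}\,dy,$$ with $c_{N,s}>0$ the usual normalizing constant. The function space is $$\mathcal{L}_s=\left\{u\in L^1_{loc}(\mathbb{R}^N):\ \limsup_{|x|\to+\infty}\frac{|u(x)|}{|x|^{2s-\delta}}<+\infty\ \text{ for some }\delta\in(0,2s]\right\},$$ and $u\in C^2(\mathbb{R}^N_+)\cap\mathcal{L}_s$ means that $u$ belongs to $\mathcal{L}_s$ and its restriction to the open half-space is $C^2$. *)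

(* Defs.v *)
From HB Require Import structures.
From mathcomp Require Import all_boot all_order all_algebra.
From mathcomp Require Import all_classical all_reals all_analysis.

Set Implicit Arguments.
Unset Strict Implicit.
Unset Printing Implicit Defensive.

Import Order.TTheory GRing.Theory Num.Theory.
Import numFieldNormedType.Exports.

Local Open Scope classical_set_scope.
Local Open Scope ring_scope.

(* R^n is 'rV[R]_n. Its sigma-algebra is generated by the coordinate maps (the
   Borel sigma-algebra), as the library does for n.-tuple. *)
Definition rV_display : measure_display.
Proof. exact: default_measure_display. Qed.

Section measurable_rV.
Context {R : realType}.
Variable n : nat.

Let coors : 'I_n -> 'rV[R]_n -> R := fun i x => x 0 i.

Let rV_set0 : g_sigma_preimage coors set0.
Proof. exact: sigma_algebra0. Qed.

Let rV_setC A : g_sigma_preimage coors A -> g_sigma_preimage coors (~` A).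
Proof. exact: sigma_algebraC. Qed.

Let rV_bigcup (F : (set 'rV[R]_n)^nat) :
  (forall i, g_sigma_preimage coors (F i)) ->
  g_sigma_preimage coors (\bigcup_i (F i)).
Proof. exact: sigma_algebra_bigcup. Qed.

HB.instance Definition _ :=
  @isMeasurable.Build rV_display 'rV[R]_n (g_sigma_preimage coors)
    rV_set0 rV_setC rV_bigcup.

Lemma measurable_coord (i : 'I_n) :
  measurable_fun [set: 'rV[R]_n] (fun x => x 0 i : R).
Proof.
move=> _ Y mY; rewrite setTI; apply: sub_sigma_algebra => /=.
rewrite -bigcup_seq/=; exists i => /=; first by rewrite mem_index_enum.
by exists Y => //; rewrite setTI.
Qed.

Lemma measurable_fun_rVP d (T : measurableType d) (f : T -> 'rV[R]_n) :
  (forall i, measurable_fun [set: T] (fun t => f t 0 i : R)) ->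
  measurable_fun [set: T] f.
Proof.
move=> mf.
suff prefS : g_sigma_preimage (fun i => coors i \o f) `<=` measurable.
  move=> _ A mA; rewrite g_sigma_preimage_comp in prefS.
  by apply: prefS; exists A.
apply: smallest_sub; first exact: sigma_algebra_measurable.
rewrite -bigcup_seq; apply: bigcup_sub => i _ A [B mB <-].
exact: mf.
Qed.

End measurable_rV.

Section rV_cons.
Context {R : realType}.
Variable n : nat.

Definition rV_cons (p : measurableTypeR R * 'rV[R]_n) : 'rV[R]_n.+1 :=
  row_mx (const_mx p.1 : 'rV[R]_1) p.2.

Definition rV_uncons (v : 'rV[R]_n.+1) : measurableTypeR R * 'rV[R]_n :=
  (v 0 0, rsubmx (v : 'rV[R]_(1 + n))).

Lemma rV_consK : cancel rV_cons rV_uncons.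
Proof.
case=> a v; congr (_, _); last exact: row_mxKr.
have -> : (0 : 'I_n.+1) = lshift n (0 : 'I_1) by exact: val_inj.
by rewrite [LHS](row_mxEl (const_mx a : 'rV[R]_1) v 0 0) mxE.
Qed.

Lemma rV_cons0 p : rV_cons p 0 0 = p.1.
Proof. by have := congr1 fst (rV_consK p). Qed.

Lemma rV_consS p (i : 'I_n) : rV_cons p 0 (rshift 1 i) = p.2 0 i.
Proof. exact: row_mxEr. Qed.

Lemma measurable_rV_cons : measurable_fun setT rV_cons.
Proof.
apply: measurable_fun_rVP => i.
have [j|j] := split_ordP (i : 'I_(1 + n)).
  move=> ->.
  rewrite (_ : (fun _ => _) = fst) //; apply/funext => p.
  rewrite (_ : lshift n j = 0 :> 'I_n.+1) ?rV_cons0 //.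
  by case: j => -[] // ?; exact: val_inj.
move=> ->.
rewrite (_ : (fun _ => _) = (fun v : 'rV[R]_n => v 0 j) \o snd).
  by apply: measurableT_comp => //; exact: measurable_coord.
by apply/funext => p; rewrite rV_consS.
Qed.

Lemma measurable_rV_uncons : measurable_fun setT rV_uncons.
Proof.
apply/measurable_fun_pairP; split.
  exact: (@measurable_coord R n.+1 0).
apply: measurable_fun_rVP => i.
rewrite (_ : (fun _ => _) = fun v : 'rV[R]_n.+1 => v 0 (rshift 1 i)).
  exact: measurable_coord.
by apply/funext => v; rewrite /= mxE.
Qed.

End rV_cons.

Section lebesgue_rV_step.
Local Open Scope ereal_scope.
Context {R : realType}.
Variables (n : nat) (m : {sigma_finite_measure set 'rV[R]_n -> \bar R}).

Definition lebesgue_cons : set 'rV[R]_n.+1 -> \bar R :=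
  pushforward (lebesgue_measure \x m) (@rV_cons R n).

Let mcons := @measurable_rV_cons R n.
Let pf : {measure set 'rV[R]_n.+1 -> \bar R} :=
  measure_function_pushforward__canonical__measure_function_Measure
    (lebesgue_measure \x m) mcons.

HB.instance Definition _ := isMeasure.Build _ _ _ lebesgue_cons
  (measure0 pf) (measure_ge0 pf) (@measure_semi_sigma_additive _ _ _ pf).

Let lebesgue_cons_sigma_finite : sigma_finite setT lebesgue_cons.
Proof.
have /sigma_finiteP[F [TF ndF Foo]] := sigma_finiteT (@lebesgue_measure R).
have /sigma_finiteP[G [TG ndG Goo]] := sigma_finiteT m.
exists (fun k => @rV_uncons R n @^-1` (F k `*` G k)).
  rewrite -preimage_bigcup (_ : \bigcup_k _ = setT) ?preimage_setT//.
  apply/seteqP; split => // -[x y] _.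
  have [i _ Fix] : (\bigcup_i F i) x by rewrite -TF.
  have [j _ Gjy] : (\bigcup_i G i) y by rewrite -TG.
  exists (maxn i j) => //; split.
  - by move: x Fix; exact/subsetPset/ndF/leq_maxl.
  - by move: y Gjy; exact/subsetPset/ndG/leq_maxr.
move=> k; have [mF Fk] := Foo k; have [mG Gk] := Goo k; split.
  rewrite -[X in measurable X]setTI; apply: measurable_rV_uncons => //.
  exact: measurableX.
rewrite /lebesgue_cons /pushforward -comp_preimage.
rewrite (_ : _ \o _ = id); last by apply/funext => p; exact: rV_consK.
by rewrite preimage_id product_measure1E// lte_mul_pinfty// ge0_fin_numE.
Qed.

HB.instance Definition _ := Measure_isSigmaFinite.Build _ _ _ lebesgue_cons
  lebesgue_cons_sigma_finite.

End lebesgue_rV_step.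

(* Lebesgue measure on R^n: the n-fold product of the one on R *)
Fixpoint lebesgue_rV {R : realType} (n : nat) :
    {sigma_finite_measure set 'rV[R]_n -> \bar R} :=
  match n with
  | 0 => dirac (0 : 'rV[R]_0)
  | k.+1 => lebesgue_cons (lebesgue_rV k)
  end.

Lemma lebesgue_rV_box {R : realType} n (A : 'I_n -> set R) :
  (forall i, measurable (A i)) ->
  lebesgue_rV n [set x : 'rV[R]_n | forall i, A i (x 0 i)] =
  (\prod_(i < n) lebesgue_measure (A i))%E.
Proof.
elim: n A => [|n IH] A mA /=.
  rewrite big_ord0 diracE (_ : _ \in _) //.
  by rewrite inE /= => -[].
rewrite big_ord_recl -IH; last by move=> i; exact: mA.
pose B : set 'rV[R]_n := [set x | forall i, A (lift ord0 i) (x 0 i)].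
have mB : measurable B.
  have -> : B = \bigcap_(i in [set: 'I_n])
      ((fun x : 'rV[R]_n => x 0 i : R) @^-1` A (lift ord0 i)).
    by apply/seteqP; split => [x Bx i _|x Bx i]; [exact: Bx|exact: (Bx i I)].
  apply: fin_bigcap_measurable => // i _.
  by rewrite -[X in measurable X]setTI; exact: measurable_coord.
rewrite -[RHS](product_measure1E lebesgue_measure (lebesgue_rV n)) //;
  last exact: (mA ord0).
rewrite /lebesgue_cons /pushforward; congr (_ _).
have liftE (i : 'I_n) : lift ord0 i = rshift 1 i :> 'I_n.+1 by exact: val_inj.
apply/seteqP; split => -[a v] /=.
  move=> Av; split; first by have := Av ord0; rewrite rV_cons0.
  by move=> i; have := Av (lift ord0 i); rewrite liftE rV_consS.
case=> Aa Bv i; have [j ->|->] := unliftP ord0 i.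
  by rewrite liftE rV_consS -liftE; exact: Bv.
by rewrite rV_cons0.
Qed.

Section half_space_problem.
Context {R : realType}.
Variable n : nat.
Implicit Types (x y : 'rV[R]_n) (f u : 'rV[R]_n -> R).

(* The norm `|x| of the library on 'rV[R]_n is the sup norm. *)
Definition enorm x : R := Num.sqrt (\sum_(i < n) x 0 i ^+ 2).

Definition partial (i : 'I_n) f : 'rV[R]_n -> R := 'D_(delta_mx 0 i) f.

(* U is meant to be open: the partial derivatives are those of f on R^n. *)
Fixpoint Ck_on (k : nat) (U : set 'rV[R]_n) f : Prop :=
  (forall x, U x -> {for x, continuous f}) /\
  match k with
  | 0 => True
  | j.+1 => forall i : 'I_n,
      (forall x, U x -> derivable f x (delta_mx 0 i)) /\
      Ck_on j U (partial i f)
  end.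

Definition L1loc u : Prop :=
  forall K : set 'rV[R]_n, compact K ->
    (lebesgue_rV n).-integrable K (EFin \o u).

Definition rV_infty : set_system 'rV[R]_n :=
  filter_from [set: R] (fun M => [set x | M < enorm x]).

Definition Ls (s : R) u : Prop :=
  L1loc u /\
  exists delta : R, [/\ 0 < delta, delta <= 2 * s &
    (limf_esup (fun x => (`|u x| / enorm x `^ (2 * s - delta))%:E) rV_infty
      < +oo)%E].

End half_space_problem.

Section fractional_laplacian.
Context {R : realType}.
Variable n : nat.
Local Notation N := n.+1.
Implicit Types (x y : 'rV[R]_N) (u : 'rV[R]_N -> R).

(* The constant for which (-Delta)^s has Fourier symbol |xi|^(2s):
   (-Delta)^s e^(i xi.x) = 2 c (\int (1 - cos (xi.y)) / |y|^(N+2s) dy) e^(i xi.x),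
   and the integral is |xi|^(2s) times its value at a unit vector. The factor 2
   comes from the second difference u(x+y) + u(x-y) - 2u(x). *)
Definition cNs (s : R) : R :=
  (2 * \int[lebesgue_rV N]_y
         ((1 - cos (y 0 ord0)) / enorm y `^ (N%:R + 2 * s)))^-1.

(* The real-valued integral is 0 when a measurable integrand is not integrable, so
   that u^p <= (-Delta)^s u with u > 0 forces integrability. *)
Definition frac_laplacian (s : R) u x : R :=
  - cNs s * \int[lebesgue_rV N]_y
      ((u (x + y) + u (x - y) - 2 * u x) / enorm y `^ (N%:R + 2 * s)).

Definition half_space_pos : set 'rV[R]_N := [set x | 0 < x 0 ord_max].
Definition half_space_neg : set 'rV[R]_N := [set x | x 0 ord_max < 0].

End fractional_laplacian.

(* Main.v *)
(* Write N for the dimension, g(z) = (max z_N 0)^s and h(z) = g(z) |z|^(-N), the Kelvin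
   transform of g; the solution is u = lambda h^alpha with
   alpha = 2s / ((p-1)(N-s)), which lies in (0,1) exactly when p > (N+s)/(N-s).

   The function h is s-superharmonic in the half-space, and t |-> t^alpha is concave, so
   u(z) - u(x) is at most alpha lambda h(x)^(alpha-1) (h(z) - h(x)), and even smaller by
   (1-alpha) u(x) when z_N <= 0, where both u and h vanish.  Integrating against
   |z-x|^(-N-2s), the first term contributes something nonpositive and the second one at most
   -c u(x) x_N^(-2s).  Since h <= x_N^(s-N), one has
   u^(p-1) <= lambda^(p-1) x_N^(-2s), and a small lambda finishes the proof.

   Superharmonicity of g: on lines through x it reduces to a one-dimensional inequality.
   Superharmonicity of h: the kernels (|z-x|^2 + e|z|)^(-(N+2s)/2) are covariant under the
   inversion of radius |x|, which fixes x and exchanges g and h up to the factor |x|^N; so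
   the integral of h against such a kernel is |x|^(-N) times that of g, and e tends to 0. *)
Require Import Defs.
From HB Require Import structures.
From mathcomp Require Import all_boot all_order all_algebra.
From mathcomp Require Import all_classical all_reals all_analysis.
From mathcomp Require Import measurable_realfun.
From mathcomp Require Import ring lra.

Set Implicit Arguments.
Unset Strict Implicit.
Unset Printing Implicit Defensive.

Import Order.TTheory GRing.Theory Num.Theory.
Import numFieldNormedType.Exports.

Local Open Scope classical_set_scope.
Local Open Scope ring_scope.

(** Each natural form of the operator fails at one step. Second differences converge absolutely, but
    an inversion does not respect the pairing of x + y with x - y. Single differences u(z) - u(x)
    follow the inversion, but are not absolutely integrable against |z-x|^(-N-2s) when 2s >= 1.
    Hence the regularized kernels: for e > 0 they are bounded, because |z-x| and |z| do not vanish
    together, so single differences can be integrated, inverted and compared pointwise; second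
    differences return only in the limit e -> 0, with a factor 1/2.

    The coordinates t (1, w) on R^N play the role of polar coordinates. A line through the origin is
    then described by t alone, so the reduction to lines and the inversion both become one-variable
    statements, joined by Tonelli. This is also why the superharmonicity of g is first stated as a
    comparison between the integrals of the positive and of the negative part of its second
    difference: both make sense before any integrability is known. *)

Ltac mfun_step :=
  lazymatch goal with
  | |- measurable_fun _ (fun x => x) => exact: measurable_id
  | |- measurable_fun _ (fun x => EFin (@?f x)) =>
      apply/measurable_EFinP; change (measurable_fun setT f)
  | |- measurable_fun _ (fun x => if _ then _ else _) => apply: measurable_fun_ifT
  | |- measurable_fun _ (fun x => (@?f x && @?g x)) => refine (@measurable_and _ _ _ f g _ _)
  | |- measurable_fun _ (fun x => (@?f x < @?g x)%R) => refine (@measurable_fun_ltr _ _ _ _ f g _ _)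
  | |- measurable_fun _ (fun x => (@?f x <= @?g x)%R) => refine (@measurable_fun_ler _ _ _ _ f g _ _)
  | |- measurable_fun _ (fun x => (@?f x + - @?g x)%R) => refine (@measurable_funB _ _ _ _ f g _ _)
  | |- measurable_fun _ (fun x => (@?f x + @?g x)%R) => first [refine (@measurable_funD _ _ _ _ f g _ _)
      | refine (@emeasurable_funD _ _ _ _ f g _ _)]
  | |- measurable_fun _ (fun x => (@?f x * @?g x)%R) => first [refine (@measurable_funM _ _ _ _ f g _ _)
      | refine (@emeasurable_funM _ _ _ _ f g _ _)]
  | |- measurable_fun _ (fun x => (Num.max (@?f x) (@?g x))%R) => refine (@measurable_maxr _ _ _ _ f g _ _)
  | |- measurable_fun _ (fun x => (powR (@?f x) ?a)) =>
      refine (measurableT_comp (measurable_powR a) (_ : measurable_fun setT f))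
  | |- measurable_fun _ (fun x => (@?f x * @?g x)%E) => refine (@emeasurable_funM _ _ _ _ f g _ _)
  | |- measurable_fun _ (fun x => (@?f x + @?g x)%E) => refine (@emeasurable_funD _ _ _ _ f g _ _)
  | |- measurable_fun _ (fun x => _) => first [exact: measurable_cst | eassumption]
  | |- measurable_fun _ _ =>
      first [eassumption | apply: measurable_fun_ltr | apply: measurable_fun_ler]
  end.
Ltac mfun := repeat (mfun_step; cbv beta).

(** * Change of variables on the line *)

Section integral_setT.
Local Open Scope ereal_scope.
Context d (T : measurableType d) (R : realType).
Variable mu : {measure set T -> \bar R}.

Lemma ge0_integralMl (k : R) (f : T -> \bar R) : (0 <= k)%R ->
  measurable_fun setT f -> (forall x, 0 <= f x) ->
  \int[mu]_x (k%:E * f x) = k%:E * \int[mu]_x f x.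
Proof. by move=> k0 mf f0; rewrite ge0_integralZl. Qed.

Lemma ge0_integralMr (k : R) (f : T -> \bar R) : (0 <= k)%R ->
  measurable_fun setT f -> (forall x, 0 <= f x) ->
  \int[mu]_x (f x * k%:E) = (\int[mu]_x f x) * k%:E.
Proof. by move=> k0 mf f0; rewrite ge0_integralZr. Qed.

Lemma ge0_leT_integral (f g : T -> \bar R) :
  measurable_fun setT f -> measurable_fun setT g -> (forall x, 0 <= f x) ->
  (forall x, f x <= g x) -> \int[mu]_x f x <= \int[mu]_x g x.
Proof.
move=> mf mg f0 fg; apply: ge0_le_integral => // x _; exact: le_trans (fg x).
Qed.

(** Monotone convergence in the form that removes cutoffs: a bound that is uniform over increasing
    truncations passes to the whole integral. *)
Lemma ge0_integral_exhaust (f : T -> \bar R) (S : nat -> T -> bool) (M : \bar R) :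
  measurable_fun setT f -> (forall x, 0 <= f x) ->
  (forall m, measurable_fun setT (S m)) ->
  (forall m x, S m x -> S m.+1 x) ->
  (forall x, f x != 0 -> exists m, S m x) ->
  (forall m, \int[mu]_x (if S m x then f x else 0) <= M) ->
  \int[mu]_x f x <= M.
Proof.
move=> mf f0 mS ndS covS SM.
pose g m x := if S m x then f x else 0.
have mono m n x : (m <= n)%N -> S m x -> S n x.
  by move=> mn Sm; rewrite -(subnK mn); elim: (n - m)%N => //= k IH; exact: ndS.
have nd x : nondecreasing_seq (g ^~ x).
  by move=> m n mn; rewrite /g; case: ifPn => [/(mono _ _ _ mn) ->//|_]; case: ifPn.
have gf x : f x = limn (g ^~ x).
  apply/esym/cvg_lim => //; have [fx0|/covS[m Sm]] := eqVneq (f x) 0.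
    rewrite fx0; apply: cvg_near_cst; apply: nearW => n.
    by rewrite /g fx0; case: ifPn.
  apply: cvg_near_cst; exists m => // n /= mn.
  by rewrite /g (mono _ _ _ mn Sm).
under eq_integral do rewrite gf.
rewrite monotone_convergence//.
- apply: lime_le; last by apply: nearW.
  apply: ereal_nondecreasing_is_cvgn => m n mn; apply: ge0_leT_integral.
  + exact: measurable_fun_ifT.
  + exact: measurable_fun_ifT.
  + by move=> x; rewrite /g; case: ifPn.
  + by move=> x; exact: nd.
- by move=> n; exact: measurable_fun_ifT.
- by move=> n x _; rewrite /g; case: ifPn.
Qed.

End integral_setT.

Section change_of_variable.
Local Open Scope ereal_scope.
Context d1 d2 (T1 : measurableType d1) (T2 : measurableType d2) (R : realType).
Variables (mu : {measure set T1 -> \bar R}) (nu : {measure set T2 -> \bar R}).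
Variables (phi : T1 -> T2) (w : T1 -> R).
Hypothesis mphi : measurable_fun setT phi.
Hypothesis mw : measurable_fun setT w.
Hypothesis w0 : forall x, (0 <= w x)%R.

Import HBNNSimple.

Lemma measurable_weighted (F : T2 -> \bar R) : measurable_fun setT F ->
  measurable_fun setT (fun x => F (phi x) * (w x)%:E).
Proof.
move=> mF; apply: emeasurable_funM; first exact: measurableT_comp.
exact/measurable_EFinP.
Qed.

(** The hypothesis says that [phi] pushes the measure of density [w] forward to [nu]. Linearity
    extends it from indicators to simple functions, and monotone convergence to [F]. *)
Lemma ge0_integral_change :
  (forall A, measurable A -> \int[mu]_x (\1_A (phi x) * w x)%:E = nu A) ->
  forall F : T2 -> \bar R, measurable_fun setT F -> (forall y, 0 <= F y) ->
  \int[mu]_x (F (phi x) * (w x)%:E) = \int[nu]_y F y.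
Proof.
move=> H F mF F0; pose h := nnsfun_approx measurableT mF.
have nF y : F y = limn (fun n => (h n y)%:E).
  by apply/esym/cvg_lim => //; apply: cvg_nnsfun_approx.
have mono y : nondecreasing_seq (fun n => (h n y)%:E).
  by move=> a b ab; rewrite lee_fin; exact/lefP/nd_nnsfun_approx.
have ch y : cvgn (fun n => (h n y)%:E) by apply: ereal_nondecreasing_is_cvgn.
under [RHS]eq_integral do rewrite nF.
rewrite monotone_convergence//; last 2 first.
  - by move=> n; exact/measurable_EFinP.
  - by move=> n y _; rewrite lee_fin.
under eq_integral do rewrite nF -limeMr//.
rewrite monotone_convergence//; last 3 first.
  - move=> n; apply: (@measurable_weighted (EFin \o h n)).
    exact/measurable_EFinP.
  - by move=> n y _; rewrite mule_ge0// lee_fin.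
  - by move=> x _ a b ab; apply: lee_wpmul2r; [rewrite lee_fin|exact: mono].
apply/congr_lim/funext => n.
under [LHS]eq_integral.
  move=> x _; rewrite fimfunE -fsumEFin// ge0_mule_fsuml; last first.
    by move=> r; rewrite EFinM nnfun_muleindic_ge0.
  over.
rewrite /=.
under [RHS]eq_integral do rewrite fimfunE -fsumEFin//.
rewrite !ge0_integral_fsum//; last first.
- by move=> r x _; rewrite mule_ge0 ?lee_fin// -lee_fin EFinM nnfun_muleindic_ge0.
- move=> r; apply: (@measurable_weighted (fun y => (r * \1_(h n @^-1` [set r]) y)%:E)).
  by apply/measurable_EFinP; exact: measurable_funM.
- by move=> r y _; rewrite EFinM nnfun_muleindic_ge0.
- by move=> r; apply/measurable_EFinP; exact: measurable_funM.
apply: eq_fsbigr => r /[!inE] -[y _ <-].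
have r0 : (0 <= h n y)%R by [].
set A := (_ @^-1` _); have mA : measurable A by exact: measurable_sfunP.
under eq_integral do rewrite -EFinM -mulrA EFinM.
under [RHS]eq_integral do rewrite EFinM.
rewrite !ge0_integralZl//; last first.
- exact/measurable_EFinP.
- by move=> *; rewrite lee_fin mulr_ge0.
- apply: (@measurable_weighted (fun y => (\1_A y)%:E)).
  exact/measurable_EFinP.
by rewrite integral_indic// setIT H.
Qed.
End change_of_variable.

Section lebesgue_change.
Local Open Scope ereal_scope.
Context (R : realType).
Notation mu := (@lebesgue_measure R).
Variables (phi : measurableTypeR R -> measurableTypeR R) (w : measurableTypeR R -> R).
Hypothesis mphi : measurable_fun setT phi.
Hypothesis mw : measurable_fun setT w.
Hypothesis w0 : forall x, (0 <= w x)%R.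

Let nu (A : set (measurableTypeR R)) : \bar R := \int[mu]_x (\1_A (phi x) * w x)%:E.

Let nu0 : nu set0 = 0.
Proof. by apply: integral0_eq => x _; rewrite indic0 mul0r. Qed.

Let nu_ge0 A : 0 <= nu A.
Proof. by apply: integral_ge0 => x _; rewrite lee_fin mulr_ge0. Qed.

Let nu_sigma : semi_sigma_additive nu.
Proof.
move=> A mA tA mU.
have mt i : measurable_fun setT (fun x => (\1_(A i) (phi x) * w x)%:E).
  by apply: (measurable_weighted mphi mw (F := fun y => (\1_(A i) y)%:E));
    exact/measurable_EFinP/measurable_indic.
rewrite [X in _ --> X](_ : _ = \sum_(i <oo) nu (A i)).
  by apply: is_cvg_nneseries => n _ _; exact: nu_ge0.
rewrite /nu -integral_nneseries//; last first.
  by move=> *; rewrite lee_fin mulr_ge0.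
apply: eq_integral => x _; rewrite /= !indicE.
have [|nA] := boolP (phi x \in \bigcup_n A n).
  rewrite inE => -[i _ Ai].
  rewrite (nneseriesD1 (n := i))//=; last by move=> *; rewrite lee_fin mulr_ge0.
  rewrite indicE mem_set// mul1r eseries0 ?adde0//.
  move=> k _ ki; rewrite indicE memNset ?mul0r// => Ak.
  by move/eqP: ki; apply; apply: (tA k i) => //; exists (phi x).
rewrite mul0r eseries0// => k _ _; rewrite indicE memNset ?mul0r// => Ak.
by move/negP: nA; apply; rewrite inE; exists k.
Qed.

HB.instance Definition _ := isMeasure.Build _ _ _ nu nu0 nu_ge0 nu_sigma.

(** The pushforward [nu] of the density [w] is a measure, and Lebesgue measure is determined by its
    values on the intervals []a, b]]. *)
Lemma lebesgue_change :
  (forall a b : R, (a < b)%R ->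
    \int[mu]_x (\1_(`]a, b]%classic) (phi x) * w x)%:E = (b - a)%:E) ->
  forall F : measurableTypeR R -> \bar R, measurable_fun setT F -> (forall y, 0 <= F y) ->
  \int[mu]_x (F (phi x) * (w x)%:E) = \int[mu]_y F y.
Proof.
move=> H; apply: ge0_integral_change => // A mA; apply/esym.
apply: (@lebesgue_measure_unique R nu) => // _ [[a b] /= _ <-].
rewrite lebesgue_measure_itv/= lte_fin; case: ltP => ab.
  by rewrite /nu H// EFinB.
rewrite set_itv_ge; last by rewrite bnd_simp -leNgt.
by rewrite -/(nu set0) nu0.
Qed.
End lebesgue_change.

Section lebesgue_affine.
Local Open Scope ereal_scope.
Context (R : realType).
Notation mu := (@lebesgue_measure R).

Lemma ge0_integral_affine (c a : R) (F : measurableTypeR R -> \bar R) : c != 0%R ->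
  measurable_fun setT F -> (forall y, 0 <= F y) ->
  \int[mu]_x (F (c * x + a)%R * `|c|%:E) = \int[mu]_y F y.
Proof.
move=> c0 mF F0.
have mphi : measurable_fun setT (fun x : measurableTypeR R => c * x + a : measurableTypeR R)%R.
  by apply: measurable_funD => //; exact: measurable_funM.
apply: (@lebesgue_change R (fun x => c * x + a)%R (fun=> `|c|%R)) => // u v uv.
under eq_integral do rewrite EFinM muleC.
rewrite ge0_integralMl//; last first.
  have mI : measurable_fun setT (\1_(`]u, v]%classic) : measurableTypeR R -> R).
    exact: measurable_indic.
  by apply/measurable_EFinP; exact: (measurableT_comp mI mphi).
have [cp|cn] := ltP 0%R c.
  rewrite (_ : (fun x => _) = (fun x => (\1_(`](u - a) / c, (v - a) / c]%classic) x)%:E)%R); last first.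
    apply/funext => x; rewrite !indicE; congr ((_ : bool)%:R%:E).
    apply/idP/idP; rewrite !inE /= !in_itv/=;
    rewrite ltr_pdivrMr// ler_pdivlMr// ltrBlDr lerBrDr mulrC //.
  rewrite integral_indic// setIT /= lebesgue_measure_itv/= lte_fin ifT; last first.
    by rewrite ltr_pM2r ?invr_gt0// ltrD2r.
  by rewrite -EFinB -EFinM gtr0_norm//; congr EFin; field.
have {}cn : (c < 0)%R by rewrite lt_neqAle c0.
rewrite (_ : (fun x => _) = (fun x => (\1_(`[(v - a) / c, (u - a) / c[%classic) x)%:E)%R); last first.
  apply/funext => x; rewrite !indicE; congr ((_ : bool)%:R%:E).
  apply/idP/idP; rewrite !inE /= !in_itv/=;
  rewrite ltr_ndivlMr// ler_ndivrMr// ltrBlDr lerBrDr mulrC andbC//.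
rewrite integral_indic// setIT /= lebesgue_measure_itv/= lte_fin ifT; last first.
  by rewrite ltr_nM2r ?invr_lt0// ltrD2r.
by rewrite -EFinB -EFinM ltr0_norm//; congr EFin; field.
Qed.
End lebesgue_affine.

Section lebesgue_inversion.
Local Open Scope ereal_scope.
Context (R : realType).
Notation mu := (@lebesgue_measure R).

Lemma integral_inv_sqr (c a : R) : (0 < c)%R -> (0 < a)%R ->
  \int[mu]_(t in `[a, +oo[) (c / t ^+ 2)%:E = (c / a)%:E.
Proof.
move=> c0 a0.
have dF (t : R) : (0 < t)%R -> is_derive t (1 : R)%R (fun t : R => - (c * t^-1))%R (c / t ^+ 2)%R.
  move=> t0; have tn0 : t != 0%R by rewrite gt_eqF.
  have H1 := @is_deriveV R id t (1 : R)%R (1 : R)%R tn0 (is_derive_id t (1 : R)%R).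
  have H2 := is_deriveN (is_deriveZ c H1).
  refine (is_derive_eq H2 _).
  by rewrite /GRing.scale/= mulr1 mulrN opprK.
rewrite (@ge0_continuous_FTC2y R (fun t => c / t ^+ 2)%R (fun t => - (c * t^-1))%R a 0)//.
- by rewrite -EFinB sub0r opprK.
- by move=> x ax; rewrite divr_ge0 ?exprn_ge0 ?ltW// (lt_le_trans a0).
- apply: continuous_in_subspaceT => x; rewrite inE/= in_itv/= andbT => ax.
  have x0 : (0 < x)%R by exact: lt_le_trans ax.
  apply: cvgM; first exact: cvg_cst.
  apply: cvgV; first by rewrite sqrf_eq0 gt_eqF.
  exact: exprn_continuous.
- rewrite -oppr0; apply: cvgN; rewrite -(mulr0 c); apply: cvgM; first exact: cvg_cst.
  by apply/gtr0_cvgV0 => //; exact: nbhs_pinfty_gt.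
- by move=> x ax; have := dF x (lt_trans a0 ax); case.
- apply: cvg_at_right_filter; apply: cvgN; apply: cvgM; first exact: cvg_cst.
  by apply: cvgV; [rewrite gt_eqF|exact: cvg_id].
- move=> x; rewrite in_itv/= andbT => ax; rewrite derive1E.
  by have := dF x (lt_trans a0 ax); case.
Qed.

Lemma measurable_invr : measurable_fun setT (fun x : measurableTypeR R => x^-1)%R.
Proof.
rewrite (_ : (fun _ => _) = fun x : measurableTypeR R =>
    (if 0 < x then x `^ (-1) else if x < 0 then - ((- x) `^ (-1)) else 0))%R.
  apply: measurable_fun_ifT; first exact: measurable_fun_ltr.
    exact: measurable_powR.
  apply: measurable_fun_ifT => //; first exact: measurable_fun_ltr.
  apply: measurableT_comp => //.
  by apply: (measurableT_comp (measurable_powR (-1)%R)).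
apply/funext => x; case: ltgtP => x0; last by rewrite -x0 invr0.
  by rewrite powR_inv1 ?ltW.
by rewrite powR_inv1 ?oppr_ge0 ?ltW// invrN opprK.
Qed.

Let w (c t : R) : R := (if 0 < t then c / t ^+ 2 else 0)%R.

Let w_ge0 c t : (0 < c)%R -> (0 <= w c t)%R.
Proof. by move=> c0; rewrite /w; case: ifPn => // t0; rewrite divr_ge0 ?sqr_ge0// ltW. Qed.

Let measurable_w c : measurable_fun setT (w c : measurableTypeR R -> R).
Proof.
apply: measurable_fun_ifT => //; first exact: measurable_fun_ltr.
apply: measurable_funM => //.
by apply: (measurableT_comp measurable_invr); exact: measurable_funX.
Qed.

(** Under [x |-> c / x] the interval []a, b]] corresponds to the tail from [c / b] minus the tail
    from [c / a], whose weighted integrals are [b] and [a]. The difference is written as a sum and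
    cancelled at the end, since the values are extended reals. *)
Lemma integral_inv_pos (c a b : R) : (0 < c)%R -> (0 <= a < b)%R ->
  \int[mu]_x (\1_(`]a, b]%classic) (c / x) * w c x)%:E = (b - a)%:E.
Proof.
move=> c0 /andP[a0 ab]; have b0 : (0 < b)%R by exact: le_lt_trans ab.
have tail (d : R) : (0 < d)%R -> \int[mu]_x (\1_(`[c / d, +oo[%classic) x * w c x)%:E = d%:E.
  move=> d0; have cd : (0 < c / d)%R by rewrite divr_gt0.
  rewrite [RHS](_ : _ = (c / (c / d))%:E); last by congr EFin; field; rewrite !gt_eqF.
  rewrite -integral_inv_sqr// [RHS]integral_mkcond.
  apply: eq_integral => x _; rewrite patchE indicE mem_setE in_itv/= andbT.
  case: ifPn => xd; last by rewrite mul0r.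
  by rewrite mul1r /w (lt_le_trans cd xd).
have mt (d : R) : measurable_fun setT (fun x : measurableTypeR R => (\1_(`[c / d, +oo[%classic) x * w c x)%:E).
  by apply/measurable_EFinP; apply: measurable_funM => //; exact: measurable_indic.
have mab : measurable_fun setT (fun x : measurableTypeR R => (\1_(`]a, b]%classic) (c / x) * w c x)%:E).
  apply/measurable_EFinP; apply: measurable_funM => //.
  have mI : measurable_fun setT (\1_(`]a, b]%classic) : measurableTypeR R -> R).
    exact: measurable_indic.
  apply: (measurableT_comp mI); apply: measurable_funM => //.
  exact: measurable_invr.
have cx (d x : R) : (0 < d)%R -> (0 < x)%R -> (c / x <= d)%R = (c / d <= x)%R.
  by move=> d0 x0; rewrite !ler_pdivrMr// mulrC.
move: a0; rewrite le_eqVlt => /predU1P[a0|a0].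
  subst a; rewrite subr0 -(tail b b0); apply: eq_integral => x _; congr EFin.
  rewrite /w; case: ifPn => x0; last by rewrite !mulr0.
  congr (_ * _)%R; rewrite !indicE; congr ((nat_of_bool _)%:R).
  by apply/idP/idP; rewrite !inE/= !in_itv/= divr_gt0//= andbT cx.
have E : \int[mu]_x (\1_(`[(c / b)%R, +oo[%classic) x * w c x)%:E =
    \int[mu]_x (\1_(`]a, b]%classic) (c / x) * w c x)%:E +
    \int[mu]_x (\1_(`[(c / a)%R, +oo[%classic) x * w c x)%:E.
  rewrite -ge0_integralD//; last 2 first.
  - by move=> x _; rewrite lee_fin mulr_ge0 ?w_ge0.
  - by move=> x _; rewrite lee_fin mulr_ge0 ?w_ge0.
  apply: eq_integral => x _; rewrite -EFinD -mulrDl; congr EFin.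
  rewrite /w; case: ifPn => x0; last by rewrite !mulr0.
  congr (_ * _)%R; rewrite !indicE !mem_setE !in_itv/= !andbT -(cx b x)//.
  have [h|h] := leP (c / a)%R x.
    have h1 : (c / x <= a)%R by rewrite cx.
    by rewrite (le_trans h1 (ltW ab)) ltNge h1/= add0r.
  rewrite (_ : a < c / x)%R; last by rewrite ltNge cx// -ltNge.
  by rewrite addr0.
move: E; rewrite !tail//; set I := integral _ _ _; case: I => //= r.
by rewrite -EFinD => -[->]; rewrite addrK.
Qed.

Let measurable_divc c : measurable_fun setT (fun x : measurableTypeR R => c / x : measurableTypeR R)%R.
Proof. by apply: measurable_funM => //; exact: measurable_invr. Qed.

Lemma ge0_integral_inv_pos (c : R) (F : measurableTypeR R -> \bar R) : (0 < c)%R ->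
  measurable_fun setT F -> (forall y, 0 <= F y) ->
  \int[mu]_x (F (c / x)%R * (if (0 < x)%R then (c / x ^+ 2)%:E else 0)) =
  \int[mu]_x (if (0 < x)%R then F x else 0).
Proof.
move=> c0 mF F0.
(* The identity with weight 1 fills in [x <= 0], so that all of Lebesgue measure is transported; an
   interval is then cut at 0 into a part for [integral_inv_pos] and a part left in place. *)
pose phi (x : measurableTypeR R) : measurableTypeR R := (if 0 < x then c / x else x)%R.
pose v (x : measurableTypeR R) : R := (if 0 < x then c / x ^+ 2 else 1)%R.
have mpos : measurable_fun setT (fun x : measurableTypeR R => (0 < x)%R).
  exact: measurable_fun_ltr.
have mphi : measurable_fun setT phi by exact: measurable_fun_ifT.
have mv : measurable_fun setT v.
  apply: measurable_fun_ifT => //; apply: measurable_funM => //.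
  by apply: (measurableT_comp measurable_invr); exact: measurable_funX.
have v0 x : (0 <= v x)%R.
  by rewrite /v; case: ifPn => // x0; rewrite divr_ge0 ?sqr_ge0// ltW.
pose G (x : measurableTypeR R) : \bar R := if (0 < x)%R then F x else 0.
have mG : measurable_fun setT G by exact: measurable_fun_ifT.
have G0 x : 0 <= G x by rewrite /G; case: ifPn.
rewrite -/(integral mu setT G) -(@lebesgue_change R phi v mphi mv v0 _ G mG G0).
  apply: eq_integral => x _; rewrite /G /phi /v.
  by case: ltP => x0; rewrite ?divr_gt0// ltNge x0 /= mule0 mul0e.
move=> a b ab.
pose f1 (x : measurableTypeR R) : \bar R := (\1_(`]Num.max a 0, Num.max b 0]%classic) (c / x) * w c x)%:E%R.
pose f2 (x : measurableTypeR R) : \bar R := (\1_(`]Num.min a 0, Num.min b 0]%classic) x)%:E%R.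
have mf1 : measurable_fun setT f1.
  apply/measurable_EFinP; apply: measurable_funM => //.
  have mI : measurable_fun setT (\1_(`]Num.max a 0, Num.max b 0]%classic) : measurableTypeR R -> R)%R.
    exact: measurable_indic.
  exact: (measurableT_comp mI).
rewrite (_ : \int[mu]_x _ = \int[mu]_x (f1 x + f2 x)); last first.
  apply: eq_integral => x _; rewrite -EFinD /phi /v /w; congr EFin.
  rewrite !indicE !mem_setE !in_itv/=.
  case: ifPn => x0.
    have -> : (x <= Num.min b 0)%R = false by rewrite le_min [X in _ && X]leNgt x0 andbF.
    rewrite andbF addr0; congr (_ * _)%R; congr ((nat_of_bool _)%:R).
    have cx0 : (0 < c / x)%R by rewrite divr_gt0.
    by rewrite gt_max le_max cx0 andbT [X in _ || X]leNgt cx0 orbF.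
  rewrite mulr0 add0r mulr1; congr ((nat_of_bool _)%:R).
  rewrite -leNgt in x0; rewrite gt_min le_min x0 andbT.
  case: (ltP a x) => //= ax; case: (ltP 0%R x) => //= xlt0.
    by move: (lt_le_trans xlt0 x0); rewrite ltxx.
have f10 x : 0 <= f1 x by rewrite lee_fin mulr_ge0 ?w_ge0.
have f20 x : 0 <= f2 x by rewrite lee_fin.
have mf2 : measurable_fun setT f2 by apply/measurable_EFinP; exact: measurable_indic.
rewrite ge0_integralD//.
have -> : \int[mu]_x f2 x = (Num.min b 0 - Num.min a 0)%:E%R.
  rewrite integral_indic// setIT/= lebesgue_measure_itv/= lte_fin EFinB.
  case: ltP => // h; have -> : Num.min b 0%R = Num.min a 0%R.
    by apply/eqP; rewrite eq_le h /= le_min !ge_min lexx (ltW ab) orbT.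
  by rewrite -EFinB subrr.
have -> : \int[mu]_x f1 x = (Num.max b 0 - Num.max a 0)%:E%R.
  have [h|h] := ltP (Num.max a 0)%R (Num.max b 0)%R.
    by rewrite /f1 integral_inv_pos// h andbT le_max lexx orbT.
  have e : Num.max b 0%R = Num.max a 0%R.
    by apply/eqP; rewrite eq_le h /= ge_max !le_max lexx (ltW ab) orbT.
  rewrite e subrr; apply: integral0_eq => x _.
  rewrite /f1 e indicE mem_setE in_itv/=.
  by case: ltP; case: leP => //; rewrite ?mul0r// => u v'; move: (le_lt_trans u v'); rewrite ltxx.
rewrite -EFinD; congr EFin; rewrite addrACA -opprD.
by rewrite (addrC (Num.max b 0%R)) (addrC (Num.max a 0%R)) !addr_min_max !addr0.
Qed.

Lemma ge0_integral_half_lines (G : measurableTypeR R -> \bar R) :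
  measurable_fun setT G -> (forall x, 0 <= G x) ->
    \int[mu]_x G x = \int[mu]_x (if (0 < x)%R then G x else 0) +
                     \int[mu]_x (if (0 < x)%R then G (- x)%R else 0).
Proof.
move=> mG G0.
have mpos : measurable_fun setT (fun x : measurableTypeR R => (0 < x)%R).
  exact: measurable_fun_ltr.
have mneg : measurable_fun setT (fun x : measurableTypeR R => (x < 0)%R).
  exact: measurable_fun_ltr.
have mN : measurable_fun setT (fun x : measurableTypeR R => - x : measurableTypeR R)%R.
  exact: oppr_measurable.
have mGN : measurable_fun setT (fun x : measurableTypeR R => G (- x)%R).
  exact: (measurableT_comp mG mN).
have E : \int[mu]_x (if (0 < x)%R then G (- x)%R else 0) =
    \int[mu]_x (if (x < 0)%R then G x else 0).
  have N1 : (-1 != 0 :> R)%R by rewrite oppr_eq0 oner_eq0.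
  have mG' : measurable_fun setT (fun x : measurableTypeR R => if (x < 0)%R then G x else 0).
    exact: measurable_fun_ifT.
  rewrite -[RHS](ge0_integral_affine 0%R N1 mG'); last by move=> y; case: ifPn.
  apply: eq_integral => x _.
  by rewrite normrN1 mule1 addr0 mulN1r oppr_lt0.
have mGp : measurable_fun setT (fun x : measurableTypeR R => if (0 < x)%R then G x else 0).
  exact: measurable_fun_ifT.
have mGn : measurable_fun setT (fun x : measurableTypeR R => if (x < 0)%R then G x else 0).
  exact: measurable_fun_ifT.
rewrite E -ge0_integralD//; [|by move=> x _; case: ifPn..].
have mG2 : measurable_fun setT (fun x : measurableTypeR R =>
    (if (0 < x)%R then G x else 0) + (if (x < 0)%R then G x else 0)).
  exact: emeasurable_funD.
rewrite -(@integral_setD1 _ _ 0%R)//; last 2 first.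
- exact: measurableD.
- exact: measurable_funTS.
rewrite -[RHS](@integral_setD1 _ _ 0%R)//; last 2 first.
- exact: measurableD.
- exact: measurable_funTS.
apply: eq_integral => x /[!inE] -[_ /= /eqP x0].
by move: x0; case: ltgtP => //; rewrite ?adde0 ?add0e.
Qed.

Lemma ge0_integral_inv (c : R) (F : measurableTypeR R -> \bar R) : (0 < c)%R ->
  measurable_fun setT F -> (forall y, 0 <= F y) ->
  \int[mu]_x (F (c / x)%R * (c / x ^+ 2)%:E) = \int[mu]_x F x.
Proof.
move=> c0 mF F0.
have mv : measurable_fun setT (fun x : measurableTypeR R => (c / x ^+ 2)%:E).
  apply/measurable_EFinP; apply: measurable_funM => //.
  by apply: (measurableT_comp measurable_invr); exact: measurable_funX.
have v0 (x : R) : 0 <= (c / x ^+ 2)%:E by rewrite lee_fin divr_ge0 ?sqr_ge0// ltW.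
have mN : measurable_fun setT (fun x : measurableTypeR R => - x : measurableTypeR R)%R.
  exact: oppr_measurable.
have mFc : measurable_fun setT (fun x : measurableTypeR R => F (c / x)%R).
  exact: (measurableT_comp mF (measurable_divc c)).
have mFN : measurable_fun setT (fun x : measurableTypeR R => F (- x)%R).
  exact: (measurableT_comp mF mN).
rewrite ge0_integral_half_lines//; last 2 first.
- exact: emeasurable_funM.
- by move=> x; rewrite mule_ge0.
rewrite [RHS]ge0_integral_half_lines//; congr (_ + _).
  rewrite -[RHS](ge0_integral_inv_pos c0 mF F0); apply: eq_integral => x _.
  by case: ifPn => // _; rewrite mule0.
rewrite -[RHS](ge0_integral_inv_pos c0 mFN)//.
apply: eq_integral => x _.
by case: ifPn => // _; rewrite ?mule0// sqrrN invrN mulrN.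
Qed.

End lebesgue_inversion.

(** * Lebesgue measure on row vectors *)

Section rV_integral.
Local Open Scope ereal_scope.
Context (R : realType).
Notation mu := (@lebesgue_measure R).
Notation leb n := (@lebesgue_rV R n).

Lemma eq_integral_ex1 (f g : measurableTypeR R -> \bar R) (r : R) :
  measurable_fun setT f -> measurable_fun setT g ->
  (forall x, x != r -> f x = g x) -> \int[mu]_x f x = \int[mu]_x g x.
Proof.
move=> mf mg fg.
rewrite -(@integral_setD1 _ _ r)//; last 2 first.
- exact: measurableD.
- exact: measurable_funTS.
rewrite -[RHS](@integral_setD1 _ _ r)//; last 2 first.
- exact: measurableD.
- exact: measurable_funTS.
by apply: eq_integral => x /[!inE] -[_ /= /eqP]; exact: fg.
Qed.

Lemma rV_unconsK n : cancel (@rV_uncons R n) (@rV_cons R n).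
Proof.
move=> v; apply/rowP => i; have [j|j] := split_ordP (i : 'I_(1 + n)).
  move=> ->; rewrite (_ : lshift n j = 0%R :> 'I_n.+1) ?rV_cons0 //.
  by case: j => -[] // ?; exact: val_inj.
by move=> ->; rewrite rV_consS mxE.
Qed.

Lemma ge0_integral_cons n (F : 'rV[R]_n.+1 -> \bar R) :
  measurable_fun setT F -> (forall v, 0 <= F v) ->
  \int[leb n.+1]_v F v = \int[mu]_t \int[leb n]_w F (rV_cons (t, w)).
Proof.
move=> mF F0.
pose nu := measure_function_pushforward__canonical__measure_function_Measure
  (mu \x leb n)%E (@measurable_rV_cons R n).
transitivity (\int[nu]_v F v); first by apply: eq_measure_integral.
rewrite (ge0_integral_pushforward (@measurable_rV_cons R n))//.
rewrite preimage_setT fubini_tonelli1//.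
  by apply: measurableT_comp => //; exact: measurable_rV_cons.
by move=> x; exact: F0.
Qed.

Lemma measurable_rV_affine n (c : R) (a : 'rV[R]_n) :
  measurable_fun setT (fun v : 'rV[R]_n => c *: v + a)%R.
Proof.
apply: measurable_fun_rVP => i.
rewrite (_ : (fun _ => _) = fun v : 'rV[R]_n => c * v 0 i + a 0 i)%R.
  by apply: measurable_funD => //; apply: measurable_funM => //; exact: measurable_coord.
by apply/funext => v; rewrite !mxE.
Qed.

Lemma measurable_rV_addl n (x : 'rV[R]_n) :
  measurable_fun setT (fun y : 'rV[R]_n => x + y)%R.
Proof.
rewrite (_ : (fun y => _) = fun y => 1 *: y + x)%R; first exact: measurable_rV_affine.
by apply/funext => y; rewrite scale1r addrC.
Qed.

Lemma measurable_rV_subl n (x : 'rV[R]_n) :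
  measurable_fun setT (fun y : 'rV[R]_n => x - y)%R.
Proof.
rewrite (_ : (fun y => _) = fun y => -1 *: y + x)%R; first exact: measurable_rV_affine.
by apply/funext => y; rewrite scaleN1r addrC.
Qed.

Lemma rV_cons_affine n (c t a : R) (w b : 'rV[R]_n) :
  (c *: rV_cons (t, w) + rV_cons (a, b) = rV_cons (c * t + a, c *: w + b))%R.
Proof.
have S k (A B : 'rV[R]_k) i : ((c *: A + B) 0 i = c * A 0 i + B 0 i)%R.
  by rewrite !mxE.
apply/rowP => i; rewrite S; have [j|j] := split_ordP (i : 'I_(1 + n)).
  have -> : lshift n j = 0%R :> 'I_n.+1 by apply: val_inj; case: j => -[].
  by move=> ->; rewrite !rV_cons0.
by move=> ->; rewrite !rV_consS S.
Qed.

Lemma measurable_cons_section n (F : 'rV[R]_n.+1 -> \bar R) t :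
  measurable_fun setT F -> measurable_fun setT (fun w => F (rV_cons (t, w))).
Proof.
move=> mF; apply: (measurableT_comp mF).
exact: (measurableT_comp (@measurable_rV_cons R n) (pair1_measurable t)).
Qed.

Lemma measurable_integral_section n (F : 'rV[R]_n.+1 -> \bar R) :
  measurable_fun setT F -> (forall v, 0 <= F v) ->
  measurable_fun setT (fun t : measurableTypeR R => \int[leb n]_w F (rV_cons (t, w))).
Proof.
move=> mF F0; apply: (@measurable_fun_fubini_tonelli_F _ _ _ _ _ (leb n)
   (fun p => F (rV_cons p))) => //.
exact: (measurableT_comp mF (@measurable_rV_cons R n)).
Qed.

Lemma ge0_integral_rV_affine n (c : R) (a : 'rV[R]_n) (F : 'rV[R]_n -> \bar R) :
  c != 0%R -> measurable_fun setT F -> (forall v, 0 <= F v) ->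
  \int[leb n]_v (F (c *: v + a)%R * (`|c| ^+ n)%:E) = \int[leb n]_v F v.
Proof.
move=> c0; elim: n => [|n IH] in a F *; move=> mF F0.
  rewrite expr0; apply: eq_integral => v _; rewrite mule1; congr F.
  by apply/rowP => -[].
have mFa : measurable_fun setT (fun v : 'rV[R]_n.+1 => F (c *: v + a)%R).
  exact: (measurableT_comp mF (measurable_rV_affine c a)).
have cn0 k : (0 <= `|c| ^+ k)%R by rewrite exprn_ge0.
rewrite ge0_integralMr// (ge0_integral_cons mFa)// (ge0_integral_cons mF)//.
have mI := measurable_integral_section mFa (fun=> F0 _).
move: mFa mI; rewrite -[a]rV_unconsK; case: (rV_uncons a) => a0 b mFa mI.
rewrite -ge0_integralMr//; last by move=> t; apply: integral_ge0.
rewrite -[RHS](ge0_integral_affine a0 c0)//; last 2 first.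
- exact: measurable_integral_section.
- by move=> t; apply: integral_ge0.
apply: eq_integral => t _; rewrite exprSr EFinM muleA; congr (_ * _).
rewrite -ge0_integralMr//; last exact: (measurable_cons_section t mFa).
under eq_integral do rewrite rV_cons_affine.
by rewrite (IH b (fun w => F (rV_cons (c * t + a0, w))%R))//; exact: measurable_cons_section.
Qed.

(* Coordinates (t, w) |-> t (1, w), defined off the hyperplane y_0 = 0. *)
Definition slope n (w : 'rV[R]_n) : 'rV[R]_n.+1 := rV_cons (1%R, w).

Lemma slopeZ n t (w : 'rV[R]_n) : (t *: slope w = rV_cons (t, t *: w))%R.
Proof.
have := rV_cons_affine t 1%R 0%R w 0%R; rewrite /slope mulr1 !addr0 => <-.
rewrite (_ : rV_cons (0%R, 0%R) = 0%R) ?addr0//; apply/rowP => i.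
have [j|j] := split_ordP (i : 'I_(1 + n)) => ->.
  have -> : lshift n j = 0%R :> 'I_n.+1 by apply: val_inj; case: j => -[].
  by rewrite rV_cons0 mxE.
by rewrite rV_consS !mxE.
Qed.

Lemma measurable_slopeZ n :
  measurable_fun setT (fun p : measurableTypeR R * 'rV[R]_n => (p.1 *: slope p.2)%R).
Proof.
under eq_fun do rewrite slopeZ.
apply: (measurableT_comp (@measurable_rV_cons R n)).
apply/measurable_fun_pairP; split; first exact: measurable_fst.
apply: measurable_fun_rVP => i.
rewrite (_ : (fun _ => _) = fun p : measurableTypeR R * 'rV[R]_n => p.1 * p.2 0%R i)%R.
  apply: measurable_funM => //.
  exact: (measurableT_comp (measurable_coord i)).
by apply/funext => p; rewrite mxE.
Qed.

Lemma measurable_slope_fun n (F : 'rV[R]_n.+1 -> \bar R) :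
  measurable_fun setT F ->
  measurable_fun setT (fun p : measurableTypeR R * 'rV[R]_n =>
    F (p.1 *: slope p.2)%R * (`|p.1| ^+ n)%:E).
Proof.
move=> mF; apply: emeasurable_funM.
  exact: (measurableT_comp mF (@measurable_slopeZ n)).
apply/measurable_EFinP; apply: measurable_funX.
by apply: measurableT_comp => //.
Qed.

(** For [t] other than 0 the scaling [w |-> t w] of R^n produces the factor [|t| ^ n], and Tonelli
    exchanges the order. The inner integral runs over a whole line through the origin, with both
    signs of [t]. *)
Lemma ge0_integral_slope n (F : 'rV[R]_n.+1 -> \bar R) :
  measurable_fun setT F -> (forall v, 0 <= F v) ->
  \int[leb n.+1]_v F v =
  \int[leb n]_w \int[mu]_t (F (t *: slope w)%R * (`|t| ^+ n)%:E).
Proof.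
move=> mF F0.
have mG := measurable_slope_fun mF.
have G0 (p : measurableTypeR R * 'rV[R]_n) : 0 <= F (p.1 *: slope p.2)%R * (`|p.1| ^+ n)%:E.
  by rewrite mule_ge0// lee_fin exprn_ge0.
rewrite -(@fubini_tonelli _ _ _ _ _ mu (leb n) _ mG G0) ge0_integral_cons//.
apply: (@eq_integral_ex1 _ _ 0%R).
- exact: measurable_integral_section.
- exact: (@measurable_fun_fubini_tonelli_F _ _ _ _ _ (leb n) _ mG G0).
move=> t t0 /=; rewrite -(ge0_integral_rV_affine 0%R t0)//; last first.
  exact: measurable_cons_section.
by apply: eq_integral => w _; rewrite addr0 slopeZ.
Qed.

Definition sqn n (v : 'rV[R]_n) : R := (\sum_(i < n) v 0 i ^+ 2)%R.

Lemma sqn_ge0 n (v : 'rV[R]_n) : (0 <= sqn v)%R.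
Proof. by apply: sumr_ge0 => i _; rewrite sqr_ge0. Qed.

Lemma sqnZ n (c : R) (v : 'rV[R]_n) : (sqn (c *: v) = c ^+ 2 * sqn v)%R.
Proof. by rewrite /sqn mulr_sumr; apply: eq_bigr => i _; rewrite mxE exprMn. Qed.

Lemma sqn_slope n (w : 'rV[R]_n) : (sqn (slope w) = 1 + sqn w)%R.
Proof.
rewrite /sqn big_ord_recl rV_cons0 expr1n; congr (_ + _)%R; apply: eq_bigr => i _.
by rewrite (_ : lift ord0 i = rshift 1 i) ?rV_consS//; exact: val_inj.
Qed.

Lemma sqn_slope_gt0 n (w : 'rV[R]_n) : (0 < sqn (slope w))%R.
Proof. by rewrite sqn_slope ltr_wpDr ?sqn_ge0. Qed.

Lemma measurable_sqn n : measurable_fun setT (@sqn n : 'rV[R]_n -> R).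
Proof.
by apply: measurable_sum => i; apply: measurable_funX; exact: measurable_coord.
Qed.

(** The parameter [r] is the square of the radius; the origin goes to itself because [0^-1 = 0]. *)
Definition inversion n (r : R) (v : 'rV[R]_n) : 'rV[R]_n := (r / sqn v *: v)%R.

Lemma measurable_inversion n (r : R) : measurable_fun setT (@inversion n r).
Proof.
apply: measurable_fun_rVP => i.
rewrite (_ : (fun _ => _) = fun v : 'rV[R]_n => r / sqn v * v 0%R i)%R.
  apply: measurable_funM; last exact: measurable_coord.
  apply: measurable_funM => //.
  exact: (measurableT_comp (@measurable_invr R) (@measurable_sqn n)).
by apply/funext => v; rewrite mxE.
Qed.

(* In the coordinates t (1, w), the inversion leaves w alone and is t |-> c / t in t. *)
Lemma ge0_integral_inversion n (r : R) (F : 'rV[R]_n.+1 -> \bar R) :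
  (0 < r)%R -> measurable_fun setT F -> (forall v, 0 <= F v) ->
  \int[leb n.+1]_v (F (inversion r v) * ((r / sqn v) ^+ n.+1)%:E) =
  \int[leb n.+1]_v F v.
Proof.
move=> r0 mF F0.
have w0 (v : 'rV[R]_n.+1) : (0 <= (r / sqn v) ^+ n.+1)%R.
  by rewrite exprn_ge0// divr_ge0 ?sqn_ge0// ltW.
rewrite ge0_integral_slope; last 2 first.
- apply: emeasurable_funM; first exact: (measurableT_comp mF (@measurable_inversion _ r)).
  apply/measurable_EFinP/measurable_funX/measurable_funM => //.
  exact: (measurableT_comp (@measurable_invr R) (@measurable_sqn n.+1)).
- by move=> v; rewrite mule_ge0// lee_fin w0.
rewrite [RHS]ge0_integral_slope//; apply: eq_integral => w _.
have A0 := sqn_slope_gt0 w; set A := sqn (slope w) in A0 *.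
have c0 : (0 < r / A)%R by rewrite divr_gt0.
have mG : measurable_fun setT (fun t : measurableTypeR R => F (t *: slope w)%R * (`|t| ^+ n)%:E).
  exact: (measurableT_comp (measurable_slope_fun mF) (pair2_measurable w)).
rewrite -[RHS](ge0_integral_inv c0)//; last by move=> t; rewrite mule_ge0// lee_fin exprn_ge0.
apply: eq_integral => t _; rewrite /inversion sqnZ -/A scalerA.
(* At [t = 0] both weights vanish, again because [0^-1 = 0]. *)
have [->|t0] := eqVneq t 0%R.
  by rewrite !expr0n/= !(mul0r, invr0, mulr0, expr0n, mule0, mul0e)/= ?mule0 ?mul0e.
rewrite -muleA -[RHS]muleA -!EFinM; congr (F _ * _%:E).
  congr (_ *: _)%R.
  by field; rewrite (gt_eqF A0) t0.
have tn0 : (`|t| != 0)%R by rewrite normr_eq0.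
rewrite normrM normfV (gtr0_norm c0) -(@real_normK _ t) ?num_real//.
rewrite (_ : r / (`|t| ^+ 2 * A) = r / A / `|t| ^+ 2)%R; last first.
  by rewrite invfM mulrA mulrAC.
rewrite exprSr mulrAC -exprMn; congr (_ ^+ n * _)%R.
by field; rewrite (gt_eqF A0) tn0.
Qed.

End rV_integral.

(** * Powers on the half-line: continuity, decay and integrals *)

Section powers.
Local Open Scope ereal_scope.
Context (R : realType).
Notation mu := (@lebesgue_measure R).
Notation leb n := (@lebesgue_rV R n).

Lemma continuous_powR (a x : R) : (0 < x)%R -> {for x, continuous (fun t : R => t `^ a)%R}.
Proof.
move=> x0; apply/differentiable_continuous/derivable1_diffP.
by apply: derivable_powR; rewrite in_itv/= andbT.
Qed.

Lemma powRN_cvgy (a : R) : (0 < a)%R -> (t `^ (- a) @[t --> +oo] --> 0)%R.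
Proof.
move=> a0; under eq_cvg do rewrite powRN.
apply/gtr0_cvgV0.
  near=> t; rewrite powR_gt0//; near: t; exact: nbhs_pinfty_gt.
apply/cvgryPge => A; near=> t.
have t0 : (0 <= t)%R by near: t; apply: nbhs_pinfty_ge; rewrite num_real.
have tA : (`|A| `^ a^-1 <= t)%R by near: t; apply: nbhs_pinfty_ge; rewrite num_real.
rewrite (le_trans (ler_norm A))//.
rewrite -[leLHS](@powRr1 _ `|A|)// -(@mulVf _ a) ?gt_eqF// powRrM.
by rewrite ge0_ler_powR ?ltW// nnegrE ?powR_ge0.
Unshelve. all: by end_near. Qed.

Lemma integral_powR_tail (a d : R) : (0 < a)%R -> (0 < d)%R ->
  \int[mu]_(t in `[d, +oo[) (t `^ (- 1 - a))%:E = (d `^ (- a) / a)%:E.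
Proof.
move=> a0 d0.
have dF (t : R) : (0 < t)%R ->
    is_derive t (1 : R)%R (fun t : R => - a^-1 * t `^ (- a))%R (t `^ (- 1 - a))%R.
  move=> t0.
  refine (is_derive_eq (is_deriveZ (- a^-1)%R (is_derive1_powR (- a)%R t0)) _).
  rewrite /GRing.scale/= mulrA mulrNN mulVf ?gt_eqF// mul1r; congr (_ `^ _)%R.
  by rewrite addrC.
rewrite (@ge0_continuous_FTC2y R (fun t => t `^ (- 1 - a))%R (fun t => - a^-1 * t `^ (- a))%R d 0)//.
- by rewrite -EFinB sub0r mulNr opprK mulrC.
- by move=> x ax; rewrite powR_ge0.
- apply: continuous_in_subspaceT => x; rewrite inE/= in_itv/= andbT => ax.
  by apply: continuous_powR; exact: lt_le_trans ax.
- rewrite -(mulr0 (- a^-1)%R); apply: cvgM; first exact: cvg_cst.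
  exact: powRN_cvgy.
- by move=> x ax; have := dF x (lt_trans d0 ax); case.
- apply: cvg_at_right_filter; apply: cvgM; first exact: cvg_cst.
  exact: continuous_powR.
- move=> x; rewrite in_itv/= andbT => ax; rewrite derive1E.
  by have := dF x (lt_trans d0 ax); case.
Qed.

Lemma integral_powR_ge1 (a : R) : (0 < a)%R ->
  \int[mu]_t (if (1 <= t)%R then (t `^ (- 1 - a))%:E else 0) = a^-1%:E.
Proof.
move=> a0; rewrite (_ : a^-1 = 1 `^ (- a) / a)%R; last by rewrite powR1 mul1r.
rewrite -integral_powR_tail//.
rewrite [RHS]integral_mkcond; apply: eq_integral => x _.
by rewrite patchE mem_setE in_itv/= andbT.
Qed.

Lemma measurable_powR_ge1 (a : R) : measurable_fun setT
  (fun t : measurableTypeR R => if (1 <= t)%R then (t `^ (- 1 - a))%:E else 0).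
Proof.
apply: measurable_fun_ifT => //; first exact: measurable_fun_ler.
by apply/measurable_EFinP; exact: measurable_powR.
Qed.

Lemma integral_powR_le1 (a : R) : (0 < a)%R ->
  \int[mu]_t (if (0 < t <= 1)%R then (t `^ (a - 1))%:E else 0) = a^-1%:E.
Proof.
move=> a0; pose F (t : measurableTypeR R) := if (t <= 1)%R then (t `^ (a - 1))%:E else 0.
have mF : measurable_fun setT F.
  apply: measurable_fun_ifT => //; first exact: measurable_fun_ler.
  by apply/measurable_EFinP; exact: measurable_powR.
have F0 t : 0 <= F t by rewrite /F; case: ifPn => // _; rewrite lee_fin powR_ge0.
transitivity (\int[mu]_t (if (0 < t)%R then F t else 0)).
  by apply: eq_integral => t _; rewrite /F; case: ifPn => [/andP[-> ->]//|]; case: (0 < t)%R => //= /negbTE ->.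
rewrite -(ge0_integral_inv_pos (@ltr01 R) mF F0) -integral_powR_ge1//.
apply: eq_integral => t _; rewrite /F.
have [t0|t0] := boolP (0 < t)%R; last first.
  by rewrite mule0 ifF//; apply/negbTE; move: t0; apply: contra; exact: lt_le_trans.
rewrite ler_pdivrMr// mul1r; case: ifPn => t1; last by rewrite mul0e.
rewrite -EFinM !div1r; congr EFin.
have tn0 : t != 0%R by rewrite gt_eqF.
rewrite -(powR_inv1 (ltW t0)) -(powR_mulrn 2 (ltW t0)) -powRN -powRrM -powRD ?tn0 ?implybT//.
by congr (_ `^ _)%R; ring.
Qed.

Lemma integral_pow_lty (g : measurableTypeR R -> R) (C a b : R) :
  measurable_fun setT g -> (forall t, 0 <= g t)%R -> (0 < a)%R -> (0 < b)%R ->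
  (forall t, 0 < t -> t <= 1 -> g t <= C * t `^ (a - 1))%R ->
  (forall t, 1 <= t -> g t <= C * t `^ (- 1 - b))%R ->
  \int[mu]_t (if (0 < t)%R then (g t)%:E else 0) < +oo.
Proof.
move=> mg g0 a0 b0 g1 g2.
have C0 : (0 <= C)%R by have := g2 1%R (lexx _); rewrite powR1 mulr1; exact: le_trans.
pose f1 (t : measurableTypeR R) := if (0 < t <= 1)%R then (t `^ (a - 1))%:E else 0.
pose f2 (t : measurableTypeR R) := if (1 <= t)%R then (t `^ (- 1 - b))%:E else 0.
have f10 t : 0 <= f1 t by rewrite /f1; case: ifPn => // _; rewrite lee_fin powR_ge0.
have f20 t : 0 <= f2 t by rewrite /f2; case: ifPn => // _; rewrite lee_fin powR_ge0.
have mf1 : measurable_fun setT f1.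
  apply: measurable_fun_ifT => //.
    apply: measurable_and; [exact: measurable_fun_ltr|exact: measurable_fun_ler].
  by apply/measurable_EFinP; exact: measurable_powR.
have mf2 : measurable_fun setT f2 by exact: measurable_powR_ge1.
have mg' : measurable_fun setT (fun t : measurableTypeR R => if (0 < t)%R then (g t)%:E else 0).
  apply: measurable_fun_ifT => //; first exact: measurable_fun_ltr.
  exact/measurable_EFinP.
apply: (@le_lt_trans _ _ (\int[mu]_t (C%:E * (f1 t + f2 t)))).
  apply: ge0_leT_integral => //.
  - by apply: emeasurable_funM => //; exact: emeasurable_funD.
  - by move=> t; case: ifPn => // _; rewrite lee_fin.
  - move=> t; case: ifPn => t0; last by rewrite mule_ge0 ?adde_ge0.
    have [t1|t1] := leP t 1%R.
      apply: (@le_trans _ _ (C%:E * f1 t)); last by rewrite lee_pmul// leeDl.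
      have -> : f1 t = (t `^ (a - 1))%:E by rewrite /f1 t0 t1.
      by rewrite -EFinM lee_fin g1.
    apply: (@le_trans _ _ (C%:E * f2 t)); last by rewrite lee_pmul// leeDr.
    have -> : f2 t = (t `^ (- 1 - b))%:E by rewrite /f2 ltW.
    by rewrite -EFinM lee_fin g2// ltW.
rewrite ge0_integralMl//; [|exact: emeasurable_funD|by move=> t; rewrite adde_ge0].
rewrite ge0_integralD// integral_powR_le1// integral_powR_ge1//.
by rewrite -EFinD -EFinM ltry.
Qed.

End powers.

(** * Integrals of radial functions *)

Section radial.
Local Open Scope ereal_scope.
Context (R : realType).
Notation mu := (@lebesgue_measure R).
Notation leb n := (@lebesgue_rV R n).

Lemma enorm_ge0 n (v : 'rV[R]_n) : (0 <= enorm v)%R.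
Proof. exact: sqrtr_ge0. Qed.

Lemma enorm_sqr n (v : 'rV[R]_n) : (enorm v ^+ 2 = sqn v)%R.
Proof. by rewrite sqr_sqrtr ?sqn_ge0. Qed.

Lemma enormZ n (c : R) (v : 'rV[R]_n) : (enorm (c *: v) = `|c| * enorm v)%R.
Proof.
by rewrite /enorm -/(sqn (c *: v)) sqnZ sqrtrM ?sqr_ge0// sqrtr_sqr.
Qed.

Lemma enormN n (v : 'rV[R]_n) : (enorm (- v) = enorm v)%R.
Proof. by rewrite -scaleN1r enormZ normrN1 mul1r. Qed.

Lemma enorm_slope_ge1 n (w : 'rV[R]_n) : (1 <= enorm (slope w))%R.
Proof.
rewrite -[leLHS]sqrtr1 ler_sqrt ?sqn_ge0// -/(sqn (slope w)) sqn_slope lerDl.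
exact: sqn_ge0.
Qed.

Lemma enorm_slope_gt0 n (w : 'rV[R]_n) : (0 < enorm (slope w))%R.
Proof. exact: lt_le_trans (enorm_slope_ge1 w). Qed.

Lemma measurable_enorm n : measurable_fun setT (@enorm R n).
Proof.
rewrite (_ : @enorm R n = fun v => sqn v `^ (2^-1))%R.
  by apply: (measurableT_comp (measurable_powR (2^-1)%R)); exact: measurable_sqn.
by apply/funext => v; rewrite powR12_sqrt ?sqn_ge0.
Qed.

Lemma measurable_inv_1D_sqr :
  measurable_fun setT (fun t : measurableTypeR R => (1 + t ^+ 2)^-1)%R.
Proof.
apply: (measurableT_comp (@measurable_invr R)).
apply: (@measurable_funD _ _ _ setT (cst 1%R) (fun t : measurableTypeR R => t ^+ 2)%R) => //.
Qed.

(** The surface measure of a unit half-sphere of R^(n+1), read in the coordinate [w]; its integral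
    is half the area of the sphere. The exponent comes from rescaling [t] by [enorm (slope w)]. *)
Definition slope_weight n (w : 'rV[R]_n) : R := (enorm (slope w) ^+ n.+1)^-1%R.

Lemma slope_weight_ge0 n (w : 'rV[R]_n) : (0 <= slope_weight w)%R.
Proof. by rewrite invr_ge0 exprn_ge0 ?enorm_ge0. Qed.

Lemma measurable_slope n : measurable_fun setT (@slope R n).
Proof. exact: (measurableT_comp (@measurable_rV_cons R n) (pair1_measurable (1%R : measurableTypeR R))). Qed.

Lemma measurable_slope_weight n : measurable_fun setT (@slope_weight n : 'rV[R]_n -> R).
Proof.
apply: (measurableT_comp (@measurable_invr R)); apply: measurable_funX.
exact: (measurableT_comp (@measurable_enorm n.+1) (@measurable_slope n)).
Qed.

Lemma ge0_integral_radial n (g : measurableTypeR R -> R) :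
  measurable_fun setT g -> (forall t, 0 <= g t)%R ->
  \int[leb n.+1]_v (g (enorm v))%:E =
  \int[leb n]_w (slope_weight w)%:E * \int[mu]_t (g `|t| * `|t| ^+ n)%:E.
Proof.
move=> mg g0.
have mgn : measurable_fun setT (fun v : 'rV[R]_n.+1 => (g (enorm v))%:E).
  by apply/measurable_EFinP; exact: (measurableT_comp mg (@measurable_enorm n.+1)).
rewrite ge0_integral_slope//; last by move=> v; rewrite lee_fin.
set I := (X in _ = _ * X).
rewrite -[RHS]ge0_integralZr//; last 3 first.
- by apply/measurable_EFinP; exact: measurable_slope_weight.
- by move=> w _; rewrite lee_fin slope_weight_ge0.
- by apply: integral_ge0 => t _; rewrite lee_fin mulr_ge0 ?exprn_ge0.
apply: eq_integral => w _.
have a0 := enorm_slope_gt0 w; set a := enorm (slope w) in a0.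
have an0 : a != 0%R by rewrite gt_eqF.
have mG : measurable_fun setT (fun t : measurableTypeR R => (g `|t| * `|t| ^+ n)%:E).
  apply/measurable_EFinP; apply: measurable_funM.
    by apply: (measurableT_comp mg); exact: normr_measurable.
  by apply: measurable_funX; exact: normr_measurable.
rewrite /I -(ge0_integral_affine 0%R an0 mG); last first.
  by move=> t; rewrite lee_fin mulr_ge0 ?exprn_ge0.
have mH : measurable_fun setT (fun t : measurableTypeR R =>
    (g `|a * t + 0| * `|a * t + 0| ^+ n)%:E%R * `|a|%:E).
  apply: emeasurable_funM => //.
  apply: (measurableT_comp (f := fun t : measurableTypeR R => (g `|t| * `|t| ^+ n)%:E)) => //.
  apply: measurable_funD => //; exact: measurable_funM.
rewrite -ge0_integralMl//; last 2 first.
- exact: slope_weight_ge0.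
- by move=> t; rewrite mule_ge0// lee_fin mulr_ge0 ?exprn_ge0.
apply: eq_integral => t _; rewrite addr0 enormZ -!EFinM; congr EFin.
rewrite /slope_weight -/a normrM (gtr0_norm a0) exprMn exprS (mulrC `|t|%R).
by field; rewrite expf_neq0.
Qed.

Lemma integral_inv_1D_sqr_lty : \int[mu]_t ((1 + t ^+ 2)^-1)%:E < +oo.
Proof.
have mg := measurable_inv_1D_sqr.
have g0 (t : R) : (0 <= (1 + t ^+ 2)^-1)%R by rewrite invr_ge0 addr_ge0 ?sqr_ge0.
rewrite ge0_integral_half_lines//; last exact/measurable_EFinP.
under [X in _ + X]eq_integral do rewrite sqrrN.
have H : \int[mu]_x (if (0 < x)%R then (((1 + x ^+ 2)^-1)%:E)%R else 0) < +oo.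
  apply: (@integral_pow_lty _ _ 1 1 1)%R => //.
    move=> t t0 t1; rewrite subrr powRr0 mulr1 invf_le1 ?lerDl ?sqr_ge0//.
    by rewrite ltr_wpDr ?sqr_ge0.
  move=> t t1; have t0 : (0 < t)%R by exact: lt_le_trans t1.
  rewrite (_ : (- 1 - 1 = - 2%:R :> R)%R); last by rewrite -opprD.
  rewrite powRN powR_mulrn ?(ltW t0)// mul1r lef_pV2 ?posrE ?exprn_gt0//.
    by rewrite lerDr.
  by rewrite ltr_wpDr ?sqr_ge0.
by rewrite lte_add_pinfty.
Qed.

(** Induction by integrating out the first coordinate [t]. With [a^2 = 1 + |w|^2] and
    [e^2 = a^2 + t^2], the bound [e^(-n-2) <= a^(-n) / (a^2 + t^2)] holds, and the integral of the
    right side in [t] is a constant times [a^(-n-1)], the weight of the previous dimension. *)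
Lemma integral_slope_weight_lty n : \int[leb n]_w (slope_weight w)%:E < +oo.
Proof.
elim: n => [|n IH].
  rewrite /= integral_dirac//; last first.
    by apply/measurable_EFinP; exact: measurable_slope_weight.
  by rewrite diracE -EFinM ltry.
have mW k : measurable_fun setT (fun w : 'rV[R]_k => (slope_weight w)%:E).
  by apply/measurable_EFinP; exact: measurable_slope_weight.
have mW' : measurable_fun setT (fun p : measurableTypeR R * 'rV[R]_n => (slope_weight (rV_cons p))%:E).
  exact: (measurableT_comp (mW n.+1) (@measurable_rV_cons R n)).
rewrite ge0_integral_cons//; last by move=> w; rewrite lee_fin slope_weight_ge0.
rewrite (@fubini_tonelli _ _ _ _ _ mu (leb n) _ mW'); last first.
  by move=> p; rewrite lee_fin slope_weight_ge0.
set C := \int[mu]_t ((1 + t ^+ 2)^-1)%:E.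
have mg : measurable_fun setT (fun t : measurableTypeR R => ((1 + t ^+ 2)^-1)%:E)%R.
  by apply/measurable_EFinP; exact: measurable_inv_1D_sqr.
have g0 (t : R) : 0 <= ((1 + t ^+ 2)^-1)%:E%R.
  by rewrite lee_fin invr_ge0 addr_ge0 ?sqr_ge0.
apply: (@le_lt_trans _ _ (\int[leb n]_w ((slope_weight w)%:E * C))).
  apply: ge0_leT_integral.
  - apply: (@measurable_fun_fubini_tonelli_G _ _ _ _ _ mu _ mW') => p.
    by rewrite lee_fin slope_weight_ge0.
  - by apply: emeasurable_funM; [exact: mW|exact: measurable_cst].
  - by move=> w; apply: integral_ge0 => t _; rewrite lee_fin slope_weight_ge0.
  - move=> w; have a0 := enorm_slope_gt0 w; set a := enorm (slope w) in a0.
    have an0 : a^-1%R != 0%R by rewrite invr_eq0 gt_eqF.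
    rewrite /C -(ge0_integral_affine 0%R an0 mg)//.
    have mH : measurable_fun setT (fun t : measurableTypeR R =>
        ((1 + (a^-1 * t + 0) ^+ 2)^-1)%:E%R * `|a^-1%R|%:E).
      apply: emeasurable_funM => //.
      apply: (measurableT_comp mg).
      by apply: measurable_funD => //; exact: measurable_funM.
    rewrite -ge0_integralMl//; last 2 first.
    - exact: slope_weight_ge0.
    - by move=> t; rewrite mule_ge0.
    apply: ge0_leT_integral.
    - exact: (measurableT_comp mW' (pair2_measurable w)).
    - exact: emeasurable_funM.
    - by move=> t; rewrite lee_fin slope_weight_ge0.
    - move=> t; rewrite addr0 -!EFinM lee_fin /slope_weight -/a.
      set e := enorm (slope (rV_cons (t, w))).
      have e2 : (e ^+ 2 = a ^+ 2 + t ^+ 2)%R.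
        rewrite !enorm_sqr !sqn_slope /sqn big_ord_recl rV_cons0 -!addrA; congr (_ + _)%R.
        rewrite addrC; congr (_ + _)%R; apply: eq_bigr => i _.
        by rewrite (_ : lift ord0 i = rshift 1 i) ?rV_consS//; exact: val_inj.
      have e0 : (0 < e)%R by exact: enorm_slope_gt0.
      have ae : (a <= e)%R.
        by rewrite -(@ler_pXn2r _ 2)// ?nnegrE ?(ltW a0) ?(ltW e0)// e2 lerDl sqr_ge0.
      rewrite normfV (gtr0_norm a0).
      rewrite (_ : _ * _ = (a ^+ n * (a ^+ 2 + t ^+ 2))^-1)%R; last first.
        rewrite exprS; field; rewrite !expf_neq0 ?(gt_eqF a0)//=.
        by rewrite !gt_eqF// ltr_pwDl ?exprn_gt0// ?sqr_ge0.
      have h : (a ^+ n * e ^+ 2 <= e ^+ n.+2)%R.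
        rewrite -[n.+2]addn2 exprD ler_pM2r ?exprn_gt0//.
        by rewrite lerXn2r ?nnegrE ?(ltW a0) ?(ltW e0).
      have h1 : (e ^+ n.+2 \is Num.pos)%R by rewrite posrE; exact: exprn_gt0.
      have h2 : (a ^+ n * e ^+ 2 \is Num.pos)%R by rewrite posrE mulr_gt0 ?exprn_gt0.
      by rewrite -e2 lef_pV2.
have w0 : 0 <= \int[leb n]_w (slope_weight w)%:E.
  by apply: integral_ge0 => w _; rewrite lee_fin slope_weight_ge0.
rewrite ge0_integralZr//; last 3 first.
- exact: mW.
- by move=> w _; rewrite lee_fin slope_weight_ge0.
- exact: integral_ge0.
apply: lte_mul_pinfty => //; last exact: integral_inv_1D_sqr_lty.
by rewrite ge0_fin_numE.
Qed.

End radial.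

(** * The one-dimensional inequality *)

Section half_line_profile.
Local Open Scope ereal_scope.
Context (R : realType).
Notation mu := (@lebesgue_measure R).
Variable s : R.
Hypotheses (s0 : (0 < s)%R) (s1 : (s < 1)%R).

(** The second difference at 1 of the profile [(max t 0)^s] is [a - b], where [a] and [b] are
    nonnegative for [t > 0]. *)
Let a (t : R) : R := ((1 + t) `^ s - 1)%R.
Let b (t : R) : R := (1 - (Num.max (1 - t) 0) `^ s)%R.
Let k (t : R) : R := (t `^ (- 1 - 2 * s))%R.
Let k0 t : (0 <= k t)%R := powR_ge0 _ _.

Let ma : measurable_fun setT (a : measurableTypeR R -> R).
Proof. by rewrite /a; mfun. Qed.

Let mb : measurable_fun setT (b : measurableTypeR R -> R).
Proof. by rewrite /b; mfun. Qed.

Let mk : measurable_fun setT (k : measurableTypeR R -> R).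
Proof. by rewrite /k; mfun. Qed.

Let phi (r : R) : R := (1 - r `^ s)%R.

Let phi_le r : (0 < r <= 1)%R -> (0 <= phi r <= 1 - r)%R.
Proof.
move=> /andP[r0 r1]; rewrite /phi subr_ge0; apply/andP; split.
  have /(_ r 1%R) := @ge0_ler_powR R s (ltW s0).
  by rewrite powR1 !nnegrE (ltW r0) ler01 r1 => ->.
rewrite lerD2l lerN2 -[leLHS](powRr1 (ltW r0)).
by apply: ger_powR; rewrite ?r0 ?r1// ltW.
Qed.

(* The substitutions r = 1 / (1 + t) and r = 1 - t bring the integrals of a k and of b k over
   t > 0 to integrals over 0 < r < 1 whose integrands differ by psi, the derivative of Psi;
   the boundary term of Psi cancels the part t > 1 of the second integral. *)
Let psi (r : R) : R := (phi r * (r `^ (s - 1) - 1) * k (1 - r))%R.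

Let psi_ge0 r : (0 < r < 1)%R -> (0 <= psi r)%R.
Proof.
move=> /andP[r0 r1]; rewrite /psi mulr_ge0// mulr_ge0//.
  by have /andP[] := phi_le (introT andP (conj r0 (ltW r1))).
rewrite subr_ge0 -[leLHS](powRr0 r); apply: ger_powR; first by rewrite r0 ltW.
by rewrite subr_le0 ltW.
Qed.

Let Psi (r : R) : R := (- (2 * s)^-1 * (phi r ^+ 2 * (1 - r) `^ (- (2 * s))))%R.

Local Open Scope ring_scope.

Let dPsi (r : R) : (0 < r < 1)%R -> is_derive r (1 : R)%R Psi (psi r).
Proof.
move=> /andP[r0 r1]; have r10 : (0 < 1 - r)%R by rewrite subr_gt0.
have D1 : is_derive r (1 : R)%R phi (- (s * r `^ (s - 1)))%R.
  refine (is_derive_eq (is_deriveB (is_derive_cst (1 : R) r 1%R) (is_derive1_powR s r0)) _).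
  by rewrite sub0r.
have D2 : is_derive r (1 : R)%R (fun r => (1 - r) `^ (- (2 * s)))%R
    (2 * s * (1 - r) `^ (- (2 * s) - 1))%R.
  have D0 : is_derive r (1 : R)%R (fun r => 1 - r)%R (-1)%R.
    refine (is_derive_eq (is_deriveB (is_derive_cst (1 : R) r 1%R) (is_derive_id r (1 : R)%R)) _).
    by rewrite sub0r.
  have D3 := @is_derive1_comp R (fun t => t `^ (- (2 * s)))%R (fun r => 1 - r)%R r _ _ (is_derive1_powR (- (2 * s))%R r10) D0.
  by refine (is_derive_eq D3 _); rewrite /GRing.scale/=; ring.
refine (is_derive_eq (is_deriveZ (- (2 * s)^-1)%R (is_deriveM (is_deriveX 2 D1) D2)) _).
rewrite (_ : (phi ^+ 2) r = phi r ^+ 2)//.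
rewrite /GRing.scale/= /psi /k.
have e1 : ((1 - r) `^ (- (2 * s)) = (1 - r) * (1 - r) `^ (- 1 - 2 * s))%R.
  rewrite -{2}(powRr1 (ltW r10)) -powRD ?(gt_eqF r10) ?implybT//.
  by congr (_ `^ _)%R; ring.
have e2 : (r * r `^ (s - 1) = r `^ s)%R by rewrite mulr_powRB1// ltW.
rewrite (_ : - (2 * s) - 1 = - 1 - 2 * s)%R; last by rewrite addrC.
rewrite e1 /phi -e2; set K := ((1 - r) `^ _)%R; set p := (r `^ (s - 1))%R.
by rewrite /=; field; rewrite gt_eqF.
Qed.

Let cont_psi (r : R) : 0 < r < 1 -> {for r, continuous psi}.
Proof.
move=> /andP[r0 r1]; have r10 : 0 < 1 - r by rewrite subr_gt0.
apply: cvgM; [apply: cvgM|].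
- by apply: cvgB; [exact: cvg_cst|exact: continuous_powR].
- by apply: cvgB; [exact: continuous_powR|exact: cvg_cst].
- apply: (@cvg_comp _ _ _ (fun r => 1 - r) k); last exact: continuous_powR.
  by apply: cvgB; [exact: cvg_cst|exact: cvg_id].
Qed.

Let mpsi : measurable_fun setT (psi : measurableTypeR R -> R).
Proof. by rewrite /psi /phi; mfun; apply: (measurableT_comp mk); mfun. Qed.

(** [Psi] is nonpositive at the right end; at the left end [phi d <= 1 - d] bounds [- Psi d] by
    [(2 s)^-1 (1 - d)^(2 - 2 s)], and the exponent is positive. *)
Let integral_psi_segment (d : R) : 0 < d < 2^-1 ->
  (\int[mu]_(r in `[d, (1 - d)%R]) (psi r)%:E <= (2 * s)^-1%:E)%E.
Proof.
move=> /andP[d0 d1].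
have i01 r : r \in `[d, 1 - d] -> 0 < r < 1.
  rewrite in_itv/= => /andP[dr rd]; rewrite (lt_le_trans d0 dr)/=.
  by rewrite (le_lt_trans rd)// ltrBlDr ltrDl.
have dc r : 0 < r < 1 -> {for r, continuous Psi}.
  by move=> r01; apply/differentiable_continuous/derivable1_diffP; case: (dPsi r01).
have dd : d < 1 - d by lra.
have d01 : 0 < d < 1 by rewrite i01// in_itv/= lexx ltW.
have d101 : 0 < 1 - d < 1 by rewrite i01// in_itv/= lexx ltW.
rewrite (@continuous_FTC2 R psi Psi)//; last 3 first.
- by apply: continuous_in_subspaceT => r; rewrite inE => /i01; exact: cont_psi.
- split.
  + by move=> r; rewrite in_itv/= => /andP[dr rd]; case: (@dPsi r _) => //; rewrite i01// in_itv/= !ltW.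
  + by apply: cvg_at_right_filter; exact: dc.
  + by apply: cvg_at_left_filter; exact: dc.
- move=> r; rewrite in_itv/= => /andP[dr rd]; rewrite derive1E.
  by case: (@dPsi r _) => //; rewrite i01// in_itv/= !ltW.
have s20 : 0 < (2 * s)^-1 by rewrite invr_gt0 mulr_gt0.
have h0 : Psi (1 - d) <= 0.
  by rewrite /Psi mulNr oppr_le0 mulr_ge0 ?(ltW s20)// mulr_ge0 ?sqr_ge0 ?powR_ge0.
have h1 : - Psi d <= (2 * s)^-1.
  rewrite /Psi mulNr opprK -[leRHS]mulr1 ler_pM2l//.
  have e0 : 0 < 1 - d by lra.
  have /andP[p0 p1] : 0 <= phi d <= 1 - d by apply: phi_le; rewrite d0/=; lra.
  apply: (@le_trans _ _ ((1 - d) ^+ 2 * (1 - d) `^ (- (2 * s)))).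
    by rewrite ler_wpM2r ?powR_ge0// lerXn2r ?nnegrE ?p0 ?(ltW e0).
  rewrite -(powR_mulrn 2 (ltW e0)) -powRD ?(gt_eqF e0) ?implybT//.
  rewrite -[leRHS](powRr0 (1 - d)); apply: ger_powR; first by rewrite e0/=; lra.
  by rewrite subr_ge0 -[leRHS]mulr1 ler_pM2l ?ltW.
by rewrite -EFinB lee_fin; lra.
Qed.

Let integral_psi : (\int[mu]_r (if (0 < r < 1)%R then (psi r)%:E else 0) <= (2 * s)^-1%:E)%E.
Proof.
(* Starting at 3 keeps [d m] below 1/2, so that [[d, 1 - d]] is a proper segment. *)
pose d (m : nat) : R := m.+3%:R^-1.
have d0 m : 0 < d m by rewrite invr_gt0.
have dlt m : d m < 2^-1 by rewrite ltf_pV2 ?posrE// ltr_nat.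
have dS m : d m.+1 <= d m by rewrite lef_pV2 ?posrE// ler_nat.
apply: (@ge0_integral_exhaust _ _ R mu _ (fun m (r : measurableTypeR R) => d m <= r <= 1 - d m)).
- by mfun.
- by move=> r; case: ifPn => // /psi_ge0; rewrite lee_fin.
- by move=> m; mfun.
- by move=> m r /andP[h1 h2]; have := dS m; lra.
- move=> r; case: ifPn => [/andP[r0 r1] _|]; last by rewrite eqxx.
  have m0 : 0 < Num.min r (1 - r) by rewrite lt_min r0 subr_gt0.
  have [m Hm] := @ltr_add_invr R 0 (Num.min r (1 - r)) m0.
  exists m; rewrite add0r lt_min in Hm.
  have : d m <= m.+1%:R^-1 by rewrite lef_pV2 ?posrE// ler_nat (@leq_trans m.+2).
  move: (m.+1%:R^-1) Hm => e /andP[h1 h2] h3; have := d0 m.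
  by move: (d m) h3 => dm h3 h4; apply/andP; split; lra.
- move=> m; apply: le_trans (integral_psi_segment (d := d m) _); last by rewrite d0 dlt.
  rewrite [leRHS]integral_mkcond le_eqVlt; apply/orP; left; apply/eqP.
  apply: eq_integral => r _; rewrite patchE mem_setE in_itv/=.
  case: ifPn => // /andP[h1 h2]; rewrite ifT//; have := d0 m; have := dlt m; lra.
Qed.

Let a_ge0 t : 0 < t -> 0 <= a t.
Proof.
move=> t0; have h1 : 1 <= 1 + t by lra.
have h2 : 0 <= 1 + t by lra.
rewrite /a subr_ge0; have := @ge0_ler_powR R s (ltW s0) 1 (1 + t).
by rewrite powR1 !nnegrE; apply.
Qed.

Let b_ge0 t : 0 < t -> 0 <= b t <= 1.
Proof.
move=> t0; rewrite /b subr_ge0 gerBl powR_ge0 andbT.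
have /(_ (Num.max (1 - t) 0) 1) := @ge0_ler_powR R s (ltW s0).
rewrite powR1 !nnegrE ler01 le_max lexx orbT => -> //.
by rewrite ge_max ler01 andbT gerBl ltW.
Qed.

Let IA (e : R) := (\int[mu]_t (if (e < t)%R then (a t * k t)%:E else 0))%E.
Let IB (e : R) := (\int[mu]_t (if (e < t)%R then (b t * k t)%:E else 0))%E.

Let IAE (e : R) : 0 < e -> IA e =
  (\int[mu]_r (if (0 < r < (1 + e)^-1)%R then (phi r * r `^ (s - 1) * k (1 - r))%:E else 0))%E.
Proof.
move=> e0; have e1 : 0 < 1 + e by lra.
pose F (t : measurableTypeR R) := if (e < t)%R then (a t * k t)%:E else 0%E.
have mF : measurable_fun setT F by rewrite /F; mfun.
have F0 t : (0 <= F t)%E.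
  rewrite /F; case: ifPn => // et; rewrite lee_fin mulr_ge0//.
  by rewrite a_ge0// (lt_trans e0).
(* [r = 1 / (1 + t)] is obtained as a translation followed by [r |-> 1 / r]. The powers recombine
   through [(r^(-s) - 1) r^(1 + 2 s) r^(-2) = phi r * r^(s - 1)]. *)
pose H (r : measurableTypeR R) := F (r - 1).
have mH : measurable_fun setT H.
  by apply: (measurableT_comp mF); mfun.
have H0 r : (0 <= H r)%E by exact: F0.
transitivity (\int[mu]_r (if (0 < r)%R then H r else 0))%E.
  rewrite /IA -(ge0_integral_affine (-1) (oner_neq0 R) mF F0).
  apply: eq_integral => r _; rewrite mul1r normr1 mule1 -/(H r).
  case: ifPn => // r0; rewrite /H /F ifF//; apply/negbTE; lra.
rewrite -(ge0_integral_inv_pos (@ltr01 R) mH H0); apply: eq_integral => r _.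
have [r0|r0] := boolP (0 < r); last by rewrite mule0.
rewrite /= /H /F !div1r.
have E : (e < r^-1 - 1) = (r < (1 + e)^-1).
  by rewrite ltrBrDr (addrC e) -[RHS]ltf_pV2 ?posrE ?invr_gt0// invrK.
rewrite E; case: ifPn => re; last by rewrite mul0e.
rewrite -EFinM; congr EFin.
have r1 : r < 1.
  by apply: (lt_le_trans re); rewrite invf_le1//; lra.
have r10 : 0 < 1 - r by lra.
have rn0 : r != 0 by rewrite gt_eqF.
rewrite /a /phi /k (addrC 1) subrK.
rewrite (_ : r^-1 - 1 = (1 - r) * r^-1); last by field.
rewrite powRM ?invr_ge0 ?(ltW r0) ?(ltW r10)//.
rewrite -(powR_inv1 (ltW r0)) -(powR_mulrn 2 (ltW r0)) -!powRrM -powRN.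
set K := (1 - r) `^ (- 1 - 2 * s).
rewrite (_ : (r `^ (-1 * s) - 1) * (K * r `^ (-1 * (- 1 - 2 * s))) * r `^ (- 2) =
  (r `^ (-1 * s) * (r `^ (-1 * (- 1 - 2 * s)) * r `^ (- 2)) - r `^ (-1 * (- 1 - 2 * s)) * r `^ (- 2)) * K); last by ring.
rewrite (_ : (1 - r `^ s) * r `^ (s - 1) * K = (r `^ (s - 1) - r `^ s * r `^ (s - 1)) * K); last by ring.
rewrite -!powRD ?rn0 ?implybT//; congr ((_ `^ _ - _ `^ _) * _); ring.
Qed.

Let IBE (e : R) : 0 < e -> e < 1 -> IB e =
  (\int[mu]_r (if (0 < r < 1 - e)%R then (phi r * k (1 - r))%:E else 0) + (2 * s)^-1%:E)%E.
Proof.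
move=> e0 e1.
pose F (t : measurableTypeR R) := if (e < t < 1)%R then (b t * k t)%:E else 0%E.
have mF : measurable_fun setT F by rewrite /F; mfun.
have F0 t : (0 <= F t)%E.
  rewrite /F; case: ifPn => // /andP[et _]; rewrite lee_fin mulr_ge0//.
  by have /andP[] := b_ge0 (lt_trans e0 et).
(* The constant is the contribution of [t >= 1], where [b t = 1]. *)
rewrite -(@integral_powR_ge1 R (2 * s)) ?mulr_gt0//.
have N1 : -1 != 0 :> R by rewrite oppr_eq0 oner_eq0.
transitivity (\int[mu]_r F r + \int[mu]_t (if (1 <= t)%R then (k t)%:E else 0))%E.
  rewrite -ge0_integralD//; last 2 first.
  - by move=> t _; case: ifPn; rewrite // lee_fin.
  - exact: measurable_powR_ge1.
  apply: eq_integral => t _; rewrite /F.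
  have [t1|t1] := leP 1 t.
    rewrite (lt_le_trans e1 t1)/= add0e /b; congr EFin.
    rewrite (_ : Num.max (1 - t) 0 = 0) ?powR0 ?gt_eqF// ?subr0 ?mul1r//.
    by apply/max_idPr; rewrite subr_le0.
  by rewrite andbT adde0.
suff -> : (\int[mu]_r F r = \int[mu]_r
    (if (0 < r < 1 - e)%R then (phi r * k (1 - r))%:E else 0))%E by [].
rewrite -(ge0_integral_affine 1 N1 mF F0); apply: eq_integral => r _.
rewrite normrN1 mule1 mulN1r (addrC (- r)) /F.
rewrite (_ : (e < 1 - r < 1) = (0 < r < 1 - e)); last first.
  by apply/idP/idP => /andP[*]; apply/andP; split; lra.
case: ifPn => // /andP[r0 r1]; rewrite /b (_ : Num.max _ _ = r)//.
by rewrite subKr; apply/max_idPl; exact: ltW.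
Qed.

(** The common cutoff [t > e] becomes [r < 1 / (1 + e)] in one integral and [r < 1 - e] in the
    other. The two differ by an interval of length at most [e^2], on which [phi r * k (1 - r) <= (1
    - r)^(- 2 s) <= (e / 2)^(- 2 s)]; this is the error term, of order [e^(2 - 2 s)]. *)
Let IA_le (e : R) : 0 < e -> e < 2^-1 ->
  (IA e <= IB e + (e ^+ 2 * (e / 2) `^ (- (2 * s)))%:E)%E.
Proof.
move=> e0 e1; rewrite IAE// IBE//; last by lra.
pose f1 (r : measurableTypeR R) := if (0 < r < 1)%R then (psi r)%:E else 0%E.
pose f2 (r : measurableTypeR R) := if (0 < r < 1 - e)%R then (phi r * k (1 - r))%:E else 0%E.
pose c := (e / 2) `^ (- (2 * s)).
pose f3 (r : measurableTypeR R) := if (1 - e <= r <= 1 - e + e ^+ 2)%R then c%:E else 0%E.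
have mk1 : measurable_fun setT (fun r : measurableTypeR R => k (1 - r)).
  by apply: (measurableT_comp mk); mfun.
have mf1 : measurable_fun setT f1 by rewrite /f1; mfun.
have mf2 : measurable_fun setT f2 by rewrite /f2 /phi; mfun.
have mf3 : measurable_fun setT f3 by rewrite /f3; mfun.
have f10 r : (0 <= f1 r)%E by rewrite /f1; case: ifPn => // /psi_ge0.
have f20 r : (0 <= f2 r)%E.
  rewrite /f2; case: ifPn => // /andP[r0 r1]; rewrite lee_fin mulr_ge0//.
  by have /andP[] : 0 <= phi r <= 1 - r by apply: phi_le; rewrite r0/=; lra.
have f30 r : (0 <= f3 r)%E by rewrite /f3; case: ifPn => // _; rewrite lee_fin powR_ge0.
apply: (@le_trans _ _ (\int[mu]_r (f1 r + (f2 r + f3 r)))%E).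
  apply: ge0_leT_integral.
  - by rewrite /phi; mfun.
  - by mfun.
  - move=> r; case: ifPn => // /andP[r0 r1]; rewrite lee_fin mulr_ge0//.
    have r11 : r < 1 by rewrite (lt_le_trans r1)// invf_le1; lra.
    rewrite mulr_ge0 ?powR_ge0//.
    by have /andP[] : 0 <= phi r <= 1 - r by apply: phi_le; rewrite r0 ltW.
  - move=> r; case: ifPn => [/andP[r0 r1]|]; last by rewrite !adde_ge0.
    have r11 : r < 1 by rewrite (lt_le_trans r1)// invf_le1; lra.
    have r10 : 0 < 1 - r by lra.
    have /andP[p0 p1] : 0 <= phi r <= 1 - r by apply: phi_le; rewrite r0 ltW.
    have -> : f1 r = (psi r)%:E by rewrite /f1 r0 r11.
    rewrite (_ : phi r * r `^ (s - 1) * k (1 - r) = psi r + phi r * k (1 - r)); last first.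
      by rewrite /psi; ring.
    rewrite EFinD leeD2l//.
    have [re|re] := ltP r (1 - e).
      by rewrite /f2 r0 re/= leeDl.
    apply: (@le_trans _ _ (f3 r)); last by rewrite leeDr.
    have r1e : r <= 1 - e + e ^+ 2.
      apply: (le_trans (ltW r1)); rewrite -[leLHS]mul1r ler_pdivrMr; last lra.
      rewrite (_ : _ * _ = 1 + e ^+ 3); last by ring.
      by rewrite lerDl exprn_ge0// ltW.
    rewrite /f3 re r1e lee_fin.
    have er : e / 2 <= 1 - r.
      have e2 : e ^+ 2 <= e / 2 by rewrite expr2 ler_pM2l// ltW.
      lra.
    apply: (@le_trans _ _ ((1 - r) `^ (- (2 * s)))).
      rewrite (_ : - (2 * s) = 1 + (- 1 - 2 * s)); last by ring.
      rewrite powRD ?(gt_eqF r10) ?implybT// (powRr1 (ltW r10)).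
      by rewrite ler_wpM2r.
    rewrite /c !powRN lef_pV2 ?posrE ?powR_gt0//; last by lra.
    by rewrite ge0_ler_powR ?nnegrE// ?ltW// ?mulr_gt0// divr_gt0.
have f230 r : (0 <= f2 r + f3 r)%E by rewrite adde_ge0.
have mf23 : measurable_fun setT (fun r => f2 r + f3 r)%E by exact: emeasurable_funD.
rewrite ge0_integralD//.
rewrite ge0_integralD//.
have I3 : (\int[mu]_r f3 r = (e ^+ 2 * c)%:E)%E.
  rewrite mulrC EFinM (_ : (e ^+ 2)%:E = mu `[1 - e, 1 - e + e ^+ 2]%classic); last first.
    rewrite lebesgue_measure_itv/= lte_fin ltrDl exprn_gt0//.
    by rewrite -EFinB; congr EFin; ring.
  rewrite -integral_cst// [RHS]integral_mkcond; apply: eq_integral => r _.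
  by rewrite patchE mem_setE in_itv.
by rewrite I3 addeA (addeC (\int[mu]_r f2 r)%E) leeD2r// leeD2r// integral_psi.
Qed.

(** Finiteness, from [b <= 1], is what allows [IB e] to be cancelled between extended reals. *)
Let IB_fin (e : R) : 0 < e -> IB e \is a fin_num.
Proof.
move=> e0; have IB0 : (0 <= IB e)%E.
  apply: integral_ge0 => t _; case: ifPn => // et; rewrite lee_fin mulr_ge0//.
  by have /andP[] := b_ge0 (lt_trans e0 et).
rewrite ge0_fin_numE//.
apply: (@le_lt_trans _ _ (\int[mu]_(t in `[e, +oo[) (k t)%:E)%E); last first.
  by rewrite integral_powR_tail ?mulr_gt0// ltry.
rewrite [leRHS]integral_mkcond; apply: ge0_leT_integral.
- by mfun.
- apply/(measurable_restrictT _ _).1 => //; apply/measurable_EFinP.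
  exact: measurable_funTS.
- move=> t; case: ifPn => // et; rewrite lee_fin mulr_ge0//.
  by have /andP[] := b_ge0 (lt_trans e0 et).
- move=> t; rewrite patchE mem_setE in_itv/= andbT.
  have [et|et] := ltP e t; last by case: ifPn; rewrite ?lee_fin.
  rewrite (ltW et) lee_fin -[leRHS]mul1r ler_wpM2r//.
  by have /andP[] := b_ge0 (lt_trans e0 et).
Qed.

Let small (eta e1 : R) : 0 < eta -> 0 < e1 ->
  exists e, [/\ 0 < e, e < 2^-1, e <= e1 & e ^+ 2 * (e / 2) `^ (- (2 * s)) <= eta].
Proof.
move=> eta0 e10; pose c := 2 - 2 * s; have c0 : 0 < c.
  by rewrite /c subr_gt0 -[ltRHS]mulr1 ltr_pM2l.
(* The error equals [e^c 2^(2 s)] with [c = 2 - 2 s], and [2^(2 s) <= 4]. *)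
pose v := (eta / 4) `^ c^-1; have v0 : 0 < v by rewrite powR_gt0// divr_gt0.
exists (Num.min (Num.min e1 v) (4^-1)); set e := Num.min _ _.
have e0 : 0 < e by rewrite !lt_min e10 v0/= invr_gt0.
have ev : e <= v by rewrite /e !ge_min lexx !orbT.
split => //.
- by rewrite /e gt_min; apply/orP; right; lra.
- by rewrite /e !ge_min lexx.
rewrite powRM ?invr_ge0 ?(ltW e0)// mulrA.
rewrite -(powR_mulrn 2 (ltW e0)) -powRD ?(gt_eqF e0) ?implybT//.
have h1 : e `^ (2 + - (2 * s)) <= eta / 4.
  have -> : eta / 4 = v `^ c.
    by rewrite /v -powRrM mulVf ?gt_eqF// powRr1// divr_ge0// ltW.
  by apply: ge0_ler_powR; rewrite ?nnegrE ?(ltW c0) ?(ltW e0) ?(ltW v0).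
have h2 : 2^-1 `^ (- (2 * s)) <= 4 :> R.
  have h3 : 2^-1 `^ 2%:R <= 2^-1 `^ (2 * s) :> R.
    apply: ger_powR; first by apply/andP; split; lra.
    by rewrite -[leRHS]mulr1 ler_pM2l// ltW.
  rewrite powR_mulrn ?invr_ge0// in h3.
  rewrite powRN -[leRHS]invrK lef_pV2 ?posrE ?invr_gt0 ?powR_gt0 ?invr_gt0//.
  by apply: le_trans h3; rewrite exprVn -natrX.
rewrite -[leRHS](@divfK _ 4)// ler_pM ?powR_ge0//.
Qed.

Let D (t : R) : R := (1 + t) `^ s + (Num.max (1 - t) 0) `^ s - 2.

(** Near 0 the functions [a k] and [b k] are not integrable when [2 s >= 1], only their difference
    is. The comparison of [IA] and [IB] is therefore made beyond a cutoff [e]; the negative part is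
    bounded at once by its full integral, and the cutoff is removed from the positive part by
    monotone convergence. *)
Lemma half_line_profile_le :
  (\int[mu]_t (if (0 < t)%R then (Num.max (D t) 0 * k t)%:E else 0) <=
   \int[mu]_t (if (0 < t)%R then (Num.max (- D t) 0 * k t)%:E else 0))%E.
Proof.
have Dab t : D t = a t - b t by rewrite /D /a /b; ring.
have mD : measurable_fun setT (D : measurableTypeR R -> R) by rewrite /D; mfun.
have mDN : measurable_fun setT (fun t : measurableTypeR R => - D t).
  exact: measurable_funN.
pose P (t : R) := Num.max (D t) 0 * k t; pose M (t : R) := Num.max (- D t) 0 * k t.
have P0 t : 0 <= P t by rewrite mulr_ge0// le_max lexx orbT.
have M0 t : 0 <= M t by rewrite mulr_ge0// le_max lexx orbT.
have mP : measurable_fun setT (P : measurableTypeR R -> R) by rewrite /P; mfun.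
have mM : measurable_fun setT (M : measurableTypeR R -> R) by rewrite /M; mfun.
(* This is [P - M = a k - b k] without subtraction, hence usable before the integrals are known to
   be finite. *)
have PM t : P t + b t * k t = M t + a t * k t.
  rewrite /P /M Dab -!mulrDl; congr (_ * _).
  move: (a t) (b t) => A B; rewrite opprB.
  by case: (leP (A - B) 0) => h1; case: (leP (B - A) 0) => h2; lra.
pose IP e := (\int[mu]_t (if (e < t)%R then (P t)%:E else 0))%E.
pose IM e := (\int[mu]_t (if (e < t)%R then (M t)%:E else 0))%E.
have mcut (f : measurableTypeR R -> R) e : measurable_fun setT f ->
  measurable_fun setT (fun t : measurableTypeR R => if (e < t)%R then (f t)%:E else 0%E).
  by move=> mf; mfun.
have step e : 0 < e -> e < 2^-1 -> (IP e <= IM 0%R + (e ^+ 2 * (e / 2) `^ (- (2 * s)))%:E)%E.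
  move=> e0 e1; rewrite -(leeD2rE _ _ (IB_fin e0)).
  have -> : (IP e + IB e = IM e + IA e)%E.
    rewrite -!ge0_integralD//.
    - apply: eq_integral => t _; case: ifPn => // _.
      by rewrite -!EFinD PM.
    - by move=> t _; case: ifPn; rewrite // lee_fin.
    - exact: mcut.
    - move=> t _; case: ifPn => // et; rewrite lee_fin mulr_ge0//.
      by rewrite a_ge0// (lt_trans e0).
    - by mfun.
    - by move=> t _; case: ifPn; rewrite // lee_fin.
    - exact: mcut.
    - move=> t _; case: ifPn => // et; rewrite lee_fin mulr_ge0//.
      by have /andP[] := b_ge0 (lt_trans e0 et).
    - by mfun.
  have hM : (IM e <= IM 0%R)%E.
    apply: ge0_leT_integral; [exact: mcut|exact: mcut| |].
    - by move=> t; case: ifPn; rewrite // lee_fin.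
    - move=> t; case: ifPn => [et|_]; first by rewrite (lt_trans e0 et).
      by case: ifPn; rewrite // lee_fin.
  set c := (_ * _)%:E; have hA : (IA e <= IB e + c)%E := IA_le e0 e1.
  by rewrite -(addeA (IM 0%R) c) (addeC c); exact: (leeD hM hA).
apply: (@ge0_integral_exhaust _ _ R mu _ (fun m (r : measurableTypeR R) => m.+1%:R^-1 < r)).
- exact: mcut.
- by move=> t; case: ifPn => // _; rewrite lee_fin; apply: P0.
- by move=> m; mfun.
- move=> m r; apply: le_lt_trans; rewrite lef_pV2 ?posrE// ler_nat//.
- move=> t; case: ifPn => [t0 _|]; last by rewrite eqxx.
  have [m Hm] := @ltr_add_invr R 0 t t0.
  by exists m; rewrite add0r in Hm.
- move=> m; apply/lee_addgt0Pr => eta eta0.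
  have m0 : 0 < m.+1%:R^-1 :> R by rewrite invr_gt0.
  have [e [e0 e1 em eeta]] := small eta0 m0.
  apply: (@le_trans _ _ (IP e)).
    apply: ge0_leT_integral.
    - by mfun.
    - exact: mcut.
    - by move=> t; do 2 case: ifPn => //; rewrite lee_fin => _ _; apply: P0.
    - move=> t; case: ifPn => [mt|_]; last by case: ifPn; rewrite // lee_fin.
      by rewrite (lt_trans m0 mt) (le_lt_trans em mt).
  by apply: (le_trans (step _ e0 e1)); rewrite leeD2l// lee_fin.
Qed.

End half_line_profile.

(** * Second differences of the power of the last coordinate *)

Section line_profile.
Context (R : realType).
Notation mu := (@lebesgue_measure R).
Notation leb n := (@lebesgue_rV R n).
Variable s : R.
Hypotheses (s0 : (0 < s)%R) (s1 : (s < 1)%R).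

Definition pospow (t : R) : R := (Num.max t 0) `^ s.

Lemma measurable_pospow : measurable_fun setT (pospow : measurableTypeR R -> R).
Proof. by rewrite /pospow; mfun. Qed.

Lemma pospow_ge0 t : 0 <= pospow t. Proof. exact: powR_ge0. Qed.

Lemma pospowM c t : 0 < c -> pospow (c * t) = c `^ s * pospow t.
Proof.
move=> c0; rewrite /pospow -powRM ?(ltW c0) ?le_max ?lexx ?orbT//; congr (_ `^ _).
by rewrite maxr_pMr ?mulr0// ltW.
Qed.

Definition line_diff (A b t : R) : R :=
  pospow (A + t * b) + pospow (A - t * b) - 2 * pospow A.

Lemma measurable_line_diff A b :
  measurable_fun setT (line_diff A b : measurableTypeR R -> R).
Proof.
rewrite /line_diff; apply: measurable_funB => //; apply: measurable_funD.
  by apply: (measurableT_comp measurable_pospow); mfun.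
by apply: (measurableT_comp measurable_pospow); mfun.
Qed.

(** Rescaling [t] by [c = A / b] reduces to the base point 1 and slope 1, at the cost of the factor
    [K] on both sides; there the integrand is even, so the half-line inequality is used twice. For
    [b = 0] the line is parallel to the boundary and the second difference vanishes. *)
Lemma line_profile_le (A b : R) : 0 < A ->
  (\int[mu]_t (Num.max (line_diff A b t) 0 * `|t| `^ (- 1 - 2 * s))%:E <=
   \int[mu]_t (Num.max (- line_diff A b t) 0 * `|t| `^ (- 1 - 2 * s))%:E)%E.
Proof.
move=> A0; have [->|b0] := eqVneq b 0.
  rewrite (_ : (fun t => _) = cst 0%E); first by rewrite integral0 integral_ge0// => t _;
    rewrite lee_fin mulr_ge0 ?powR_ge0// le_max lexx orbT.
  apply/funext => t; rewrite /line_diff mulr0 addr0 subr0 (_ : _ - _ = 0) ?maxxx ?mul0r//.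
  by ring.
pose c := A / b; have c0 : c != 0 by rewrite mulf_neq0 ?invr_eq0// gt_eqF.
pose K := A `^ s * `|c| `^ (- (2 * s)).
have K0 : 0 <= K by rewrite mulr_ge0 ?powR_ge0.
have nk0 (t : R) : 0 <= `|t| `^ (- 1 - 2 * s) by exact: powR_ge0.
(* [e] stands for the identity or the opposite, which treats the positive and the negative part
   together. *)
have main (e : measurableTypeR R -> measurableTypeR R) :
  measurable_fun setT e -> (forall x y, e (x * y) = x * e y) ->
  (\int[mu]_t (Num.max (e (line_diff A b t)) 0 * `|t| `^ (- 1 - 2 * s))%:E =
   K%:E * (\int[mu]_t (if (0 < t)%R then (Num.max (e ((1 + t) `^ s + (Num.max (1 - t) 0) `^ s - 2)) 0 * t `^ (- 1 - 2 * s))%:E else 0)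
   + \int[mu]_t (if (0 < t)%R then (Num.max (e ((1 + t) `^ s + (Num.max (1 - t) 0) `^ s - 2)) 0 * t `^ (- 1 - 2 * s))%:E else 0)))%E.
  move=> me eM.
  have mL (u v : R) : measurable_fun setT (fun t : measurableTypeR R =>
      (Num.max (e (line_diff u v t)) 0 * `|t| `^ (- 1 - 2 * s))%:E).
    have ml : measurable_fun setT (fun t : measurableTypeR R => e (line_diff u v t)).
      exact: (measurableT_comp me (measurable_line_diff u v)).
    have mn : measurable_fun setT (fun t : measurableTypeR R => `|t|) by exact: normr_measurable.
    by mfun.
  have L0 (u v t : R) : (0 <= (Num.max (e (line_diff u v t)) 0 * `|t| `^ (- 1 - 2 * s))%:E)%E.
    by rewrite lee_fin mulr_ge0// le_max lexx orbT.
  rewrite -(ge0_integral_affine 0 c0 (mL A b) (L0 A b)).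
  have E (t : R) : ((Num.max (e (line_diff A b (c * t + 0))) 0 * `|c * t + 0| `^ (- 1 - 2 * s))%:E * `|c|%:E =
      K%:E * (Num.max (e (line_diff 1 1 t)) 0 * `|t| `^ (- 1 - 2 * s))%:E)%E.
    rewrite -!EFinM; congr EFin; rewrite addr0.
    have -> : line_diff A b (c * t) = A `^ s * line_diff 1 1 t.
      rewrite /line_diff (_ : A + c * t * b = A * (1 + t * 1)); last by rewrite /c; field.
      rewrite (_ : A - c * t * b = A * (1 - t * 1)); last by rewrite /c; field.
      have e3 : pospow A = A `^ s * pospow 1 by rewrite -{1}(mulr1 A) pospowM.
      by rewrite !pospowM// e3; ring.
    rewrite eM -[X in Num.max _ X](mulr0 (A `^ s)) -maxr_pMr ?powR_ge0//.
    rewrite normrM powRM ?normr_ge0// /K.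
    have cn0 : 0 < `|c| by rewrite normr_gt0.
    rewrite (_ : - 1 - 2 * s = - (2 * s) - 1); last by ring.
    rewrite (@powRB _ `|c|) ?(gt_eqF cn0) ?implybT// powRr1//.
    by field; rewrite gt_eqF.
  under eq_integral do rewrite E.
  rewrite (ge0_integralMl mu K0 (mL 1 1) (L0 1 1)) (ge0_integral_half_lines (mL 1 1) (L0 1 1)).
  have F1 (t : R) : 0 < t -> line_diff 1 1 t = (1 + t) `^ s + (Num.max (1 - t) 0) `^ s - 2.
    move=> t0; rewrite /line_diff !mulr1 /pospow (_ : Num.max (1 + t) 0 = 1 + t).
      by rewrite (_ : Num.max 1 0 = 1) ?powR1 ?mulr1//; apply/max_idPl.
    by apply/max_idPl; rewrite addr_ge0// ltW.
  have F2 (t : R) : line_diff 1 1 (- t) = line_diff 1 1 t.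
    by rewrite /line_diff !mulr1 opprK; ring.
  set J := (X in (_ = _ * (X + X))%E).
  set J1 := (X in (_ * (X + _) = _)%E); set J2 := (X in (_ * (_ + X) = _)%E).
  have -> : J1 = J.
    by rewrite /J1 /J; apply: eq_integral => t _; case: ifPn => // t0; rewrite F1// gtr0_norm.
  have -> // : J2 = J.
  rewrite /J2 /J; apply: eq_integral => t _; case: ifPn => // t0.
  by rewrite F2 F1// normrN gtr0_norm.
have H := half_line_profile_le s0 s1.
have mid : measurable_fun setT (id : measurableTypeR R -> measurableTypeR R) by exact: measurable_id.
have mN : measurable_fun setT (-%R : measurableTypeR R -> measurableTypeR R) by exact: oppr_measurable.
have -> := main _ mid (fun x y => erefl).
have -> := main _ mN (fun x y => esym (mulrN x y)).
apply: lee_wpmul2l; [by rewrite lee_fin|exact: (leeD H H)].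
Qed.

Variable n : nat.
Notation N := n.+1.

Definition second_diff (f : 'rV[R]_N -> R) (x y : 'rV[R]_N) : R :=
  f (x + y) + f (x - y) - 2 * f x.

Definition lastpow (z : 'rV[R]_N) : R := pospow (z 0 ord_max).

Lemma measurable_lastpow : measurable_fun setT lastpow.
Proof. exact: (measurableT_comp measurable_pospow (measurable_coord ord_max)). Qed.

Lemma measurable_second_diff f x :
  measurable_fun setT f -> measurable_fun setT (second_diff f x).
Proof.
move=> mf; rewrite /second_diff; apply: measurable_funB => //; apply: measurable_funD.
  exact: (measurableT_comp mf (measurable_rV_addl x)).
exact: (measurableT_comp mf (measurable_rV_subl x)).
Qed.

Lemma measurable_kernel (q : R) : measurable_fun setT (fun y : 'rV[R]_N => enorm y `^ q).
Proof. exact: (measurableT_comp (measurable_powR q) (@measurable_enorm R N)). Qed.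

(** The Jacobian [|t| ^ n] turns the kernel of R^N into the kernel of the line, up to a factor that
    depends on [w] alone. Hence an inequality that holds on each line integrates to one on R^N. *)
Lemma slope_kernel (w : 'rV[R]_n) (t : R) :
  enorm (t *: slope w) `^ (- (N%:R + 2 * s)) * `|t| ^+ n =
  enorm (slope w) `^ (- (N%:R + 2 * s)) * `|t| `^ (- 1 - 2 * s).
Proof.
rewrite enormZ powRM ?normr_ge0 ?enorm_ge0// [LHS]mulrAC [RHS]mulrC; congr (_ * _).
(* At [t = 0] both sides are 0, because 0 to any nonzero power is 0. *)
have [->|t0] := eqVneq t 0.
  have q1 : - (N%:R + 2 * s) != 0 by rewrite lt_eqF// oppr_lt0 addr_gt0// mulr_gt0.
  have q2 : - 1 - 2 * s != 0 by rewrite lt_eqF// -opprD oppr_lt0 addr_gt0// mulr_gt0.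
  by rewrite normr0 !powR0// mul0r.
rewrite -(powR_mulrn n (normr_ge0 t)) -powRD ?normr_eq0 ?t0 ?implybT//.
by congr (_ `^ _); rewrite -natr1; ring.
Qed.

Lemma integral_second_diff_lastpow_le (x : 'rV[R]_N) : 0 < x 0 ord_max ->
  (\int[leb N]_y (Num.max (second_diff lastpow x y) 0 * enorm y `^ (- (N%:R + 2 * s)))%:E <=
   \int[leb N]_y (Num.max (- second_diff lastpow x y) 0 * enorm y `^ (- (N%:R + 2 * s)))%:E)%E.
Proof.
move=> x0.
have dE w t : second_diff lastpow x (t *: slope w) =
    line_diff (x 0 ord_max) (slope w 0 ord_max) t.
  by rewrite /second_diff /lastpow /line_diff !mxE.
have md := measurable_second_diff x measurable_lastpow.
have mdN : measurable_fun setT (fun y => - second_diff lastpow x y) by exact: measurable_funN.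
have me : measurable_fun setT (fun y : 'rV[R]_N => enorm y) by exact: measurable_enorm.
have mF (f : 'rV[R]_N -> R) : measurable_fun setT f ->
    measurable_fun setT (fun y => (Num.max (f y) 0 * enorm y `^ (- (N%:R + 2 * s)))%:E).
  by move=> mf; mfun.
have F0 (f : 'rV[R]_N -> R) y : (0 <= (Num.max (f y) 0 * enorm y `^ (- (N%:R + 2 * s)))%:E)%E.
  by rewrite lee_fin mulr_ge0 ?powR_ge0// le_max lexx orbT.
rewrite (ge0_integral_slope (mF _ md) (F0 _)) (ge0_integral_slope (mF _ mdN) (F0 (fun y => - second_diff lastpow x y))).
have mS f mf := measurable_slope_fun (mF f mf).
have S0 (f : 'rV[R]_N -> R) (p : measurableTypeR R * 'rV[R]_n) :
    (0 <= (Num.max (f (p.1 *: slope p.2)) 0 * enorm (p.1 *: slope p.2) `^ (- (N%:R + 2 * s)))%:E * (`|p.1| ^+ n)%:E)%E.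
  by rewrite mule_ge0// lee_fin exprn_ge0.
apply: ge0_leT_integral.
- exact: (@measurable_fun_fubini_tonelli_G _ _ _ _ _ mu _ (mS _ md) (S0 _)).
- exact: (@measurable_fun_fubini_tonelli_G _ _ _ _ _ mu _ (mS _ mdN) (S0 (fun y => - second_diff lastpow x y))).
- by move=> w; apply: integral_ge0 => t _; exact: (S0 _ (t, w)).
move=> w; set b := slope w 0 ord_max; set A := x 0 ord_max.
pose a := enorm (slope w) `^ (- (N%:R + 2 * s)).
have a0 : 0 <= a by exact: powR_ge0.
have mn : measurable_fun setT (fun t : measurableTypeR R => `|t|) by exact: normr_measurable.
have ml := measurable_line_diff A b.
have mlN : measurable_fun setT (fun t : measurableTypeR R => - line_diff A b t) by exact: measurable_funN.
have E (f : 'rV[R]_N -> R) t : ((Num.max (f (t *: slope w)) 0 * enorm (t *: slope w) `^ (- (N%:R + 2 * s)))%:E * (`|t| ^+ n)%:E =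
    a%:E * (Num.max (f (t *: slope w)) 0 * `|t| `^ (- 1 - 2 * s))%:E)%E.
  by rewrite -!EFinM -mulrA slope_kernel mulrCA.
under eq_integral do rewrite E dE.
under [leRHS]eq_integral do rewrite (E (fun y => - second_diff lastpow x y)) dE.
have G0 (u v : R) : (0 <= (Num.max u 0 * `|v| `^ (- 1 - 2 * s))%:E)%E.
  by rewrite lee_fin mulr_ge0 ?powR_ge0// le_max lexx orbT.
have mG (f : measurableTypeR R -> R) : measurable_fun setT f -> measurable_fun setT
    (fun t : measurableTypeR R => (Num.max (f t) 0 * `|t| `^ (- 1 - 2 * s))%:E).
  by move=> mf; mfun.
rewrite (ge0_integralMl mu a0 (mG _ ml))// (ge0_integralMl mu a0 (mG _ mlN))//.
by apply: lee_wpmul2l; [rewrite lee_fin|exact: line_profile_le].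
Qed.

End line_profile.

Lemma ler_powRl (R : realType) (r x y : R) : 0 <= r -> 0 <= x -> x <= y -> x `^ r <= y `^ r.
Proof.
move=> r0 x0 xy; apply: ge0_ler_powR => //; rewrite nnegrE//.
exact: le_trans xy.
Qed.

Lemma ler_powRNl (R : realType) (r x y : R) : 0 <= r -> 0 < x -> x <= y ->
  y `^ (- r) <= x `^ (- r).
Proof.
move=> r0 x0 xy; have y0 : 0 < y by exact: lt_le_trans xy.
by rewrite !powRN lef_pV2 ?posrE ?powR_gt0// ler_powRl// ltW.
Qed.

(** * The Euclidean norm: Cauchy-Schwarz and the triangle inequality *)

Section euclidean.
Context (R : realType) (n : nat).
Implicit Types u v : 'rV[R]_n.

(** The sum of the squares of [|v| u_i - |u| v_i] is nonnegative and equals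
    [2 |u| |v| (|u| |v| - u.v)]. *)
Lemma dot_le_enorm u v : \sum_(i < n) u 0 i * v 0 i <= enorm u * enorm v.
Proof.
have [u0|u0] := eqVneq (enorm u * enorm v) 0.
  rewrite u0 big1// => i _; apply/eqP; rewrite mulf_eq0.
  have z (w : 'rV[R]_n) : enorm w = 0 -> w 0 i = 0.
    move=> w0; have : sqn w = 0 by rewrite -enorm_sqr w0 expr0n.
    by move/psumr_eq0P => /(_ (fun j _ => sqr_ge0 _)) /(_ i isT) /eqP; rewrite sqrf_eq0 => /eqP.
  by move/eqP: u0; rewrite mulf_eq0 => /orP[] /eqP /z ->; rewrite eqxx ?orbT.
have uv0 : 0 < enorm u * enorm v by rewrite lt_neqAle eq_sym u0 mulr_ge0 ?enorm_ge0.
have : 0 <= \sum_(i < n) (enorm v * u 0 i - enorm u * v 0 i) ^+ 2.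
  by apply: sumr_ge0 => i _; exact: sqr_ge0.
rewrite (eq_bigr (fun i => enorm v ^+ 2 * u 0 i ^+ 2 + enorm u ^+ 2 * v 0 i ^+ 2
   - (2 * (enorm u * enorm v)) * (u 0 i * v 0 i))); last by move=> i _; ring.
rewrite sumrB big_split/= -!mulr_sumr -/(sqn u) -/(sqn v) -!enorm_sqr.
rewrite (_ : _ + _ - _ = 2 * (enorm u * enorm v) * (enorm u * enorm v - \sum_(i < n) u 0 i * v 0 i)); last by ring.
by rewrite pmulr_rge0; [rewrite subr_ge0|rewrite mulr_gt0].
Qed.

Lemma enormD u v : enorm (u + v) <= enorm u + enorm v.
Proof.
rewrite -(@ler_pXn2r _ 2)// ?nnegrE ?addr_ge0 ?enorm_ge0// enorm_sqr.
rewrite (_ : sqn (u + v) = sqn u + sqn v + 2 * \sum_(i < n) u 0 i * v 0 i).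
  rewrite -!enorm_sqr sqrrD -addrA -mulr_natl; have := dot_le_enorm u v; lra.
rewrite /sqn mulr_sumr -!big_split/=; apply: eq_bigr => i _; rewrite !mxE; ring.
Qed.

Lemma enorm_dist u v : `|enorm (u - v) - enorm (u + v)| <= 2 * enorm v.
Proof.
have h1 : enorm (u - v) <= enorm (u + v) + 2 * enorm v.
  rewrite {1}(_ : u - v = u + v - 2 *: v); last first.
    by rewrite scaler_nat mulr2n opprD addrA addrK.
  by apply: le_trans (enormD _ _) _; rewrite enormN enormZ ger0_norm.
have h2 : enorm (u + v) <= enorm (u - v) + 2 * enorm v.
  rewrite {1}(_ : u + v = u - v + 2 *: v); last by rewrite scaler_nat mulr2n addrA subrK.
  by apply: le_trans (enormD _ _) _; rewrite enormZ ger0_norm.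
by rewrite ler_norml; apply/andP; split; lra.
Qed.

Lemma enorm_coord v i : `|v 0 i| <= enorm v.
Proof.
rewrite -(@ler_pXn2r _ 2)// ?nnegrE ?enorm_ge0// enorm_sqr real_normK ?num_real//.
by rewrite /sqn (bigD1 i)//= lerDl sumr_ge0// => j _; exact: sqr_ge0.
Qed.

Lemma sqn_powR v q : sqn v `^ (2^-1 * q) = enorm v `^ q.
Proof. by rewrite powRrM powR12_sqrt ?sqn_ge0. Qed.

End euclidean.

Section powRN_lipschitz.
Context (R : realType).

(** Convexity of [r |-> r^(-P)] at 1, applied to [r = b / a]: from [expR_ge1Dx] and [ln r <= r - 1]
    one gets [r^(-P) >= 1 - P ln r >= 1 - P (r - 1)]. *)
Lemma powRN_sub_le (P a b : R) : 0 < P -> 0 < a -> a <= b ->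
  0 <= a `^ (- P) - b `^ (- P) <= P * (b - a) / a * a `^ (- P).
Proof.
move=> P0 a0 ab; have b0 : 0 < b by exact: lt_le_trans ab.
have mono : b `^ (- P) <= a `^ (- P).
  rewrite !powRN lef_pV2 ?posrE ?powR_gt0//.
  exact: ler_powRl (ltW P0) (ltW a0) ab.
rewrite subr_ge0 mono/=.
have ba0 : 0 < b / a by rewrite divr_gt0.
have -> : b `^ (- P) = (b / a) `^ (- P) * a `^ (- P).
  by rewrite -powRM ?(ltW ba0) ?(ltW a0)// divfK// gt_eqF.
rewrite -{1}[a `^ (- P)]mul1r -mulrBl ler_wpM2r ?powR_ge0//.
have h1 : 1 + - P * ln (b / a) <= (b / a) `^ (- P).
  by rewrite /powR gt_eqF// expR_ge1Dx.
have h2 : ln (b / a) <= b / a - 1.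
  by have := @le_ln1Dx R (b / a - 1); rewrite (addrC 1) subrK; apply; lra.
have -> : P * (b - a) / a = P * (b / a - 1) by field; rewrite gt_eqF.
have : P * ln (b / a) <= P * (b / a - 1) by rewrite ler_pM2l.
by move: h1; rewrite mulNr; lra.
Qed.

End powRN_lipschitz.

(** * The singular kernel and its regularization *)

Section rV_translation.
Local Open Scope ereal_scope.
Context (R : realType) (n : nat).
Notation leb := (@lebesgue_rV R n).
Implicit Types F : 'rV[R]_n -> \bar R.

Lemma ge0_integral_rV_addl x F : measurable_fun setT F -> (forall v, 0 <= F v) ->
  \int[leb]_y F (x + y)%R = \int[leb]_y F y.
Proof.
move=> mF F0; rewrite -[RHS](ge0_integral_rV_affine x (oner_neq0 R) mF F0).
by apply: eq_integral => y _; rewrite normr1 expr1n mule1 scale1r addrC.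
Qed.

Lemma ge0_integral_rV_subl x F : measurable_fun setT F -> (forall v, 0 <= F v) ->
  \int[leb]_y F (x - y)%R = \int[leb]_y F y.
Proof.
have N1 : (-1 != 0 :> R)%R by rewrite oppr_eq0 oner_eq0.
move=> mF F0; rewrite -[RHS](ge0_integral_rV_affine x N1 mF F0).
by apply: eq_integral => y _; rewrite normrN1 expr1n mule1 scaleN1r addrC.
Qed.

Lemma integral_rV_addl x F : measurable_fun setT F ->
  \int[leb]_y F (x + y)%R = \int[leb]_y F y.
Proof.
move=> mF; rewrite [LHS]integralE [RHS]integralE.
have -> : (fun y => F (x + y)%R)^\+ = (fun y => F^\+ (x + y)%R).
  by apply/funext => y; rewrite !funeposE.
have -> : (fun y => F (x + y)%R)^\- = (fun y => F^\- (x + y)%R).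
  by apply/funext => y; rewrite !funenegE.
by rewrite -(ge0_integral_rV_addl x (measurable_funepos mF) (funepos_ge0 F))
  -(ge0_integral_rV_addl x (measurable_funeneg mF) (funeneg_ge0 F)).
Qed.

Lemma integral_rV_subl x F : measurable_fun setT F ->
  \int[leb]_y F (x - y)%R = \int[leb]_y F y.
Proof.
move=> mF; rewrite [LHS]integralE [RHS]integralE.
have -> : (fun y => F (x - y)%R)^\+ = (fun y => F^\+ (x - y)%R).
  by apply/funext => y; rewrite !funeposE.
have -> : (fun y => F (x - y)%R)^\- = (fun y => F^\- (x - y)%R).
  by apply/funext => y; rewrite !funenegE.
by rewrite -(ge0_integral_rV_subl x (measurable_funepos mF) (funepos_ge0 F))
  -(ge0_integral_rV_subl x (measurable_funeneg mF) (funeneg_ge0 F)).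
Qed.

Lemma measurable_rV_addl_comp d (T : measurableType d) (x : 'rV[R]_n) (F : 'rV[R]_n -> T) :
  measurable_fun setT F -> measurable_fun setT (fun y : 'rV[R]_n => F (x + y)%R).
Proof.
by move=> mF; exact: (measurableT_comp mF (measurable_rV_addl x)).
Qed.

Lemma measurable_rV_subl_comp d (T : measurableType d) (x : 'rV[R]_n) (F : 'rV[R]_n -> T) :
  measurable_fun setT F -> measurable_fun setT (fun y : 'rV[R]_n => F (x - y)%R).
Proof.
by move=> mF; exact: (measurableT_comp mF (measurable_rV_subl x)).
Qed.

Lemma integrable_rV_addl x F : leb.-integrable setT F ->
  leb.-integrable setT (fun y => F (x + y)%R).
Proof.
move=> /integrableP[mF iF]; apply/integrableP; split.
  exact: measurable_rV_addl_comp.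
rewrite (ge0_integral_rV_addl x (F := fun y => `|F y|))//.
exact: measurableT_comp.
Qed.

Lemma integrable_rV_subl x F : leb.-integrable setT F ->
  leb.-integrable setT (fun y => F (x - y)%R).
Proof.
move=> /integrableP[mF iF]; apply/integrableP; split.
  exact: measurable_rV_subl_comp.
rewrite (ge0_integral_rV_subl x (F := fun y => `|F y|))//.
exact: measurableT_comp.
Qed.

End rV_translation.

Section radial_integrable.
Context (R : realType) (n : nat).
Notation leb := (@lebesgue_rV R n.+1).

Lemma integrable_radial (g : measurableTypeR R -> R) (C a b : R) :
  measurable_fun setT g -> (forall t, 0 <= g t) -> 0 < a -> 0 < b ->
  (forall t, 0 < t -> t <= 1 -> g t * t ^+ n <= C * t `^ (a - 1)) ->
  (forall t, 1 <= t -> g t * t ^+ n <= C * t `^ (- 1 - b)) ->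
  leb.-integrable setT (fun v => (g (enorm v))%:E).
Proof.
move=> mg g0 a0 b0 g1 g2; apply/integrableP; split.
  by apply/measurable_EFinP; exact: (measurableT_comp mg (@measurable_enorm R n.+1)).
under eq_integral do rewrite gee0_abs ?lee_fin//.
rewrite ge0_integral_radial//.
have J0 : (0 <= \int[lebesgue_rV n]_w (slope_weight w : R)%:E)%E.
  by apply: integral_ge0 => w _; rewrite lee_fin slope_weight_ge0.
apply: lte_mul_pinfty => //.
  by rewrite ge0_fin_numE//; exact: integral_slope_weight_lty.
have mn : measurable_fun setT (fun t : measurableTypeR R => `|t|) by exact: normr_measurable.
have mgn : measurable_fun setT (fun t : measurableTypeR R => g `|t|) by exact: (measurableT_comp mg).
have mG : measurable_fun setT (fun t : measurableTypeR R => g t * t ^+ n).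
  by apply: measurable_funM => //; exact: (measurable_funX n (@measurable_id _ _ setT)).
have mGn : measurable_fun setT (fun t : measurableTypeR R => (g `|t| * `|t| ^+ n)%:E).
  by apply/measurable_EFinP; apply: measurable_funM => //; exact: measurable_funX.
have G0 (t : R) : (0 <= (g `|t| * `|t| ^+ n)%:E)%E by rewrite lee_fin mulr_ge0 ?exprn_ge0.
rewrite (ge0_integral_half_lines mGn G0).
pose G (t : measurableTypeR R) := g t * `|t| ^+ n.
have mG' : measurable_fun setT G by apply: measurable_funM => //; exact: measurable_funX.
have H : (\int[@lebesgue_measure R]_t (if (0 < t)%R then (G t)%:E else 0) < +oo)%E.
  apply: (@integral_pow_lty _ _ C a b) => //.
  - by move=> t; rewrite mulr_ge0 ?exprn_ge0.
  - by move=> t t0 t1; rewrite /G gtr0_norm// g1.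
  - by move=> t t1; rewrite /G gtr0_norm ?g2// (lt_le_trans _ t1).
have E1 : (\int[@lebesgue_measure R]_x (if (0 < x)%R then (g `|x| * `|x| ^+ n)%:E else 0) =
  \int[@lebesgue_measure R]_t (if (0 < t)%R then (G t)%:E else 0))%E.
  by apply: eq_integral => t _; case: ifPn => // t0; rewrite /G gtr0_norm.
have E2 : (\int[@lebesgue_measure R]_x (if (0 < x)%R then (g `|- x| * `|- x| ^+ n)%:E else 0) =
  \int[@lebesgue_measure R]_t (if (0 < t)%R then (G t)%:E else 0))%E.
  by apply: eq_integral => t _; case: ifPn => // t0; rewrite /G normrN gtr0_norm.
by rewrite E1 E2 lte_add_pinfty.
Qed.

End radial_integrable.

Section kernels.
Context (R : realType) (n : nat).
Notation N := n.+1.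
Notation leb := (@lebesgue_rV R N).
Variables (s : R).
Hypotheses (s0 : (0 < s)%R) (s1 : (s < 1)%R).
Let q : R := N%:R + 2 * s.
Let P : R := 2^-1 * q.
Let q0 : 0 < q. Proof. by rewrite addr_gt0// mulr_gt0. Qed.
Let P0 : 0 < P. Proof. by rewrite mulr_gt0// invr_gt0. Qed.

Definition kern (y : 'rV[R]_N) : R := enorm y `^ (- (N%:R + 2 * s)).

(* The point of this regularization is that inversions centered at the origin and fixing x
   multiply both terms of the sum by the same factor. *)
Definition kreg (x : 'rV[R]_N) (e : R) (z : 'rV[R]_N) : R :=
  (sqn (z - x) + e * enorm z) `^ (- (2^-1 * (N%:R + 2 * s))).

Lemma kern_ge0 y : 0 <= kern y. Proof. exact: powR_ge0. Qed.

Lemma kreg_ge0 x e z : 0 <= kreg x e z. Proof. exact: powR_ge0. Qed.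

Lemma kernE y : kern y = sqn y `^ (- P).
Proof. by rewrite /kern -/q -sqn_powR mulrN. Qed.

Lemma kern0 : kern 0 = 0.
Proof.
rewrite kernE (_ : sqn 0 = 0) ?powR0// ?oppr_eq0 ?gt_eqF//.
by rewrite /sqn big1// => i _; rewrite mxE expr0n.
Qed.

Lemma measurable_kern : measurable_fun setT kern.
Proof. exact: (measurableT_comp (measurable_powR _) (@measurable_enorm R N)). Qed.

Lemma measurable_kreg x e : measurable_fun setT (kreg x e).
Proof.
apply: (measurableT_comp (measurable_powR _)); apply: measurable_funD.
  have := @measurable_rV_affine R N 1 (- x).
  under eq_fun do rewrite scale1r.
  exact: (measurableT_comp (@measurable_sqn R N)).
by apply: measurable_funM => //; exact: measurable_enorm.
Qed.

(** The majorant for everything quadratic near 0 and bounded at infinity. Radially it is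
    [t^(1 - 2 s)] near 0, integrable since [s < 1], and [t^(- 1 - 2 s)] at infinity, integrable
    since [s > 0]. *)
Lemma integrable_min_kern :
  leb.-integrable setT (fun y => (Num.min (sqn y) 1 * kern y)%:E).
Proof.
pose g (t : measurableTypeR R) : R := Num.min (t ^+ 2) 1 * t `^ (- q).
rewrite (_ : (fun y => _) = fun y => (g (enorm y))%:E); last first.
  by apply/funext => y; rewrite /g enorm_sqr.
have s2 : 0 < 2 - 2 * s by rewrite subr_gt0 -[ltRHS]mulr1 ltr_pM2l.
apply: (@integrable_radial _ _ g 1 (2 - 2 * s) (2 * s)) => //.
- apply: measurable_funM; last exact: measurable_powR.
  by apply: measurable_minr => //; exact: (measurable_funX 2 (@measurable_id _ _ setT)).
- by move=> t; rewrite mulr_ge0 ?powR_ge0// le_min sqr_ge0 ler01.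
- by rewrite mulr_gt0.
- move=> t t0 t1; rewrite /g mul1r.
  apply: (@le_trans _ _ (t ^+ 2 * t `^ (- q) * t ^+ n)).
    by rewrite ler_wpM2r ?exprn_ge0 ?(ltW t0)// ler_wpM2r ?powR_ge0// ge_min lexx.
  rewrite -!(powR_mulrn _ (ltW t0)) -!powRD ?(gt_eqF t0) ?implybT//.
  rewrite le_eqVlt; apply/orP; left; apply/eqP; congr (_ `^ _).
  by rewrite /q -natr1; ring.
- move=> t t1; have t0 : 0 < t by exact: lt_le_trans t1.
  rewrite /g mul1r; apply: (@le_trans _ _ (1 * t `^ (- q) * t ^+ n)).
    by rewrite ler_wpM2r ?exprn_ge0 ?(ltW t0)// ler_wpM2r ?powR_ge0// ge_min lexx orbT.
  rewrite mul1r -!(powR_mulrn _ (ltW t0)) -!powRD ?(gt_eqF t0) ?implybT//.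
  rewrite le_eqVlt; apply/orP; left; apply/eqP; congr (_ `^ _).
  by rewrite /q -natr1; ring.
Qed.

End kernels.

Section real_integrable.
Context d (T : measurableType d) (R : realType) (mu : {measure set T -> \bar R}).
Implicit Types f g : T -> R.
Notation intR f := (mu.-integrable setT (EFin \o f)).

Lemma intR_measurable f : intR f -> measurable_fun setT f.
Proof. by move=> /integrableP[mf _]; apply/measurable_EFinP. Qed.

Lemma intR_le f g : measurable_fun setT f -> (forall x, `|f x| <= g x) ->
  intR g -> intR f.
Proof.
move=> mf fg; apply: le_integrable => //; first exact/measurable_EFinP.
by move=> x _ /=; rewrite lee_fin (le_trans (fg x))// ler_norm.
Qed.

Lemma intRD f g : intR f -> intR g -> intR (fun x => f x + g x).
Proof. by move=> fi gi; exact: (integrableD measurableT fi gi). Qed.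

Lemma intRB f g : intR f -> intR g -> intR (fun x => f x - g x).
Proof. by move=> fi gi; exact: (integrableB measurableT fi gi). Qed.

Lemma intRZ (k : R) f : intR f -> intR (fun x => k * f x).
Proof. by move=> fi; exact: (integrableZl measurableT k fi). Qed.

Lemma intR_norm f : intR f -> intR (fun x => `|f x|).
Proof. by move=> fi; exact: (integrable_abse fi). Qed.

End real_integrable.

Section regularization.
Context (R : realType) (n : nat).
Notation N := n.+1.
Notation leb := (@lebesgue_rV R N).
Notation intR f := (leb.-integrable setT (EFin \o f)).
Variables (s : R).
Hypotheses (s0 : (0 < s)%R) (s1 : (s < 1)%R).
Let q : R := N%:R + 2 * s.
Let P : R := 2^-1 * q.
Let q0 : 0 < q. Proof. by rewrite addr_gt0// mulr_gt0. Qed.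
Let P0 : 0 < P. Proof. by rewrite mulr_gt0// invr_gt0. Qed.
Variable x : 'rV[R]_N.
Hypothesis x0 : 0 < enorm x.
Notation rho := (enorm x).

Let kregD e y : kreg s x e (x + y) = (sqn y + e * enorm (x + y)) `^ (- P).
Proof. by rewrite /kreg (addrC x) addrK. Qed.

Let kregB e y : kreg s x e (x - y) = (sqn y + e * enorm (x - y)) `^ (- P).
Proof. by rewrite kregD -!enorm_sqr enormN. Qed.

Let rho2 : 0 < rho / 2. Proof. by rewrite divr_gt0. Qed.

(** The two terms of the base of [kreg] vanish at different points, [sqn y] at [z = x] and
    [enorm (x + y)] at [z = 0]. As [x] is not 0 they are never both small, so [kreg] is bounded for
    each [e > 0]. *)
Let far_or_near y : (rho / 2) ^+ 2 <= sqn y \/ rho / 2 <= enorm (x + y).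
Proof.
have [h|h] := leP (rho / 2) (enorm y); [left|right].
  by rewrite -enorm_sqr lerXn2r ?nnegrE ?enorm_ge0// ltW.
have := enormD (x + y) (- y); rewrite addrK enormN; lra.
Qed.

Let sqn_enorm_gt0 e y : 0 < e -> 0 < sqn y + e * enorm (x + y).
Proof.
move=> e0; case: (far_or_near y) => h.
  rewrite ltr_pwDl ?mulr_ge0 ?enorm_ge0 ?(ltW e0)//.
  by apply: lt_le_trans h; rewrite exprn_gt0.
by rewrite ltr_wpDl ?sqn_ge0// mulr_gt0// (lt_le_trans _ h).
Qed.

Let kreg_le_kern e y : 0 < e -> y != 0 -> kreg s x e (x + y) <= kern s y.
Proof.
move=> e0 yn0; rewrite kregD kernE; apply: ler_powRNl; first exact: ltW.
  rewrite lt_neqAle sqn_ge0 andbT eq_sym; apply: contra_neq yn0 => y0.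
  apply/rowP => i; rewrite mxE; apply/eqP; rewrite -sqrf_eq0; apply/eqP.
  by move: y0 => /psumr_eq0P ->// j _; exact: sqr_ge0.
by rewrite lerDl mulr_ge0 ?enorm_ge0// ltW.
Qed.

Lemma integrable_kreg1 (f : 'rV[R]_N -> R) (C : R) : measurable_fun setT f ->
  (forall y, `|f (x + y)| <= C * (1 + enorm y `^ s)) ->
  intR (fun z => f z * kreg s x 1 z).
Proof.
move=> mf fC.
have C0 : 0 <= C.
  have h : 0 < 1 + enorm (0 : 'rV[R]_N) `^ s by rewrite ltr_wpDr ?powR_ge0.
  by rewrite -(pmulr_lge0 _ h) (le_trans _ (fC 0)).
(* [C1] bounds the regularized kernel by [far_or_near] and serves for [enorm y <= 1]; beyond that
   the singular kernel is the majorant. *)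
pose m := Num.min ((rho / 2) ^+ 2) (rho / 2); pose C1 := m `^ (- P).
have m0 : 0 < m by rewrite lt_min exprn_gt0.
pose g (t : measurableTypeR R) : R := (1 + t `^ s) * (if t <= 1 then C1 else t `^ (- q)).
have g0 t : 0 <= g t.
  by rewrite mulr_ge0// ?addr_ge0 ?powR_ge0//; case: ifPn => _; rewrite powR_ge0.
have mg : measurable_fun setT g by rewrite /g; mfun.
have ig : leb.-integrable setT (fun v => (g (enorm v))%:E).
  apply: (@integrable_radial _ _ g (2 * (1 + C1)) 1 s) => //.
  - move=> t t0 t1; rewrite /g t1 subrr powRr0 mulr1.
    apply: (@le_trans _ _ ((1 + 1) * C1 * 1)); last by rewrite mulr1 -[1 + 1]/2 ler_pM2l// lerDr.
    apply: ler_pM; rewrite ?mulr_ge0 ?addr_ge0 ?powR_ge0 ?exprn_ge0 ?(ltW t0)//.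
      rewrite ler_wpM2r ?powR_ge0// lerD2l -[leRHS](powRr0 t).
      by apply: ger_powR; [rewrite t0 t1|exact: ltW].
    by rewrite exprn_ile1// ltW.
  - move=> t t1; have t0 : 0 < t by exact: lt_le_trans t1.
    have ts : 1 <= t `^ s by rewrite -(powRr0 t); apply: ler_powR => //; exact: ltW.
    rewrite /g; case: ifPn => t1'.
      have -> : t = 1 by apply/eqP; rewrite eq_le t1 t1'.
      rewrite !powR1 expr1n !mulr1 -[1 + 1]/2 ler_pM2l// lerDr//.
    apply: (@le_trans _ _ (2 * t `^ s * t `^ (- q) * t ^+ n)).
      rewrite ler_wpM2r ?exprn_ge0 ?(ltW t0)// ler_wpM2r ?powR_ge0//; lra.
    rewrite -(powR_mulrn _ (ltW t0)) -!mulrA -!powRD ?(gt_eqF t0) ?implybT//.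
    rewrite (_ : s + (- q + n%:R) = - 1 - s); last by rewrite /q -natr1; ring.
    by rewrite ler_pM2l// -[leLHS]mul1r ler_wpM2r ?powR_ge0// lerDl powR_ge0.
have ig2 : intR (fun y => C * g (enorm y)) by exact: intRZ.
have ifx : intR (fun y => f (x + y) * kreg s x 1 (x + y)).
  apply: intR_le ig2.
    apply: measurable_funM; first exact: (measurable_rV_addl_comp x mf).
    exact: (measurable_rV_addl_comp x (measurable_kreg s x 1)).
  move=> y; rewrite normrM [X in _ * X]ger0_norm ?kreg_ge0// /g mulrA.
  apply: ler_pM => //; first exact: kreg_ge0.
  have [->|yn0] := eqVneq y 0.
    rewrite (_ : enorm 0 = 0); last first.
      by rewrite -(scale0r (0 : 'rV[R]_N)) enormZ normr0 mul0r.
    rewrite ler01 kregD mul1r; apply: ler_powRNl => //; first exact: ltW.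
    have := far_or_near 0; rewrite /m ge_min => -[h|h]; apply/orP; [left|right].
      by rewrite (le_trans h)// lerDl enorm_ge0.
    by rewrite (le_trans h)// lerDr sqn_ge0.
  case: ifPn => y1; last exact: kreg_le_kern.
  rewrite kregD mul1r; apply: ler_powRNl => //; first exact: ltW.
  have := far_or_near y; rewrite /m ge_min => -[h|h]; apply/orP; [left|right].
    by rewrite (le_trans h)// lerDl enorm_ge0.
  by rewrite (le_trans h)// lerDr sqn_ge0.
have := integrable_rV_addl (- x) ifx.
by apply: eq_integrable => // z _ /=; rewrite addNKr.
Qed.

Let kreg_le e z : 0 < e <= 1 -> kreg s x e z <= e `^ (- P) * kreg s x 1 z.
Proof.
move=> /andP[e0 e1]; pose w := - x + z; have -> : z = x + w by rewrite /w addNKr.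
rewrite !kregD mul1r -powRM ?(ltW e0)//; last first.
  by rewrite addr_ge0 ?sqn_ge0 ?enorm_ge0.
apply: ler_powRNl; first exact: ltW.
  by rewrite mulr_gt0// -[enorm _]mul1r sqn_enorm_gt0.
by rewrite mulrDr lerD2r -[leRHS]mul1r ler_wpM2r ?sqn_ge0.
Qed.

Lemma integrable_kreg (f : 'rV[R]_N -> R) e : 0 < e <= 1 -> measurable_fun setT f ->
  intR (fun z => f z * kreg s x 1 z) -> intR (fun z => f z * kreg s x e z).
Proof.
move=> e01 mf i1; have i2 := intRZ (e `^ (- P)) (intR_norm i1).
apply: intR_le i2; first by apply: measurable_funM => //; exact: measurable_kreg.
move=> z; rewrite !normrM !(ger0_norm (kreg_ge0 _ _ _ _)) mulrCA.
by rewrite ler_wpM2l// kreg_le.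
Qed.

Lemma integrable_kreg1_cst (c : R) : intR (fun z => c * kreg s x 1 z).
Proof.
apply: (@integrable_kreg1 (cst c) `|c|) => //= y.
by rewrite -{1}[`|c|]mulr1 ler_wpM2l// lerDl powR_ge0.
Qed.

(** Away from [x] the regularization costs only a constant: for [enorm y >= r] one has
    [rho <= (rho / r^2) sqn y] and [enorm y <= r^-1 sqn y], hence
    [sqn y + enorm (x + y) <= B * sqn y]. *)
Let kern_le_kreg1 (r : R) y : 0 < r -> r <= enorm y ->
  kern s y <= (1 + rho / r ^+ 2 + r^-1) `^ P * kreg s x 1 (x + y).
Proof.
move=> r0 ry; set B := 1 + _ + _.
have y0 : 0 < enorm y by exact: lt_le_trans ry.
have B0 : 0 < B by rewrite !addr_gt0 ?invr_gt0// divr_gt0// exprn_gt0.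
have sy : 0 < sqn y by rewrite -enorm_sqr exprn_gt0.
rewrite kernE kregD mul1r -[leRHS]mulr1.
have -> : sqn y `^ (- P) = B `^ P * (B * sqn y) `^ (- P).
  rewrite powRM ?(ltW B0) ?(ltW sy)// mulrA -powRD ?(gt_eqF B0) ?implybT//.
  by rewrite subrr powRr0 mul1r.
rewrite mulr1 ler_wpM2l ?powR_ge0//; apply: ler_powRNl; first exact: ltW.
  by rewrite -[enorm _]mul1r sqn_enorm_gt0.
rewrite /B 2!mulrDl mul1r -addrA lerD2l.
apply: le_trans (enormD _ _) _; apply: lerD.
  rewrite -mulrA ler_pMr// mulrC ler_pdivlMr ?exprn_gt0// mul1r -enorm_sqr.
  by rewrite lerXn2r ?nnegrE ?(ltW r0) ?(ltW y0).
by rewrite mulrC ler_pdivlMr// -enorm_sqr expr2 ler_pM2l.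
Qed.

(** The regularized kernel is not even about [x]; its odd part gains a factor [enorm y], uniformly
    in [e]. The bases [a] and [b] differ by at most [2 e |y|] and are at least [e rho / 2], so [e]
    drops out of the relative error [4 |y| / rho]. *)
Let kreg_diff (r e : R) y : 0 < r -> r <= rho / 2 -> enorm y < r -> y != 0 -> 0 < e ->
  `|kreg s x e (x - y) - kreg s x e (x + y)| <= 4 * P / rho * enorm y * kern s y.
Proof.
move=> r0 r1 yr yn0 e0; rewrite kregB kregD kernE.
set a := sqn y + e * enorm (x - y); set b := sqn y + e * enorm (x + y).
have y0 : 0 < enorm y.
  rewrite lt_neqAle enorm_ge0 andbT eq_sym; apply: contra_neq yn0 => y0.
  by apply/rowP => i; rewrite mxE; apply/eqP; rewrite -normr_le0 -y0 enorm_coord.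
have sy : 0 < sqn y by rewrite -enorm_sqr exprn_gt0.
have h1 : rho / 2 <= enorm (x - y) by have := enormD (x - y) y; rewrite subrK; lra.
have h2 : rho / 2 <= enorm (x + y) by have := enormD (x + y) (- y); rewrite addrK enormN; lra.
have key (u v : R) : u <= v -> sqn y <= u -> e * (rho / 2) <= u -> v - u <= e * (2 * enorm y) ->
    `|u `^ (- P) - v `^ (- P)| <= 4 * P / rho * enorm y * sqn y `^ (- P).
  move=> uv su eu vu; have u0 : 0 < u by exact: lt_le_trans su.
  have /andP[p0 p1] := powRN_sub_le P0 u0 uv.
  rewrite ger0_norm//; apply: (le_trans p1); apply: ler_pM => //.
  - by apply: divr_ge0; [apply: mulr_ge0; [exact: ltW|rewrite subr_ge0]|exact: ltW].
  - exact: powR_ge0.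
  - rewrite ler_pdivrMr//.
    apply: (@le_trans _ _ (4 * P / rho * enorm y * (e * (rho / 2)))); last first.
      rewrite ler_wpM2l//; apply: mulr_ge0; last exact: enorm_ge0.
      by apply: divr_ge0; [apply: mulr_ge0 => //; exact: ltW|exact: ltW].
    rewrite (_ : 4 * P / rho * enorm y * (e * (rho / 2)) = P * (e * (2 * enorm y))).
      by rewrite ler_pM2l.
    by field; rewrite gt_eqF.
  - by apply: ler_powRNl => //; exact: ltW.
have := enorm_dist x y; rewrite ler_norml => /andP[d1 d2].
have [ab|ba] := leP a b.
  apply: key => //; rewrite /a /b.
  - by rewrite lerDl mulr_ge0 ?enorm_ge0 ?(ltW e0).
  - by rewrite (@le_trans _ _ (e * enorm (x - y)))// ?ler_pM2l// lerDr sqn_ge0.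
  - rewrite opprD addrACA subrr add0r -mulrBr ler_pM2l//; lra.
rewrite distrC; apply: key; rewrite ?(ltW ba)// /a /b.
- by rewrite lerDl mulr_ge0 ?enorm_ge0 ?(ltW e0).
- by rewrite (@le_trans _ _ (e * enorm (x + y)))// ?ler_pM2l// lerDr sqn_ge0.
- rewrite opprD addrACA subrr add0r -mulrBr ler_pM2l//; lra.
Qed.

Let eps (m : nat) : R := m.+1%:R^-1.
Let eps_gt0 m : 0 < eps m. Proof. by rewrite invr_gt0. Qed.
Let eps_le1 m : eps m <= 1. Proof. by rewrite invf_le1// ler1n. Qed.

(* Dominated convergence needs the integrand symmetrized under y |-> - y: f (x + y) - f x alone
   is not absolutely integrable against kern s when 2 s >= 1. *)
Lemma cvg_kreg_second_diff (f : 'rV[R]_N -> R) (r C : R) :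
  0 < r -> r <= 1 -> r <= rho / 2 -> 0 <= C -> measurable_fun setT f ->
  intR (fun z => f z * kreg s x 1 z) ->
  (forall y, enorm y < r -> `|f (x + y) - f x| <= C * enorm y) ->
  (forall y, enorm y < r -> `|second_diff f x y| <= C * sqn y) ->
  intR (fun y => second_diff f x y * kern s y) /\
  \int[leb]_z ((f z - f x) * kreg s x m.+1%:R^-1 z) @[m --> \oo] -->
    2^-1 * \int[leb]_y (second_diff f x y * kern s y).
Proof.
move=> r0 r1 r_rho C0 mf i1 lip quad.
pose u y := f y - f x.
have mu : measurable_fun setT u by apply: measurable_funB.
have iu : intR (fun z => u z * kreg s x 1 z).
  have := intRB i1 (integrable_kreg1_cst (f x)).
  by apply: eq_integrable => // z _ /=; rewrite /u mulrBl.
pose H m y := u (x + y) * kreg s x (eps m) (x + y) + u (x - y) * kreg s x (eps m) (x - y).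
pose D y := second_diff f x y * kern s y.
have mk e : measurable_fun setT (kreg s x e) by exact: measurable_kreg.
have iue m : intR (fun z => u z * kreg s x (eps m) z).
  by apply: integrable_kreg => //; rewrite eps_gt0 eps_le1.
have ip m : intR (fun y => u (x + y) * kreg s x (eps m) (x + y)).
  exact: (integrable_rV_addl x (iue m)).
have im m : intR (fun y => u (x - y) * kreg s x (eps m) (x - y)).
  exact: (integrable_rV_subl x (iue m)).
have HE m : \int[leb]_z (u z * kreg s x (eps m) z) = 2^-1 * \int[leb]_y H m y.
  rewrite (RintegralD measurableT (ip m) (im m)).
  have mw := measurable_int leb (iue m).
  rewrite [X in _ * (X + _)](_ : _ = \int[leb]_z (u z * kreg s x (eps m) z)); last first.
    exact: (congr1 fine (integral_rV_addl x mw)).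
  rewrite [X in _ * (_ + X)](_ : _ = \int[leb]_z (u z * kreg s x (eps m) z)); last first.
    exact: (congr1 fine (integral_rV_subl x mw)).
  by field.
pose B := (1 + rho / r ^+ 2 + r^-1) `^ P.
have B0 : 0 <= B by exact: powR_ge0.
pose K := C * (1 + 4 * P / rho).
(* The first term dominates for [enorm y < r], where the smoothness of [f] is used; the last two
   dominate farther away, where the kernels are comparable. *)
pose G y := K * (Num.min (sqn y) 1 * kern s y) +
  (B * `|u (x + y) * kreg s x 1 (x + y)| + B * `|u (x - y) * kreg s x 1 (x - y)|).
have ik : intR (fun y : 'rV[R]_N => Num.min (sqn y) 1 * kern s y).
  exact: integrable_min_kern.
have iG : intR G.
  apply: intRD; first exact: (intRZ K ik).
  apply: intRD; apply: intRZ; apply: intR_norm.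
    exact: (integrable_rV_addl x iu).
  exact: (integrable_rV_subl x iu).
have mD : measurable_fun setT D.
  by apply: measurable_funM; [exact: measurable_second_diff|exact: measurable_kern].
have mH m : measurable_fun setT (H m).
  by apply: measurable_funD; [exact: (intR_measurable (ip m))|exact: (intR_measurable (im m))].
have c40 : 0 <= 4 * P / rho.
  by apply: divr_ge0; [apply: mulr_ge0 => //; exact: ltW|exact: ltW].
have uD y : u (x + y) + u (x - y) = second_diff f x y by rewrite /u /second_diff; ring.
have domH m y : `|H m y| <= G y.
  have K0 : 0 <= K * (Num.min (sqn y) 1 * kern s y).
    by rewrite !mulr_ge0 ?addr_ge0// ?kern_ge0// le_min sqn_ge0 ler01.
  have [yr|yr] := ltP (enorm y) r.
    apply: (@le_trans _ _ (K * (Num.min (sqn y) 1 * kern s y))); last first.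
      by rewrite lerDl addr_ge0// mulr_ge0.
    have [->|yn0] := eqVneq y 0.
      by rewrite /H !addr0 subr0 /u subrr !mul0r addr0 normr0 kern0// !mulr0.
    have -> : Num.min (sqn y) 1 = sqn y.
      apply/min_idPl; rewrite -enorm_sqr exprn_ile1 ?enorm_ge0//.
      by rewrite (le_trans (ltW yr)).
    (* Both terms are quadratic: the first by the second difference of [f], the second as the
       product of a Lipschitz difference of [f] and the kernel asymmetry of [kreg_diff]. *)
    have -> : H m y = second_diff f x y * kreg s x (eps m) (x + y) +
        u (x - y) * (kreg s x (eps m) (x - y) - kreg s x (eps m) (x + y)).
      rewrite -uD /H; move: (u (x + y)) (u (x - y)) (kreg _ _ _ _) (kreg _ _ _ _) => *; ring.
    apply: (le_trans (ler_normD _ _)).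
    rewrite (_ : K * (sqn y * kern s y) = C * (sqn y * kern s y) +
      C * (4 * P / rho) * (sqn y * kern s y)); last by rewrite /K mulrDr mulr1 mulrDl.
    apply: lerD.
      rewrite normrM mulrA; apply: ler_pM => //; first exact: quad.
      by rewrite ger0_norm ?kreg_ge0// kreg_le_kern.
    rewrite normrM (_ : C * (4 * P / rho) * (sqn y * kern s y) =
       C * enorm y * (4 * P / rho * enorm y * kern s y)); last by rewrite -enorm_sqr; ring.
    apply: ler_pM => //; last exact: (kreg_diff r0).
    by have := lip (- y); rewrite enormN; apply.
  have y0 : y != 0.
    apply: contraTneq yr => ->; rewrite -ltNge.
    by rewrite -(scale0r (0 : 'rV[R]_N)) enormZ normr0 mul0r.
  apply: (@le_trans _ _ (B * `|u (x + y) * kreg s x 1 (x + y)| + B * `|u (x - y) * kreg s x 1 (x - y)|)).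
    apply: (le_trans (ler_normD _ _)); apply: lerD.
      rewrite !normrM mulrCA ler_wpM2l// !ger0_norm ?kreg_ge0//.
      apply: le_trans (kern_le_kreg1 r0 yr); exact: kreg_le_kern.
    rewrite !normrM mulrCA ler_wpM2l// !ger0_norm ?kreg_ge0//.
    apply: (@le_trans _ _ (kern s (- y))).
      by apply: kreg_le_kern; rewrite // oppr_eq0.
    by apply: (kern_le_kreg1 r0); rewrite enormN.
  by rewrite lerDr.
have cvgH y : H m y @[m --> \oo] --> D y.
  have [->|yn0] := eqVneq y 0.
    rewrite /D kern0// mulr0 (_ : (fun m => _) = fun=> 0); first exact: cvg_cst.
    by apply/funext => m; rewrite /H !addr0 subr0 /u subrr !mul0r addr0.
  have sy : 0 < sqn y.
    rewrite -enorm_sqr exprn_gt0// lt_neqAle enorm_ge0 andbT eq_sym.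
    apply: contra_neq yn0 => y0.
    by apply/rowP => i; rewrite mxE; apply/eqP; rewrite -normr_le0 -y0 enorm_coord.
  have ck (c : R) : (sqn y + eps m * c) `^ (- P) @[m --> \oo] --> kern s y.
    rewrite kernE; apply: (@cvg_comp _ _ _ (fun m => sqn y + eps m * c) (fun t => t `^ (- P)));
      last exact: continuous_powR.
    suff : sqn y + eps m * c @[m --> \oo] --> sqn y + 0 * c by rewrite mul0r addr0.
    apply: cvgD; first exact: cvg_cst.
    by apply: cvgM; [exact: cvg_harmonic|exact: cvg_cst].
  rewrite /D -uD mulrDl; apply: cvgD; apply: cvgM; try exact: cvg_cst.
    by under eq_cvg do rewrite kregD; exact: ck.
  by under eq_cvg do rewrite kregB; exact: ck.
have cvgHE y : (H m y)%:E @[m --> \oo] --> (D y)%:E.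
  by apply: cvg_EFin; [exact: nearW|exact: cvgH].
have mHE m : measurable_fun setT (EFin \o H m) by exact/measurable_EFinP.
have mDE : measurable_fun setT (EFin \o D) by exact/measurable_EFinP.
have domHE y m : setT y -> (`|(EFin \o H m) y| <= (EFin \o G) y)%E.
  by move=> _ /=; rewrite lee_fin.
have [iD _ cI] := dominated_convergence measurableT mHE mDE
  (aeW _ (fun y _ => cvgHE y)) iG (aeW _ domHE).
split => //.
under eq_cvg do rewrite HE.
apply: cvgM; first exact: cvg_cst.
have fD : (\int[leb]_y (EFin \o D) y)%E \is a fin_num by exact: integrable_fin_num.
rewrite /Rintegral; apply: fine_cvg.
by rewrite (fineK fD); exact: cI.
Qed.

End regularization.

(** * Second differences and smoothness of products and powers *)

Section powR_taylor.
Context (R : realType).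

(** The sum covers both signs of [b], that is, both directions of monotonicity of the power. *)
Lemma powR_le_endpoints (b u v c : R) : 0 < u -> u <= c -> c <= v -> c `^ b <= u `^ b + v `^ b.
Proof.
move=> u0 uc cv; have c0 : 0 < c by exact: lt_le_trans uc.
have [b0|b0] := leP 0 b.
  by rewrite (le_trans (ler_powRl b0 (ltW c0) cv))// lerDr powR_ge0.
have := ler_powRNl (r := - b) _ u0 uc; rewrite opprK oppr_ge0 => /(_ (ltW b0)) h.
by rewrite (le_trans h)// lerDl powR_ge0.
Qed.

Lemma powR_mvt (a v w : R) : 0 < v -> v <= w ->
  exists c, [/\ v <= c, c <= w & w `^ a - v `^ a = a * c `^ (a - 1) * (w - v)].
Proof.
move=> v0 vw; have pos c : v <= c -> 0 < c by exact: lt_le_trans.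
have [c ci E] : exists2 c, c \in `[v, w] & w `^ a - v `^ a = a * c `^ (a - 1) * (w - v).
  apply: (@MVT_segment R (fun t => t `^ a) (fun t => a * t `^ (a - 1))) => //.
    by move=> c; rewrite in_itv/= => /andP[vc _]; apply: is_derive1_powR; exact/pos/ltW.
  apply: continuous_in_subspaceT => c; rewrite inE/= in_itv/= => /andP[vc _].
  exact/continuous_powR/pos.
by exists c; move: ci; rewrite in_itv/= => /andP[].
Qed.

Lemma powR_lip (a v0 : R) : 0 < v0 -> exists2 L : R, 0 <= L &
  forall v w, v0 / 2 <= v <= 2 * v0 -> v0 / 2 <= w <= 2 * v0 -> `|v `^ a - w `^ a| <= L * `|v - w|.
Proof.
move=> v00; exists (`|a| * ((v0 / 2) `^ (a - 1) + (2 * v0) `^ (a - 1))).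
  by rewrite mulr_ge0// addr_ge0 ?powR_ge0.
have v20 : 0 < v0 / 2 by rewrite divr_gt0.
move=> v w; wlog vw : v w / w <= v.
  move=> H hv hw; have [/H|/ltW/H] := leP w v; first exact.
  by rewrite distrC [X in _ -> _ <= _ * X]distrC; exact.
move=> /andP[v1 v2] /andP[w1 w2].
have [c [c1 c2 ->]] := powR_mvt a (lt_le_trans v20 w1) vw.
rewrite !normrM -!mulrA ler_wpM2l// ler_wpM2r// ger0_norm ?powR_ge0//.
by apply: powR_le_endpoints => //; [exact: le_trans c1|exact: le_trans v2].
Qed.

(** The mean value theorem writes the increment with slope [a c^(a - 1)]; replacing [c] by [v0]
    costs a Lipschitz error for the exponent [a - 1], which makes the remainder quadratic. *)
Lemma powR_taylor (a v0 : R) : 0 < v0 -> exists2 L : R, 0 <= L &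
  forall v, `|v - v0| <= v0 / 2 -> `|v `^ a - v0 `^ a| <= L * `|v - v0| /\
    `|v `^ a - v0 `^ a - a * v0 `^ (a - 1) * (v - v0)| <= L * (v - v0) ^+ 2.
Proof.
move=> v00; have [L1 L10 H1] := powR_lip a v00; have [L2 L20 H2] := powR_lip (a - 1) v00.
exists (L1 + `|a| * L2); first by rewrite addr_ge0// mulr_ge0.
move=> v; rewrite ler_norml => /andP[h1 h2].
have v0i : v0 / 2 <= v0 <= 2 * v0 by apply/andP; split; lra.
have vi : v0 / 2 <= v <= 2 * v0 by apply/andP; split; lra.
split.
  by rewrite (le_trans (H1 _ _ vi v0i))// ler_wpM2r// lerDl mulr_ge0.
have vp : 0 < v by lra.
have [c [ci cd E]] : exists c, [/\ v0 / 2 <= c <= 2 * v0, `|c - v0| <= `|v - v0| &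
    v `^ a - v0 `^ a = a * c `^ (a - 1) * (v - v0)].
  have [vv0|v0v] := leP v v0.
    have [c [c1 c2 E]] := powR_mvt a vp vv0.
    exists c; split; first by apply/andP; split; lra.
      by rewrite !ler0_norm; lra.
    by rewrite -[LHS]opprB E -mulrN opprB.
  have [c [c1 c2 E]] := powR_mvt a v00 (ltW v0v).
  exists c; split => //; first by apply/andP; split; lra.
  by rewrite !ger0_norm; lra.
rewrite E -mulrBl -mulrBr !normrM -real_normK ?num_real// expr2 mulrA ler_wpM2r//.
rewrite mulrDl ler_wpDl ?mulr_ge0// -mulrA ler_wpM2l//.
by rewrite (le_trans (H2 _ _ ci v0i))// ler_wpM2l.
Qed.

End powR_taylor.

Section quad_at.
Context (R : realType) (n : nat).
Notation N := n.+1.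
Implicit Types (f g : 'rV[R]_N -> R) (x y : 'rV[R]_N).

(** The local regularity that the passage to the limit requires. It is preserved by products and by
    powers of positive functions through algebra on differences, which spares a Taylor formula in
    several variables. *)
Definition quad_at f x := exists r C : R, [/\ 0 < r, 0 <= C,
  forall y, enorm y < r -> `|f (x + y) - f x| <= C * enorm y &
  forall y, enorm y < r -> `|second_diff f x y| <= C * sqn y].

Lemma quad_at_local f g x r : 0 < r ->
  (forall y, enorm y < r -> f (x + y) = g (x + y)) -> quad_at g x -> quad_at f x.
Proof.
move=> r0 fg [r1 [C [r10 C0 lip quad]]].
have enorm0 : enorm (0 : 'rV[R]_N) = 0.
  by rewrite -(scale0r (0 : 'rV[R]_N)) enormZ normr0 mul0r.
have fgx : f x = g x by have := fg 0; rewrite addr0 enorm0; exact.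
exists (Num.min r r1), C; split => //; first by rewrite lt_min r0.
  by move=> y; rewrite lt_min => /andP[yr yr1]; rewrite fg// fgx lip.
move=> y; rewrite lt_min => /andP[yr yr1].
by rewrite /second_diff fg// fg ?enormN// fgx; exact: quad.
Qed.

Lemma quad_at_coord i x : quad_at (fun z => z 0 i) x.
Proof.
exists 1, 1; split => // y _; rewrite mul1r.
  by rewrite (_ : _ - _ = y 0 i) ?enorm_coord// mxE; ring.
rewrite /second_diff !mxE (_ : _ - _ = 0) ?normr0 ?sqn_ge0//; ring.
Qed.

Lemma quad_at_sqn x : quad_at (@sqn R N) x.
Proof.
have E y : sqn (x + y) = sqn x + sqn y + 2 * \sum_(i < N) x 0 i * y 0 i.
  by rewrite /sqn mulr_sumr -!big_split/=; apply: eq_bigr => i _; rewrite !mxE; ring.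
exists 1, (2 * enorm x + 2); split => //.
- by rewrite addr_ge0// mulr_ge0// enorm_ge0.
- move=> y y1; rewrite E (_ : _ - _ = sqn y + 2 * \sum_(i < N) x 0 i * y 0 i); last by ring.
  set D := \sum_(i < N) _.
  have D1 : D <= enorm x * enorm y by exact: dot_le_enorm.
  have D2 : - D <= enorm x * enorm y.
    rewrite -(enormN x); apply: le_trans (dot_le_enorm _ _); rewrite -sumrN.
    by rewrite le_eqVlt; apply/orP; left; apply/eqP; apply: eq_bigr => i _; rewrite mxE mulNr.
  have y2 : sqn y <= enorm y by rewrite -enorm_sqr expr2 ler_piMl ?enorm_ge0// ltW.
  have y3 := sqn_ge0 y; have y4 := enorm_ge0 y.
  rewrite (_ : (2 * enorm x + 2) * enorm y = 2 * (enorm x * enorm y) + 2 * enorm y); last by ring.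
  by rewrite ler_norml; apply/andP; split; lra.
- move=> y _; rewrite /second_diff E (_ : sqn (x - y) = sqn x + sqn y - 2 * \sum_(i < N) x 0 i * y 0 i).
    rewrite (_ : _ - _ = 2 * sqn y); last by ring.
    rewrite ger0_norm ?mulr_ge0 ?sqn_ge0// ler_wpM2r ?sqn_ge0// lerDr mulr_ge0 ?enorm_ge0//.
  have sN : sqn (- y) = sqn y by rewrite -!enorm_sqr enormN.
  rewrite E sN; congr (_ + _).
  by rewrite -mulrN -sumrN; congr (_ * _); apply: eq_bigr => i _; rewrite mxE mulrN.
Qed.

Lemma quad_atM f g x : quad_at f x -> quad_at g x -> quad_at (fun z => f z * g z) x.
Proof.
move=> [r1 [C1 [r10 C10 lip1 quad1]]] [r2 [C2 [r20 C20 lip2 quad2]]].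
pose r := Num.min 1 (Num.min r1 r2).
have rP y : enorm y < r -> [/\ enorm y <= 1, enorm y < r1 & enorm y < r2].
  by rewrite /r !lt_min => /and3P[h ? ?]; split => //; exact: ltW.
pose F := `|f x|; pose G := `|g x|.
have F0 : 0 <= F by exact: normr_ge0.
have G0 : 0 <= G by exact: normr_ge0.
exists r, (F * C2 + G * C1 + C1 * C2 + C1 * C2); split.
- by rewrite !lt_min ltr01 r10 r20.
- by do !apply: addr_ge0; exact: mulr_ge0.
- move=> y /rP[y1 yr1 yr2].
  have l1 := lip1 _ yr1; have l2 := lip2 _ yr2.
  rewrite (_ : _ - _ = f x * (g (x + y) - g x) + g x * (f (x + y) - f x) +
     (f (x + y) - f x) * (g (x + y) - g x)); last by ring.
  rewrite [leRHS](_ : _ = F * C2 * enorm y + G * C1 * enorm y + C1 * C2 * enorm y +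
    C1 * C2 * enorm y); last by ring.
  apply: ler_wpDr; first by apply: mulr_ge0; [exact: mulr_ge0|exact: enorm_ge0].
  apply: le_trans (ler_normD _ _) _; apply: lerD.
    apply: le_trans (ler_normD _ _) _; rewrite !normrM -!mulrA.
    by apply: lerD; apply: ler_wpM2l.
  rewrite normrM; apply: (@le_trans _ _ (C1 * enorm y * (C2 * 1))).
    by apply: ler_pM => //; apply: le_trans l2 _; rewrite ler_wpM2l.
  by rewrite mulr1 mulrAC.
- move=> y /rP[y1 yr1 yr2].
  have l1 := lip1 _ yr1; have l2 := lip2 _ yr2.
  have yN1 : enorm (- y) < r1 by rewrite enormN.
  have yN2 : enorm (- y) < r2 by rewrite enormN.
  have k1 := lip1 _ yN1; have k2 := lip2 _ yN2; rewrite enormN in k1 k2.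
  have q1 := quad1 _ yr1; have q2 := quad2 _ yr2.
  (* A discrete Leibniz rule; the two products of first differences are quadratic by the Lipschitz
     bounds. *)
  rewrite {1}/second_diff (_ : _ - _ = f x * second_diff g x y + g x * second_diff f x y +
     (f (x + y) - f x) * (g (x + y) - g x) + (f (x - y) - f x) * (g (x - y) - g x)); last first.
    by rewrite /second_diff; ring.
  rewrite [leRHS](_ : _ = F * (C2 * sqn y) + G * (C1 * sqn y) + C1 * (C2 * sqn y) +
    C1 * (C2 * sqn y)); last by ring.
  apply: le_trans (ler_normD _ _) _; apply: lerD; last first.
    rewrite normrM -enorm_sqr (_ : C1 * (C2 * _) = C1 * enorm y * (C2 * enorm y)).
      exact: ler_pM.
    by ring.
  apply: le_trans (ler_normD _ _) _; apply: lerD; last first.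
    rewrite normrM -enorm_sqr (_ : C1 * (C2 * _) = C1 * enorm y * (C2 * enorm y)).
      exact: ler_pM.
    by ring.
  apply: le_trans (ler_normD _ _) _; rewrite !normrM.
  by apply: lerD; apply: ler_wpM2l.
Qed.

Lemma quad_at_powR f x a : 0 < f x -> quad_at f x -> quad_at (fun z => f z `^ a) x.
Proof.
move=> fx0 [r1 [C1 [r10 C10 lip1 quad1]]].
have [L L0 HL] := powR_taylor a fx0.
pose K := `|a * f x `^ (a - 1)|; have K0 : 0 <= K by exact: normr_ge0.
(* Within this radius [f (x + y)] stays at distance at most [f x / 2] from [f x], the range of
   [powR_taylor]. *)
pose r := Num.min r1 (f x / (2 * (C1 + 1))).
have C11 : 0 < C1 + 1 by rewrite ltr_wpDl.
have near y : enorm y < r -> [/\ enorm y < r1 & `|f (x + y) - f x| <= f x / 2].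
  rewrite lt_min => /andP[yr1]; rewrite ltr_pdivlMr ?mulr_gt0// => h; split => //.
  apply: le_trans (lip1 _ yr1) _; rewrite ler_pdivlMr//.
  apply: le_trans (ltW h); rewrite (_ : C1 * enorm y * 2 = enorm y * (2 * C1)); last by ring.
  by rewrite ler_wpM2l ?enorm_ge0// ler_wpM2l// lerDl.
exists r, (L * C1 + (L * C1 ^+ 2 + L * C1 ^+ 2 + K * C1)); split.
- by rewrite lt_min r10 divr_gt0// mulr_gt0.
- by do !apply: addr_ge0; apply: mulr_ge0 => //; exact: exprn_ge0.
- move=> y /near[yr1 fy]; have [h1 _] := HL _ fy.
  rewrite mulrDl; apply: ler_wpDr; first by rewrite mulr_ge0 ?enorm_ge0// !addr_ge0 ?mulr_ge0 ?exprn_ge0.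
  by apply: (le_trans h1); rewrite -mulrA ler_wpM2l// lip1.
- move=> y yr; have [yr1 fy] := near _ yr.
  have /near[yN1 fNy] : enorm (- y) < r by rewrite enormN.
  have [_ h1] := HL _ fy; have [_ h2] := HL _ fNy.
  rewrite mulrDl; apply: ler_wpDl; first by rewrite !mulr_ge0 ?sqn_ge0.
  rewrite {1}/second_diff (_ : _ - _ =
    (f (x + y) `^ a - f x `^ a - a * f x `^ (a - 1) * (f (x + y) - f x)) +
    (f (x - y) `^ a - f x `^ a - a * f x `^ (a - 1) * (f (x - y) - f x)) +
    a * f x `^ (a - 1) * second_diff f x y); last by rewrite /second_diff; ring.
  have sq z : enorm z = enorm y -> enorm z < r1 -> L * (f (x + z) - f x) ^+ 2 <= L * C1 ^+ 2 * sqn y.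
    move=> zy z1; rewrite -mulrA ler_wpM2l// -[leLHS]real_normK ?num_real//.
    rewrite -enorm_sqr -exprMn lerXn2r ?nnegrE ?normr_ge0 ?mulr_ge0 ?enorm_ge0//.
    by rewrite -zy lip1.
  rewrite [leRHS](_ : _ = L * C1 ^+ 2 * sqn y + L * C1 ^+ 2 * sqn y + K * C1 * sqn y); last by ring.
  apply: le_trans (ler_normD _ _) _; apply: lerD; last first.
    by rewrite normrM -mulrA ler_wpM2l// quad1.
  apply: le_trans (ler_normD _ _) _; apply: lerD.
    by apply: (le_trans h1); exact: sq.
  by apply: (le_trans h2); apply: sq => //; rewrite enormN.
Qed.

End quad_at.

(** * Closure of [Ck_on] under sums, products and powers *)

Section Ck_closure.
Context (R : realType) (n : nat).
Notation V := ('rV[R]_n).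
Implicit Types (f g : V -> R) (x v : V) (k : nat) (U : set V).

(** Restriction to a line makes the one-variable chain rule available for directional
    derivatives. *)
Lemma is_derive_lineP f x v (df : R) :
  is_derive x v f df <-> is_derive (0 : R) (1 : R) (fun h : R => f (h *: v + x)) df.
Proof.
have E : 'D_v f x = 'D_1 (fun h : R => f (h *: v + x)) 0.
  rewrite /derive; set g1 := fun h => h^-1 *: _; set g2 := fun h => h^-1 *: _.
  suff -> : g1 = g2 by [].
  by apply/funext => h; rewrite /g1 /g2 /= addr0 scale0r add0r /GRing.scale/= mulr1.
split=> -[d <-]; split.
- exact: (derivable1P f x v).1.
- by rewrite -E.
- exact: (derivable1P f x v).2.
- by rewrite E.
Qed.

Lemma is_derive_powR_comp f x v (df a : R) : 0 < f x -> is_derive x v f df ->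
  is_derive x v (fun z => f z `^ a) (a * f x `^ (a - 1) * df).
Proof.
move=> fx0 /is_derive_lineP Df; apply/is_derive_lineP.
have fx0' : 0 < f (0 *: v + x) by rewrite scale0r add0r.
have := @is_derive1_comp R (fun t => t `^ a) (fun h : R => f (h *: v + x)) 0 _ _
  (is_derive1_powR a fx0') Df.
by rewrite scale0r add0r.
Qed.

Lemma is_derive_coord (i : 'I_n) x v : is_derive x v (fun z : V => z 0 i) (v 0 i).
Proof.
apply/is_derive_lineP; rewrite (_ : (fun h => _) = fun h : R => v 0 i * h + x 0 i).
  refine (is_derive_eq (is_deriveD (is_deriveZ (v 0 i) (is_derive_id (0 : R) (1 : R))) (is_derive_cst (x 0 i) (0 : R) (1 : R))) _).
  by rewrite addr0 /GRing.scale/= mulr1.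
by apply/funext => h; rewrite !mxE mulrC.
Qed.

Lemma Ck_onW k U f : Ck_on k.+1 U f -> Ck_on k U f.
Proof.
elim: k f => [|k IH] f /= [cf df]; split=> // i; have [dfi ckf] := df i.
by split => //; exact: IH.
Qed.

(** [Ck_on] mentions the partial derivatives as functions on the whole space, while the
    differentiation rules identify them only on [U]; openness lets the equality pass to
    derivatives. *)
Lemma Ck_on_eq k U f g : open U -> (forall x, U x -> f x = g x) -> Ck_on k U f -> Ck_on k U g.
Proof.
move=> oU; elim: k f g => [|k IH] f g fg.
all: have near_fg x : U x -> \forall y \near x, f y = g y
  by move=> Ux; near=> y; apply: fg; near: y; exact: open_nbhs_nbhs.
all: have near_gf x : U x -> \forall y \near x, g y = f y
  by move=> Ux; near=> y; apply/esym/fg; near: y; exact: open_nbhs_nbhs.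
all: have cg : (forall x, U x -> {for x, continuous f}) -> forall x, U x -> {for x, continuous g}
  by move=> cf x Ux; rewrite /prop_for /continuous_at -(fg _ Ux);
     apply: cvg_trans (cf x Ux) => P /=;
     apply: filterS2 (near_fg x Ux) => y /= ->.
  by move=> [cf _]; split => //; exact: cg.
move=> [cf df]; split; first exact: cg.
move=> i; have [dfi ckf] := df i; split.
  move=> x Ux; apply: near_eq_derivable (dfi _ Ux); exact: near_fg.
apply: IH ckf => x Ux; rewrite /partial; apply: near_eq_derive; exact: near_fg.
Unshelve. all: by end_near. Qed.

Lemma Ck_on_cst k U (c : R) : open U -> Ck_on k U (cst c).
Proof.
move=> oU; elim: k c => [|k IH] c; split => //.
- by move=> x _; exact: cst_continuous.
- by move=> x _; exact: cst_continuous.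
- move=> i; split; first by move=> x _; exact: derivable_cst.
  apply: (@Ck_on_eq _ _ (cst 0)) => // x _.
  by rewrite /partial derive_cst.
Qed.

Lemma Ck_on_coord k U (i : 'I_n) : open U -> Ck_on k U (fun z : V => z 0 i).
Proof.
move=> oU; case: k => [|k]; split => //; try by move=> x _; exact: coord_continuous.
move=> j; split; first by move=> x _; case: (is_derive_coord i x (delta_mx 0 j)).
apply: (@Ck_on_eq _ _ (cst (delta_mx 0 j 0 i))) => //; last exact: Ck_on_cst.
by move=> x _; rewrite /partial; case: (is_derive_coord i x (delta_mx 0 j)) => _ ->.
Qed.

Lemma Ck_onD k U f g : open U -> Ck_on k U f -> Ck_on k U g -> Ck_on k U (fun z => f z + g z).
Proof.
move=> oU; elim: k f g => [|k IH] f g [cf df] [cg dg]; split => //;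
  try by move=> x Ux; apply: (@continuousD _ _ _ f g); [exact: cf|exact: cg].
move=> i; have [dfi cdf] := df i; have [dgi cdg] := dg i.
have D x : U x -> is_derive x (delta_mx 0 i) (fun z => f z + g z) (partial i f x + partial i g x).
  by move=> Ux; apply: is_deriveD; apply/derivableP; [exact: dfi|exact: dgi].
split; first by move=> x /D[].
apply: (@Ck_on_eq _ _ (fun z => partial i f z + partial i g z)) => //; last exact: IH.
by move=> x /D[_ <-].
Qed.

Lemma Ck_onM k U f g : open U -> Ck_on k U f -> Ck_on k U g -> Ck_on k U (fun z => f z * g z).
Proof.
move=> oU; elim: k f g => [|k IH] f g Cf Cg;
  have [cf df] := Cf; have [cg dg] := Cg; split => //;
  try by move=> x Ux; apply: (@continuousM _ _ f g); [exact: cf|exact: cg].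
move=> i; have [dfi cdf] := df i; have [dgi cdg] := dg i.
have D x : U x -> is_derive x (delta_mx 0 i) (fun z => f z * g z)
    (f x * partial i g x + g x * partial i f x).
  by move=> Ux; apply: is_deriveM; apply/derivableP; [exact: dfi|exact: dgi].
split; first by move=> x /D[].
apply: (@Ck_on_eq _ _ (fun z => f z * partial i g z + g z * partial i f z)) => //.
  by move=> x /D[_ <-].
by apply: Ck_onD => //; apply: IH => //; exact: Ck_onW.
Qed.

Lemma Ck_on_powR k U f (a : R) : open U -> (forall x, U x -> 0 < f x) ->
  Ck_on k U f -> Ck_on k U (fun z => f z `^ a).
Proof.
move=> oU f0; elim: k a => [|k IH] a Cf; have [cf df] := Cf; split => //;
  try by move=> x Ux; apply: (@cvg_comp _ _ _ f (fun t => t `^ a)); [exact: cf|exact/continuous_powR/f0].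
move=> i; have [dfi cdf] := df i.
have D x : U x -> is_derive x (delta_mx 0 i) (fun z => f z `^ a)
    (a * f x `^ (a - 1) * partial i f x).
  by move=> Ux; apply: is_derive_powR_comp; [exact: f0|apply/derivableP; exact: dfi].
split; first by move=> x /D[].
apply: (@Ck_on_eq _ _ (fun z => cst a z * f z `^ (a - 1) * partial i f z)) => //.
  by move=> x /D[_ <-].
apply: Ck_onM => //; apply: Ck_onM => //; first exact: Ck_on_cst.
by apply: IH; exact: Ck_onW.
Qed.

Lemma Ck_on_sqn k U : open U -> Ck_on k U (@sqn R n).
Proof.
move=> oU; suff H (r : seq 'I_n) : Ck_on k U (fun z : V => \sum_(i <- r) z 0 i ^+ 2) by exact: H.
elim: r => [|i r IH].
  by apply: (@Ck_on_eq _ _ (cst 0)) => //; [move=> x _; rewrite big_nil|exact: Ck_on_cst].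
apply: (@Ck_on_eq _ _ (fun z => z 0 i * z 0 i + \sum_(i <- r) z 0 i ^+ 2)) => //.
  by move=> x _; rewrite big_cons expr2.
by apply: Ck_onD => //; apply: Ck_onM => //; exact: Ck_on_coord.
Qed.

End Ck_closure.

(** * The Kelvin transform *)

(** Young's inequality with exponents [1 / al] and [1 / (1 - al)] gives
    [t^al a^(1 - al) <= al t + (1 - al) a], which includes [t = 0]; multiplying by [a^(al - 1)]
    gives the tangent line at [a]. *)
Lemma powR_tangent (R : realType) (al a t : R) : 0 < al -> al < 1 -> 0 < a -> 0 <= t ->
  t `^ al <= a `^ al + al * a `^ (al - 1) * (t - a).
Proof.
move=> al0 al1 a0 t0; have b0 : 0 < 1 - al by rewrite subr_gt0.
have E : al^-1^-1 + (1 - al)^-1^-1 = 1 by rewrite !invrK addrC subrK.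
have al0' : 0 < al^-1 by rewrite invr_gt0.
have b0' : 0 < (1 - al)^-1 by rewrite invr_gt0.
have := conjugate_powR (powR_ge0 t al) (powR_ge0 a (1 - al)) al0' b0' E.
rewrite -!powRrM !divff ?gt_eqF// !powRr1 ?(ltW a0)// !invrK => H.
have a1 : 0 < a `^ (al - 1) by rewrite powR_gt0.
have a2 : a `^ (al - 1) * a `^ (1 - al) = 1.
  by rewrite -powRD ?(gt_eqF a0) ?implybT// (_ : al - 1 + (1 - al) = 0) ?powRr0//; ring.
have a3 : a `^ al = a `^ (al - 1) * a.
  by rewrite -[X in _ * X]powRr1 ?(ltW a0)// -powRD ?(gt_eqF a0) ?implybT// subrK.
rewrite -(ler_pM2l a1) in H.
apply: le_trans (_ : a `^ (al - 1) * (t `^ al * a `^ (1 - al)) <= _).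
  by rewrite mulrCA a2 mulr1.
by apply: (le_trans H); rewrite a3 le_eqVlt; apply/orP; left; apply/eqP; ring.
Qed.

Section kelvin.
Context (R : realType) (n : nat).
Notation N := n.+1.
Notation leb := (@lebesgue_rV R N).
Notation intR f := (leb.-integrable setT (EFin \o f)).
Variable s : R.
Hypotheses (s0 : (0 < s)%R) (s1 : (s < 1)%R).
Implicit Types (x y z : 'rV[R]_N).

(* Up to a constant factor, the Kelvin transform of lastpow s for any sphere centered at the
   origin. *)
Definition kelvin (z : 'rV[R]_N) : R := lastpow s z * enorm z `^ (- N%:R).

Lemma kelvin_ge0 z : 0 <= kelvin z.
Proof. by rewrite mulr_ge0 ?pospow_ge0 ?powR_ge0. Qed.

Lemma kelvin_neg z : z 0 ord_max <= 0 -> kelvin z = 0.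
Proof.
move=> z0; rewrite /kelvin /lastpow /pospow (max_idPr z0) powR0 ?mul0r//.
by rewrite gt_eqF.
Qed.

Lemma lastpow_pos z : 0 < z 0 ord_max -> lastpow s z = z 0 ord_max `^ s.
Proof. by move=> z0; rewrite /lastpow /pospow (max_idPl (ltW z0)). Qed.

Lemma enorm_gt0 z : 0 < z 0 ord_max -> 0 < enorm z.
Proof. by move=> z0; apply: lt_le_trans (enorm_coord z ord_max); rewrite gtr0_norm. Qed.

Lemma kelvin_gt0 z : 0 < z 0 ord_max -> 0 < kelvin z.
Proof. by move=> z0; rewrite /kelvin lastpow_pos// mulr_gt0 ?powR_gt0 ?enorm_gt0. Qed.

Lemma lastpow_le_enorm z : lastpow s z <= enorm z `^ s.
Proof.
apply: ler_powRl; first exact: ltW; first by rewrite le_max lexx orbT.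
by rewrite ge_max enorm_ge0 (le_trans _ (enorm_coord z ord_max))// ler_norm.
Qed.

Lemma kelvin_le_enorm z : kelvin z <= enorm z `^ (s - N%:R).
Proof.
have [z0|z0] := leP (z 0 ord_max) 0; first by rewrite kelvin_neg// powR_ge0.
rewrite powRD ?(gt_eqF (enorm_gt0 z0)) ?implybT//.
by rewrite ler_wpM2r ?powR_ge0// lastpow_le_enorm.
Qed.

Lemma measurable_kelvin : measurable_fun setT kelvin.
Proof.
apply: measurable_funM; first exact: measurable_lastpow.
exact: measurable_kernel.
Qed.

Lemma kelvin_le x : 0 < x 0 ord_max -> kelvin x <= x 0 ord_max `^ (s - N%:R).
Proof.
move=> x0; apply: (le_trans (kelvin_le_enorm x)).
rewrite -[s - _]opprB; apply: ler_powRNl => //.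
  rewrite subr_ge0 (le_trans (ltW s1))// ler1n//.
by rewrite -[leLHS]gtr0_norm// enorm_coord.
Qed.

Section at_point.
Variable x : 'rV[R]_N.
Hypothesis x0 : 0 < x 0 ord_max.
Let rho0 : 0 < enorm x. Proof. exact: enorm_gt0. Qed.

(** With [c = |x|^2 / |z|^2], the inversion multiplies [lastpow] by [c^s] and the kernel by
    [c^(- N / 2 - s)], and the Jacobian is [c^N]. The total is [c^(N / 2) = |x|^N / |z|^N], exactly
    the factor between [lastpow] and [kelvin]. At [z = 0] both sides vanish. *)
Lemma kelvin_inversion e z : 0 <= e -> kelvin z * kreg s x e z =
  enorm x `^ (- N%:R) * (lastpow s (inversion (sqn x) z) * kreg s x e (inversion (sqn x) z))
    * (sqn x / sqn z) ^+ N.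
Proof.
move=> e0; have [z0|zn0] := eqVneq (sqn z) 0.
  rewrite z0 invr0 mulr0 expr0n/= mulr0 kelvin_neg ?mul0r//.
  by apply: le_trans (ler_norm _) _; rewrite (le_trans (enorm_coord _ _))// -sqrtr0 -z0.
have z0 : 0 < sqn z by rewrite lt_neqAle eq_sym zn0 sqn_ge0.
have ez0 : 0 < enorm z by rewrite lt_neqAle enorm_ge0 andbT eq_sym -sqrf_eq0 enorm_sqr.
have sx0 : 0 < sqn x by rewrite -enorm_sqr exprn_gt0.
rewrite /inversion; set c := sqn x / sqn z; have c0 : 0 < c by rewrite divr_gt0.
have -> : lastpow s (c *: z) = c `^ s * lastpow s z by rewrite /lastpow mxE pospowM.
have -> : kreg s x e (c *: z) = c `^ (- (2^-1 * (N%:R + 2 * s))) * kreg s x e z.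
  rewrite /kreg -powRM ?(ltW c0) ?addr_ge0 ?mulr_ge0 ?sqn_ge0 ?enorm_ge0//; congr (_ `^ _).
  rewrite enormZ gtr0_norm// mulrDr; congr (_ + _); last by ring.
  have D (a b : 'rV[R]_N) : sqn (a - b) = sqn a + sqn b - 2 * \sum_i a 0 i * b 0 i.
    rewrite /sqn -big_split mulr_sumr -sumrB; apply: eq_bigr => i _; rewrite !mxE/=; ring.
  rewrite !D sqnZ (_ : \sum_i (c *: z) 0 i * x 0 i = c * \sum_i z 0 i * x 0 i); last first.
    by rewrite mulr_sumr; apply: eq_bigr => i _; rewrite mxE mulrA.
  (* This relation is what yields [sqn (c *: z - x) = c * sqn (z - x)]: it expresses that the sphere
     of inversion passes through [x]. *)
  have -> : sqn x = c * sqn z by rewrite /c divfK.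
  ring.
have -> : c ^+ N = c `^ N%:R by rewrite powR_mulrn// ltW.
rewrite /kelvin.
have -> : enorm z `^ (- N%:R) = enorm x `^ (- N%:R) * c `^ (2^-1 * N%:R).
  have E : enorm x `^ N%:R = c `^ (2^-1 * N%:R) * enorm z `^ N%:R.
    by rewrite -!sqn_powR -powRM ?(ltW c0) ?sqn_ge0// /c divfK.
  rewrite !powRN E invfM mulrAC mulVf ?mul1r// gt_eqF// powR_gt0//.
have -> : c `^ (2^-1 * N%:R) = c `^ s * c `^ (- (2^-1 * (N%:R + 2 * s))) * c `^ N%:R.
  by rewrite -!powRD ?(gt_eqF c0) ?implybT//; congr (_ `^ _); field.
ring.
Qed.

Lemma integral_kelvin e : 0 <= e ->
  (\int[leb]_z (kelvin z * kreg s x e z)%:E =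
  \int[leb]_z (enorm x `^ (- N%:R) * (lastpow s z * kreg s x e z))%:E)%E.
Proof.
move=> e0.
pose F z := (enorm x `^ (- N%:R) * (lastpow s z * kreg s x e z))%:E.
rewrite -(@ge0_integral_inversion R n (sqn x) F).
- apply: eq_integral => z _; rewrite (kelvin_inversion _ e0) EFinM//.
- by rewrite -enorm_sqr exprn_gt0.
- apply/measurable_EFinP; apply: measurable_funM => //.
  by apply: measurable_funM; [exact: measurable_lastpow|exact: measurable_kreg].
- by move=> v; rewrite lee_fin !mulr_ge0 ?powR_ge0// pospow_ge0.
Qed.

Lemma integrable_lastpow_kreg1 : intR (fun z => lastpow s z * kreg s x 1 z).
Proof.
apply: (integrable_kreg1 s0 rho0 (C := (1 + enorm x) `^ s * 2 `^ s)).
  exact: measurable_lastpow.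
move=> y; rewrite ger0_norm ?pospow_ge0//; apply: (le_trans (lastpow_le_enorm _)).
apply: (@le_trans _ _ (((1 + enorm x) * (1 + enorm y)) `^ s)).
  apply: ler_powRl; [exact: ltW|exact: enorm_ge0|].
  apply: (le_trans (enormD x y)).
  have := mulr_ge0 (enorm_ge0 x) (enorm_ge0 y); nra.
have X0 := enorm_ge0 x; have Y0 := enorm_ge0 y.
rewrite powRM ?addr_ge0// -mulrA ler_wpM2l ?powR_ge0//.
have [y1|y1] := leP (enorm y) 1.
  apply: (@le_trans _ _ (2 `^ s)).
    by apply: ler_powRl; rewrite ?(ltW s0) ?addr_ge0// -[2]/(1 + 1) lerD2l.
  by rewrite ler_peMr ?powR_ge0// lerDl powR_ge0.
apply: (@le_trans _ _ ((2 * enorm y) `^ s)).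
  apply: ler_powRl; rewrite ?(ltW s0) ?addr_ge0//.
  by rewrite (mulr_natl _ 2) mulr2n lerD2r ltW.
by rewrite powRM// ler_wpM2l ?powR_ge0// lerDr.
Qed.

Lemma integrable_lastpow_kreg e : 0 < e <= 1 -> intR (fun z => lastpow s z * kreg s x e z).
Proof.
move=> e01; apply: integrable_kreg => //; first exact: measurable_lastpow.
exact: integrable_lastpow_kreg1.
Qed.

(** The singularity of [kelvin] at the origin is handled by the inversion, which turns it into the
    growth of [lastpow] at infinity. *)
Lemma integrable_kelvin_kreg e : 0 < e <= 1 -> intR (fun z => kelvin z * kreg s x e z).
Proof.
move=> /[dup] e01 /andP[e0 _]; apply/integrableP; split.
  apply/measurable_EFinP.
  by apply: measurable_funM; [exact: measurable_kelvin|exact: measurable_kreg].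
have E z : `|(kelvin z * kreg s x e z)%:E|%E = (kelvin z * kreg s x e z)%:E.
  by rewrite /= ger0_norm// mulr_ge0 ?kelvin_ge0 ?kreg_ge0.
rewrite (eq_integral _ _ (fun z _ => E z)) integral_kelvin ?(ltW e0)//.
have := intRZ (enorm x `^ (- N%:R)) (integrable_lastpow_kreg e01).
move=> /integrableP[_]; apply: le_lt_trans; rewrite le_eqVlt; apply/orP; left; apply/eqP.
by apply: eq_integral => z _ /=; rewrite ger0_norm// !mulr_ge0 ?powR_ge0 ?pospow_ge0 ?kreg_ge0.
Qed.

Lemma Rintegral_kelvin e : 0 < e <= 1 ->
  \int[leb]_z (kelvin z * kreg s x e z) =
  enorm x `^ (- N%:R) * \int[leb]_z (lastpow s z * kreg s x e z).
Proof.
move=> /[dup] e01 /andP[e0 _].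
rewrite -RintegralZl//; last exact: integrable_lastpow_kreg.
by rewrite /Rintegral integral_kelvin// ltW.
Qed.

End at_point.
End kelvin.

(** * The mass of the kernel on the opposite half-space *)

Section half_space_potential.
Context (R : realType) (n : nat).
Notation N := n.+1.
Notation leb := (@lebesgue_rV R N).
Notation intR f := (leb.-integrable setT (EFin \o f)).
Variable s : R.
Hypotheses (s0 : (0 < s)%R) (s1 : (s < 1)%R).
Variable x : 'rV[R]_N.
Hypothesis x0 : 0 < x 0 ord_max.
Let rho0 : 0 < enorm x. Proof. exact: enorm_gt0. Qed.
Implicit Types (y z : 'rV[R]_N).
Let t := x 0 ord_max.
Let t0 : 0 < t := x0.

Definition neg_half z : R := if z 0 ord_max <= 0 then 1 else 0.

Lemma neg_half_ge0 z : 0 <= neg_half z.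
Proof. by rewrite /neg_half; case: ifP. Qed.

Lemma measurable_neg_half : measurable_fun setT neg_half.
Proof.
have mc := @measurable_coord R N ord_max.
by rewrite /neg_half; mfun.
Qed.

Lemma integrable_neg_half_kreg e : 0 < e <= 1 ->
  intR (fun z => neg_half z * kreg s x e z).
Proof.
move=> e01; apply: integrable_kreg => //; first exact: measurable_neg_half.
apply: intR_le (integrable_kreg1_cst s0 rho0 1).
  by apply: measurable_funM; [exact: measurable_neg_half|exact: measurable_kreg].
move=> z; rewrite ger0_norm ?mulr_ge0 ?neg_half_ge0 ?kreg_ge0//.
by apply: ler_wpM2r; [exact: kreg_ge0|rewrite /neg_half; case: ifP].
Qed.

(* A cube of side x_N in the opposite half-space, at distance comparable to x_N from x. *)
Let corner (i : 'I_N) : R := if i == ord_max then - 2 * t else x 0 i.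
Let box : set 'rV[R]_N := [set z | forall i, [set` `[corner i, corner i + t]] (z 0 i)].

Let measurable_box : measurable box.
Proof.
have -> : box = \bigcap_(i in [set: 'I_N])
    ((fun z : 'rV[R]_N => z 0 i : R) @^-1` [set` `[corner i, corner i + t]]).
  by apply/seteqP; split => [z Bz i _|z Bz i]; [exact: Bz|exact: (Bz i I)].
apply: fin_bigcap_measurable => // i _.
by rewrite -[X in measurable X]setTI; apply: measurable_coord => //; exact: measurable_itv.
Qed.

Let box_measure : leb box = (t ^+ N)%:E.
Proof.
rewrite /box (@lebesgue_rV_box R N (fun i => [set` `[corner i, corner i + t]])).
  rewrite (eq_bigr (fun=> t%:E)).
    by rewrite prodEFin prodr_const card_ord.
  move=> i _; rewrite lebesgue_measure_itv/= lte_fin ltrDl t0.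
  by rewrite EFinN EFinD addeAC -EFinB subrr add0e.
by move=> i; exact: measurable_itv.
Qed.

Let box_near z : box z -> z 0 ord_max <= 0 /\ sqn (z - x) <= 9 * N%:R * t ^+ 2.
Proof.
move=> Bz; have B i : corner i <= z 0 i <= corner i + t by have := Bz i; rewrite /= in_itv.
split; first by have := B ord_max; rewrite /corner eqxx => /andP[_]; move: t0; lra.
rewrite /sqn; apply: (@le_trans _ _ (\sum_(i < N) 9 * t ^+ 2)).
  apply: ler_sum => i _; rewrite !mxE.
  (* No coordinate of [z - x] exceeds [3 t] in absolute value: the last one lies between [- 3 t] and
     [- 2 t], the others between 0 and [t]. *)
  rewrite (_ : 9 * t ^+ 2 = (3 * t) ^+ 2); last by ring.
  suff /andP[h1 h2] : - (3 * t) <= z 0 i - x 0 i <= 3 * t.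
    by rewrite -subr_ge0 subr_sqr mulr_ge0; move: h1 h2; lra.
  have := B i; rewrite /corner; case: eqP => [->|_].
    by rewrite -/t; move: (z 0 ord_max) t t0 => u v; lra.
  by move: (z 0 i) (x 0 i) t t0 => u v w; lra.
rewrite sumr_const card_ord -[X in X <= _]mulr_natr mulrAC. exact: lexx.
Qed.

(** On the box [enorm z <= M], so for large [m] the regularizing term is at most [t^2] and is
    absorbed by the [+ 1]. The kernel is then at least a constant times [t^(- N - 2 s)] on a set of
    measure [t^N]. *)
Lemma neg_half_kreg_ge : \forall m \near \oo,
  (9 * N%:R + 1) `^ (- (2^-1 * (N%:R + 2 * s))) * t `^ (- (2 * s)) <=
  \int[leb]_z (neg_half z * kreg s x m.+1%:R^-1 z).
Proof.
pose M := enorm x + Num.sqrt (9 * N%:R * t ^+ 2).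
have M0 : 0 < M by rewrite ltr_pwDl ?sqrtr_ge0.
have t20 : 0 < t ^+ 2 by rewrite exprn_gt0.
have : \forall m \near \oo, m.+1%:R^-1 < t ^+ 2 / M.
  by exact: (near_infty_natSinv_lt (PosNum (divr_gt0 t20 M0))).
apply: filterS => m; rewrite ltr_pdivlMr// => me.
set e := m.+1%:R^-1 in me *.
have e0 : 0 < e by rewrite invr_gt0.
have e1 : 0 < e <= 1 by rewrite e0 invf_le1// ler1n.
set P := 2^-1 * _; set c := (9 * N%:R + 1) `^ (- P).
have P0 : 0 < P by rewrite mulr_gt0// addr_gt0// mulr_gt0.
have ge_box z : c * t `^ (- (N%:R + 2 * s)) * \1_box z <= neg_half z * kreg s x e z.
  rewrite indicE; have [Bz|_] := boolP (z \in box); last first.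
    by rewrite mulr0 mulr_ge0 ?neg_half_ge0 ?kreg_ge0.
  rewrite mulr1; move: Bz; rewrite inE => /box_near[z0 zx].
  rewrite /neg_half z0 mul1r.
  have -> : t `^ (- (N%:R + 2 * s)) = (t ^+ 2) `^ (- P).
    by rewrite -powR_mulrn ?(ltW t0)// -powRrM; congr (_ `^ _); rewrite /P; field.
  rewrite /c -powRM ?addr_ge0 ?(ltW t20)//.
  rewrite /kreg; apply: ler_powRNl; first exact: ltW.
    apply: ltr_wpDr; first by rewrite mulr_ge0 ?enorm_ge0// ltW.
    rewrite -enorm_sqr exprn_gt0//; apply: lt_le_trans (enorm_coord (z - x) ord_max).
    by rewrite normr_gt0 !mxE subr_eq0 lt_eqF// (le_lt_trans z0).
  rewrite [leRHS]mulrDl mul1r; apply: lerD => //.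
  apply: le_trans (ltW me); rewrite ler_pM2l//.
  rewrite (_ : z = x + (z - x)); last by rewrite addrC subrK.
  apply: (le_trans (enormD _ _)); rewrite lerD2l.
  by rewrite /enorm ler_wsqrtr.
rewrite -lee_fin.
have ib := integrable_neg_half_kreg e1.
rewrite /Rintegral fineK; last exact: integrable_fin_num.
apply: (@le_trans _ _ (\int[leb]_z (c * t `^ (- (N%:R + 2 * s)) * \1_box z)%:E)%E).
  under eq_integral => z _ do rewrite EFinM.
  rewrite ge0_integralMl ?integral_indic ?setIT//.
  - rewrite [X in (_ <= _ * X)%E](box_measure : _ = _) -EFinM lee_fin -mulrA ler_wpM2l ?powR_ge0//.
    rewrite -powR_mulrn ?(ltW t0)// -powRD ?(gt_eqF t0) ?implybT//.
    by rewrite (_ : - _ + _ = - (2 * s))//; ring.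
  - by rewrite mulr_ge0 ?powR_ge0.
  - exact/measurable_EFinP/measurable_indic.
apply: ge0_leT_integral.
- by apply/measurable_EFinP; apply: measurable_funM => //; exact: measurable_indic.
- by case/integrableP : ib.
- by move=> z; rewrite lee_fin mulr_ge0 ?mulr_ge0 ?powR_ge0// indicE.
- by move=> z; rewrite lee_fin; exact: ge_box.
Qed.

End half_space_potential.

(** * The fractional Laplacian of a power of the Kelvin transform *)

Section kelvin_power.
Context (R : realType) (n : nat).
Notation N := n.+1.
Notation leb := (@lebesgue_rV R N).
Notation intR f := (leb.-integrable setT (EFin \o f)).
Variable s : R.
Hypotheses (s0 : (0 < s)%R) (s1 : (s < 1)%R).
Variable al : R.
Hypotheses (al0 : (0 < al)%R) (al1 : (al < 1)%R).
Implicit Types (x y z : 'rV[R]_N).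

Definition kelvin_powR z : R := kelvin s z `^ al.

Lemma measurable_kelvin_powR : measurable_fun setT kelvin_powR.
Proof.
apply: (measurableT_comp (measurable_powR al)); exact: measurable_kelvin.
Qed.

Lemma kelvin_powR_ge0 z : 0 <= kelvin_powR z. Proof. exact: powR_ge0. Qed.

Lemma kelvin_powR_le z : kelvin_powR z <= 1 + kelvin s z.
Proof.
have k0 := kelvin_ge0 s z; rewrite /kelvin_powR.
have [k1|k1] := leP (kelvin s z) 1.
  by apply: (@le_trans _ _ (1 `^ al)); [exact: ler_powRl (ltW al0) k0 k1|rewrite powR1 lerDl].
apply: (@le_trans _ _ (kelvin s z `^ 1)); first by apply: ler_powR; exact: ltW.
by rewrite powRr1// lerDr.
Qed.

Lemma kelvin_powR_sub_le x z : 0 < x 0 ord_max ->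
  kelvin_powR z - kelvin_powR x <=
  al * kelvin s x `^ (al - 1) * (kelvin s z - kelvin s x) -
    (1 - al) * kelvin_powR x * neg_half z.
Proof.
move=> x0; have kx := kelvin_gt0 s x0; rewrite /kelvin_powR /neg_half; case: ifPn => z0.
  rewrite (kelvin_neg s0 z0) powR0 ?(gt_eqF al0)// sub0r add0r mulr1.
  have -> : kelvin s x `^ al = kelvin s x `^ (al - 1) * kelvin s x.
    by rewrite -[X in _ * X]powRr1 ?(ltW kx)// -powRD ?(gt_eqF kx) ?implybT// subrK.
  by rewrite le_eqVlt; apply/orP; left; apply/eqP; ring.
rewrite mulr0 subr0 lerBlDl.
exact: powR_tangent (kelvin_ge0 s z).
Qed.

Section at_point.
Variable x : 'rV[R]_N.
Hypothesis x0 : 0 < x 0 ord_max.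
Let rho0 : 0 < enorm x. Proof. exact: enorm_gt0. Qed.

Let pos_near y : enorm y < x 0 ord_max -> 0 < (x + y) 0 ord_max.
Proof.
move=> h; rewrite mxE; have := le_lt_trans (enorm_coord y ord_max) h.
by rewrite ltr_norml -ltrBlDl sub0r => /andP[].
Qed.

Lemma quad_at_lastpow : quad_at (@lastpow R s n) x.
Proof.
apply: (quad_at_local (g := fun z => z 0 ord_max `^ s) x0).
  by move=> y /pos_near; exact: lastpow_pos.
by apply: quad_at_powR => //; exact: quad_at_coord.
Qed.

Lemma quad_at_kelvin_powR : quad_at kelvin_powR x.
Proof.
apply: quad_at_powR; first exact: kelvin_gt0.
apply: quad_atM; first exact: quad_at_lastpow.
apply: (quad_at_local (g := fun z => sqn z `^ (2^-1 * - N%:R)) x0).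
  by move=> y _; rewrite sqn_powR.
by apply: quad_at_powR; [rewrite -enorm_sqr exprn_gt0|exact: quad_at_sqn].
Qed.

Lemma quad_at_cvg f : measurable_fun setT f -> quad_at f x ->
  intR (fun z => f z * kreg s x 1 z) ->
  intR (fun y => second_diff f x y * kern s y) /\
  \int[leb]_z ((f z - f x) * kreg s x m.+1%:R^-1 z) @[m --> \oo] -->
    2^-1 * \int[leb]_y (second_diff f x y * kern s y).
Proof.
move=> mf [r [C [r0 C0 lip quad]]] fi.
pose r' := Num.min r (Num.min 1 (enorm x / 2)).
have rr : r' <= r by rewrite ge_min lexx.
apply: (@cvg_kreg_second_diff _ _ _ s0 s1 _ rho0 f r' C) => //.
- by rewrite !lt_min r0 ltr01 divr_gt0.
- by rewrite !ge_min lexx orbT.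
- by rewrite !ge_min lexx !orbT.
- by move=> y yr; apply: lip; exact: lt_le_trans yr rr.
- by move=> y yr; apply: quad; exact: lt_le_trans yr rr.
Qed.

Lemma integrable_kelvin_powR_kreg1 : intR (fun z => kelvin_powR z * kreg s x 1 z).
Proof.
have e1 : 0 < (1 : R) <= 1 by rewrite ltr01 lexx.
have ik := intRD (integrable_kreg1_cst s0 rho0 1) (integrable_kelvin_kreg s0 x0 e1).
apply: (intR_le _ _ ik).
  by apply: measurable_funM; [exact: measurable_kelvin_powR|exact: measurable_kreg].
move=> z; rewrite ger0_norm ?mulr_ge0 ?kelvin_powR_ge0 ?kreg_ge0// -mulrDl.
by rewrite ler_wpM2r ?kreg_ge0// kelvin_powR_le.
Qed.

Lemma integral_second_diff_lastpow_le0 :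
  \int[leb]_y (second_diff (@lastpow R s n) x y * kern s y) <= 0.
Proof.
have [ig _] := quad_at_cvg (@measurable_lastpow R s n) quad_at_lastpow
  (integrable_lastpow_kreg1 s0 x0).
have ip f : intR f -> intR (fun y => Num.max (f y) 0).
  move=> fi; apply: intR_le (intR_norm fi).
    by apply: measurable_maxr => //; exact: intR_measurable fi.
  by move=> y; rewrite ger0_norm ?le_max ?lexx ?orbT// ge_max ler_norm normr_ge0.
pose f y := second_diff (@lastpow R s n) x y * kern s y.
have fN : intR (fun y => - f y).
  apply: intR_le (intR_norm ig); last by move=> y; rewrite normrN.
  by apply: measurableT_comp => //; exact: intR_measurable ig.
have ipf := ip _ ig; have inf := ip _ fN.
have -> : \int[leb]_y f y = \int[leb]_y (Num.max (f y) 0) - \int[leb]_y (Num.max (- f y) 0).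
  rewrite -(RintegralB measurableT ipf inf); apply: eq_Rintegral => y _.
  case: (leP (f y) 0) => fy.
    by rewrite (max_idPl _) ?oppr_ge0// sub0r opprK.
  by rewrite (max_idPr _) ?oppr_le0 ?(ltW fy)// subr0.
have maxM a b : 0 <= b -> Num.max (a * b) 0 = Num.max a 0 * b :> R.
  by move=> b0; rewrite maxr_pMl// mul0r.
have E1 : (\int[leb]_y (Num.max (f y) 0)%:E = \int[leb]_y
    (Num.max (second_diff (@lastpow R s n) x y) 0 * enorm y `^ (- (N%:R + 2 * s)))%:E)%E.
  by apply: eq_integral => y _; rewrite maxM ?kern_ge0.
have E2 : (\int[leb]_y (Num.max (- f y) 0)%:E = \int[leb]_y
    (Num.max (- second_diff (@lastpow R s n) x y) 0 * enorm y `^ (- (N%:R + 2 * s)))%:E)%E.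
  by apply: eq_integral => y _; rewrite -mulNr maxM ?kern_ge0.
rewrite subr_le0; apply: fine_le.
- exact: integrable_fin_num ipf.
- exact: integrable_fin_num inf.
- by rewrite E1 E2; exact: integral_second_diff_lastpow_le.
Qed.

(** The factor 2 undoes the [2^-1] of [quad_at_cvg]. The contribution of [lastpow] survives in the
    limit only as a nonpositive term, and the mass of the kernel on the lower half-space gives the
    strict gain. *)
Lemma kelvin_powR_second_diff_le :
  intR (fun y => second_diff kelvin_powR x y * kern s y) /\
  2 * (1 - al) * (9 * N%:R + 1) `^ (- (2^-1 * (N%:R + 2 * s))) * kelvin_powR x *
    x 0 ord_max `^ (- (2 * s)) <=
  - \int[leb]_y (second_diff kelvin_powR x y * kern s y).
Proof.
have [iw cw] := quad_at_cvg measurable_kelvin_powR quad_at_kelvin_powR integrable_kelvin_powR_kreg1.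
have [ig cg] := quad_at_cvg (@measurable_lastpow R s n) quad_at_lastpow
  (integrable_lastpow_kreg1 s0 x0).
split => //.
set c := _ `^ (- (2^-1 * _)); set t := x 0 ord_max.
pose A := al * kelvin s x `^ (al - 1) * enorm x `^ (- N%:R).
have A0 : 0 <= A by rewrite !mulr_ge0 ?powR_ge0// ltW.
pose B := (1 - al) * kelvin_powR x.
have B0 : 0 <= B by rewrite mulr_ge0 ?kelvin_powR_ge0// subr_ge0 ltW.
(* For fixed [m] every integral converges absolutely, so the pointwise bound [kelvin_powR_sub_le]
   can be integrated term by term. *)
have main : \forall m \near \oo,
    \int[leb]_z ((kelvin_powR z - kelvin_powR x) * kreg s x m.+1%:R^-1 z) <=
    A * \int[leb]_z ((lastpow s z - lastpow s x) * kreg s x m.+1%:R^-1 z) - B * (c * t `^ (- (2 * s))).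
  have := neg_half_kreg_ge s0 x0; apply: filterS => m; rewrite -/c -/t.
  set e := m.+1%:R^-1 => box.
  have e1 : 0 < e <= 1 by rewrite invr_gt0 ltr0n invf_le1// ler1n.
  have k1 := integrable_kreg s0 rho0 e1 (measurable_cst (1 : R)) (integrable_kreg1_cst s0 rho0 1).
  have kw := integrable_kreg s0 rho0 e1 measurable_kelvin_powR integrable_kelvin_powR_kreg1.
  have kh := integrable_kelvin_kreg s0 x0 e1.
  have kg := integrable_lastpow_kreg s0 x0 e1.
  have kb := integrable_neg_half_kreg s0 x0 e1.
  apply: (@le_trans _ _ (A * \int[leb]_z ((lastpow s z - lastpow s x) * kreg s x e z) -
    B * \int[leb]_z (neg_half z * kreg s x e z))); last first.
    by rewrite lerD2l lerN2 ler_wpM2l.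
  have ik : intR (fun z => kreg s x e z).
    by move: k1; rewrite (_ : (fun z => cst 1 z * _) = kreg s x e)//; apply/funext => z; rewrite mul1r.
  have sub f c' : intR (fun z => f z * kreg s x e z) ->
      intR (fun z => (f z - c') * kreg s x e z) /\
      \int[leb]_z ((f z - c') * kreg s x e z) =
      \int[leb]_z (f z * kreg s x e z) - c' * \int[leb]_z kreg s x e z.
    move=> fi; have -> : (fun z => (f z - c') * kreg s x e z) =
        (fun z => f z * kreg s x e z - c' * kreg s x e z).
      by apply/funext => z; rewrite mulrBl.
    by split; [exact: intRB fi (intRZ _ ik)|
      rewrite (RintegralB measurableT fi (intRZ c' ik)) (RintegralZl _ measurableT ik)].
  have [iw' _] := sub _ (kelvin_powR x) kw.
  have [ih' Eh] := sub _ (kelvin s x) kh.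
  have [_ ->] := sub _ (lastpow s x) kg.
  pose A' := al * kelvin s x `^ (al - 1).
  (* The inversion gives the factor [|x|^(-N)] between the integrals, and the values at [x] are in
     the same ratio because [kelvin s x = lastpow s x * |x|^(-N)]; so the integrals of the
     differences correspond as well. *)
  have -> : A * (\int[leb]_z (lastpow s z * kreg s x e z) - lastpow s x * \int[leb]_z kreg s x e z)
      = A' * \int[leb]_z ((kelvin s z - kelvin s x) * kreg s x e z).
    rewrite Eh (Rintegral_kelvin s0 x0 e1) /A -/A'.
    by move: (\int[leb]_z _) (\int[leb]_z _) => I J; rewrite /kelvin; ring.
  rewrite -(RintegralZl A' measurableT ih') -(RintegralZl B measurableT kb).
  rewrite -(RintegralB measurableT (intRZ A' ih') (intRZ B kb)).
  apply: le_Rintegral => //; first exact: intRB (intRZ A' ih') (intRZ B kb).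
  move=> z _; rewrite !mulrA -mulrBl ler_wpM2r ?kreg_ge0//.
  exact: kelvin_powR_sub_le.
have lim : 2^-1 * \int[leb]_y (second_diff kelvin_powR x y * kern s y) <=
    A * (2^-1 * \int[leb]_y (second_diff (@lastpow R s n) x y * kern s y)) - B * (c * t `^ (- (2 * s))).
  apply: (ler_cvg_to cw _ main).
  apply: cvgB; last exact: cvg_cst.
  by apply: cvgM => //; exact: cvg_cst.
have le0 : A * (2^-1 * \int[leb]_y (second_diff (@lastpow R s n) x y * kern s y)) <= 0.
  by rewrite !mulr_ge0_le0// integral_second_diff_lastpow_le0.
move: lim le0; rewrite /B; move: (\int[leb]_y _) (A * _) => I J; move: (t `^ _) => T; lra.
Qed.

End at_point.
End kelvin_power.

(** * Positivity of the normalizing constant *)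

Section trigonometry.
Context (R : realType).

Lemma norm_sin_le (t : R) : 0 <= t -> `|sin t| <= t.
Proof.
move=> t0; have [c _] : exists2 c, c \in `[0, t] & sin t - sin 0 = cos c * (t - 0).
  apply: (@MVT_segment R sin cos) => //.
  by apply: continuous_subspaceT => c; exact: continuous_sin.
rewrite sin0 !subr0 => ->; rewrite normrM (ger0_norm t0) ler_piMl//; exact: cos_max.
Qed.

Lemma one_sub_cos_le (t : R) : 1 - cos t <= t ^+ 2.
Proof.
wlog t0 : t / 0 <= t.
  move=> H; have [/H//|/ltW t0] := leP 0 t.
  by rewrite -cosN -sqrrN; apply: H; rewrite oppr_ge0.
have [c ci E] : exists2 c, c \in `[0, t] & cos t - cos 0 = - sin c * (t - 0).
  apply: (@MVT_segment R cos (fun u => - sin u)) => //.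
  by apply: continuous_subspaceT => c; exact: continuous_cos.
have [c0 ct] : 0 <= c /\ c <= t by move: ci; rewrite in_itv/= => /andP[].
rewrite -opprB -{1}(cos0 R) E mulNr opprK subr0 expr2 ler_wpM2r//.
by apply: le_trans ct; apply: le_trans (norm_sin_le c0); exact: ler_norm.
Qed.

End trigonometry.

Section normalizing_constant.
Context (R : realType) (n : nat).
Notation N := n.+1.
Notation leb := (@lebesgue_rV R N).
Notation intR f := (leb.-integrable setT (EFin \o f)).
Variable s : R.
Hypotheses (s0 : (0 < s)%R) (s1 : (s < 1)%R).
Implicit Types (x y z : 'rV[R]_N).

Lemma div_enorm_powR (a : R) y : a / enorm y `^ (N%:R + 2 * s) = a * kern s y.
Proof. by rewrite /kern powRN. Qed.

(** An infinite integral would be read as 0 by the real-valued integral, and [cNs] would then be 0;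
    integrability is thus part of its positivity. *)
Lemma integrable_cos_kern : intR (fun y => (1 - cos (y 0 ord0)) * kern s y).
Proof.
have mcos : measurable_fun setT (@cos R).
  by apply: continuous_measurable_fun; exact: continuous_cos.
apply: intR_le (intRZ 2 (integrable_min_kern n s0 s1)).
  apply: measurable_funM; last exact: measurable_kern.
  apply: measurable_funB => //.
  by apply: (measurableT_comp mcos); exact: measurable_coord.
move=> y; have c1 := cos_le1 (y 0 ord0); have c2 := cos_geN1 (y 0 ord0).
rewrite ger0_norm; last by rewrite mulr_ge0 ?kern_ge0// subr_ge0.
rewrite mulrA ler_wpM2r ?kern_ge0//.
case: (leP (sqn y) 1) => y1; last by move: c2; rewrite mulr1; lra.
apply: (le_trans (one_sub_cos_le _)).
apply: (@le_trans _ _ (sqn y)); last by rewrite ler_peMl ?sqn_ge0// ler1n.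
by rewrite /sqn (bigD1 ord0)//= lerDl sumr_ge0// => i _; exact: sqr_ge0.
Qed.

(** The integrand is bounded below on the cube [[1, 2]^N], of measure 1: there the first coordinate
    lies in [[1, pi]], where [1 - cos] is at least [1 - cos 1 > 0], and [sqn] is at most [4 N]. *)
Lemma cNs_gt0 : 0 < cNs n s.
Proof.
rewrite /cNs invr_gt0 mulr_gt0//.
have -> : (fun y : 'rV[R]_N => (1 - cos (y 0 ord0)) / enorm y `^ (N%:R + 2 * s)) =
    (fun y => (1 - cos (y 0 ord0)) * kern s y).
  by apply/funext => y; rewrite div_enorm_powR.
pose box : set 'rV[R]_N := [set z | forall i, [set` `[1, 2]] (z 0 i)].
have measurable_box : measurable box.
  have -> : box = \bigcap_(i in [set: 'I_N])
      ((fun z : 'rV[R]_N => z 0 i : R) @^-1` [set` `[1, 2]]).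
    by apply/seteqP; split => [z Bz i _|z Bz i]; [exact: Bz|exact: (Bz i I)].
  apply: fin_bigcap_measurable => // i _.
  by rewrite -[X in measurable X]setTI; apply: measurable_coord => //; exact: measurable_itv.
have box_measure : leb box = 1%:E.
  rewrite /box (@lebesgue_rV_box R N (fun i => [set` `[1, 2]])); last first.
    by move=> i; exact: measurable_itv.
  rewrite (eq_bigr (fun=> 1%:E)); last first.
    move=> i _; rewrite lebesgue_measure_itv/= lte_fin ltr1n/=.
    by rewrite -EFinB; congr EFin; ring.
  by rewrite prodEFin prodr_const expr1n.
pose c := (1 - cos 1) * (N%:R * 4 : R) `^ (- (2^-1 * (N%:R + 2 * s))).
have cos1 : cos 1 < 1 :> R.
  rewrite -[ltRHS]cos0 ltr_cos// ?in_itv/= ?lexx ?ler01 ?pi_ge0//.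
  have := pi_ge2 R; lra.
have c0 : 0 < c by rewrite mulr_gt0 ?subr_gt0// powR_gt0// mulr_gt0.
have ge_box z : c * \1_box z <= (1 - cos (z 0 ord0)) * kern s z.
  rewrite indicE; have [Bz|_] := boolP (z \in box); last first.
    by rewrite mulr0 mulr_ge0 ?kern_ge0// subr_ge0 cos_le1.
  rewrite mulr1; move: Bz; rewrite inE => Bz.
  have B i : 1 <= z 0 i <= 2 by have := Bz i; rewrite /= in_itv.
  have q0 : 0 <= 2^-1 * (N%:R + 2 * s) by rewrite mulr_ge0// addr_ge0// mulr_ge0// ltW.
  rewrite /c; apply: ler_pM; rewrite ?subr_ge0 ?powR_ge0 ?(ltW cos1)//.
    rewrite lerD2l lerN2; have /andP[z1 z2] := B ord0.
    have p2 := pi_ge2 R.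
    have i1 : (1 : R) \in `[0, pi] by rewrite in_itv/= ler01 (le_trans _ p2)// ler1n.
    have iz : z 0 ord0 \in `[0, pi] by rewrite in_itv/= (le_trans _ z1)//= (le_trans z2).
    by rewrite leNgt ltr_cos// -leNgt.
  rewrite kernE; apply: ler_powRNl => //.
    rewrite /sqn (bigD1 ord0)//=; apply: ltr_wpDr; first by rewrite sumr_ge0// => i _; exact: sqr_ge0.
    by have /andP[z1 _] := B ord0; rewrite exprn_gt0// (lt_le_trans _ z1).
  rewrite /sqn; apply: (@le_trans _ _ (\sum_(i < N) 4)).
    apply: ler_sum => i _; have /andP[z1 z2] := B i.
    by rewrite (_ : 4 = 2 ^+ 2) ?lerXn2r ?nnegrE// ?(le_trans _ z1)//; ring.
  by rewrite sumr_const card_ord -[X in X <= _]mulr_natl lexx.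
apply: (lt_le_trans c0); rewrite -lee_fin.
have ib := integrable_cos_kern.
rewrite /Rintegral fineK; last exact: integrable_fin_num.
apply: (@le_trans _ _ (\int[leb]_z (c * \1_box z)%:E)%E).
  under eq_integral => z _ do rewrite EFinM.
  rewrite ge0_integralMl ?integral_indic ?setIT//.
  - by rewrite [X in (_ <= _ * X)%E](box_measure : _ = _) mule1.
  - exact: ltW.
  - exact/measurable_EFinP/measurable_indic.
apply: ge0_leT_integral.
- by apply/measurable_EFinP; apply: measurable_funM => //; exact: measurable_indic.
- by case/integrableP : ib.
- by move=> z; rewrite lee_fin mulr_ge0 ?(ltW c0)// indicE.
- by move=> z; rewrite lee_fin; exact: ge_box.
Qed.

End normalizing_constant.

(** * The solution *)

Section half_space_solution.
Context (R : realType) (n : nat).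
Notation N := n.+1.
Notation leb := (@lebesgue_rV R N).
Notation intR f := (leb.-integrable setT (EFin \o f)).
Implicit Types (x y z : 'rV[R]_N) (u : 'rV[R]_N -> R).

Lemma open_half_space_pos : open (@half_space_pos R n).
Proof.
rewrite (_ : @half_space_pos R n = (fun z : 'rV[R]_N => z 0 ord_max) @^-1` [set t | 0 < t])//.
by apply: open_comp; [move=> z _; exact: coord_continuous|exact: open_gt].
Qed.

Lemma enorm_le_norm z : enorm z <= Num.sqrt N%:R * `|z|.
Proof.
rewrite -[`|z|]ger0_norm// -sqrtr_sqr -sqrtrM// ler_wsqrtr//.
apply: (@le_trans _ _ (\sum_(i < N) `|z| ^+ 2)); last by rewrite sumr_const card_ord mulr_natl.
apply: ler_sum => i _; rewrite -[X in X <= _]real_normK ?num_real// lerXn2r ?nnegrE//.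
by rewrite [leRHS]mx_normrE (le_bigmax _ (fun ij => `|z ij.1 ij.2|) (0, i)).
Qed.

(* No measurability of K is needed for the bound: the integral of a nonnegative function is
   defined as a supremum over simple functions. *)
Lemma integrable_dominated d (T : measurableType d) (mu : {measure set T -> \bar R})
    (K : set T) (f G : T -> R) : measurable_fun setT f ->
  mu.-integrable setT (EFin \o G) -> (forall t : T, 0 <= G t) ->
  (forall t, K t -> `|f t| <= G t) -> mu.-integrable K (EFin \o f).
Proof.
move=> mf /integrableP[_ iG] G0 fG; apply/integrableP; split.
  by apply: measurable_funTS; exact/measurable_EFinP.
apply: le_lt_trans iG; rewrite ge0_integralE// ge0_integralTE//.
apply: le_ereal_sup => _ [h hu <-]; exists h => //= t.
apply: (le_trans (hu t)); rewrite patchE; case: ifPn => Kt.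
  by rewrite lee_fin (le_trans (fG _ (set_mem Kt)))// ler_norm.
by rewrite lee_fin.
Qed.

Variables s al lam : R.
Hypotheses (s0 : (0 < s)%R) (s1 : (s < 1)%R).
Hypotheses (al0 : (0 < al)%R) (al1 : (al < 1)%R) (lam0 : (0 < lam)%R).

Let u z : R := lam * kelvin_powR s al z.

Lemma Ck_on_kelvin_powR k : Ck_on k (@half_space_pos R n) u.
Proof.
have oU := open_half_space_pos.
have pos_sqn z : half_space_pos z -> 0 < sqn z.
  by move=> z0; rewrite -enorm_sqr exprn_gt0// enorm_gt0.
have pos_last z : half_space_pos z -> 0 < z 0 ord_max by [].
have Cg := Ck_on_powR s oU pos_last (Ck_on_coord k ord_max oU).
have Cn := Ck_on_powR (2^-1 * - N%:R) oU pos_sqn (Ck_on_sqn k oU).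
have Ch := Ck_onM oU Cg Cn.
have pos_h z : half_space_pos z -> 0 < z 0 ord_max `^ s * sqn z `^ (2^-1 * - N%:R).
  by move=> z0; apply: mulr_gt0; apply: powR_gt0; [exact: z0|exact: pos_sqn].
have Cu := Ck_onM oU (Ck_on_cst k lam oU) (Ck_on_powR al oU pos_h Ch).
apply: Ck_on_eq oU _ Cu => z z0; rewrite /u /kelvin_powR /kelvin (lastpow_pos s z0) sqn_powR /cst; reflexivity.
Qed.

Let mu : measurable_fun setT u.
Proof. by apply: measurable_funM => //; exact: measurable_kelvin_powR. Qed.

Let u0 z : 0 <= u z.
Proof. by rewrite mulr_ge0 ?kelvin_powR_ge0// ltW. Qed.

(** Local integrability near the origin is read off from integrability against [kreg s x 1] for one
    fixed [x] in the half-space: on a bounded set this kernel is at least some [c > 0], and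
    [kelvin_powR <= 1 + kelvin]. *)
Lemma L1loc_kelvin_powR : L1loc u.
Proof.
move=> K /compact_bounded[M [_ KM]].
have {}KM z : K z -> enorm z <= Num.sqrt N%:R * (M + 1).
  move=> Kz; apply: (le_trans (enorm_le_norm z)); rewrite ler_wpM2l ?sqrtr_ge0//.
  have M1 : M < M + 1 by rewrite ltrDl.
  exact: KM M1 _ Kz.
pose x : 'rV[R]_N := delta_mx 0 ord_max.
have x0 : 0 < x 0 ord_max by rewrite mxE !eqxx.
have rho0 := enorm_gt0 x0.
pose D := Num.sqrt N%:R * (M + 1); pose P := 2^-1 * (N%:R + 2 * s).
have P0 : 0 <= P by rewrite mulr_ge0// addr_ge0// mulr_ge0// ltW.
pose c := ((D + enorm x) ^+ 2 + D) `^ (- P).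
have e1 : 0 < (1 : R) <= 1 by rewrite ltr01 lexx.
pose G z := lam / c * (1 * kreg s x 1 z + kelvin s z * kreg s x 1 z).
have G0 z : 0 <= G z.
  rewrite mulr_ge0 ?divr_ge0 ?powR_ge0 ?(ltW lam0)//.
  apply: addr_ge0; apply: mulr_ge0; [exact: ler01|exact: kreg_ge0|exact: kelvin_ge0|exact: kreg_ge0].
apply: (integrable_dominated (G := G)) => //.
  apply: intRZ; apply: intRD; first exact: integrable_kreg1_cst.
  exact: integrable_kelvin_kreg.
move=> z /KM; rewrite -/D => zD; rewrite ger0_norm// /G /u.
have zx : enorm (z - x) <= D + enorm x.
  by rewrite (le_trans (enormD _ _))// enormN lerD2r.
have b0 : 0 < sqn (z - x) + 1 * enorm z.
  rewrite mul1r; have [z0|z0] := eqVneq (enorm z) 0.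
    rewrite z0 addr0 -enorm_sqr exprn_gt0//.
    have := enormD (z - x) (- z); rewrite addrAC subrr sub0r !enormN z0 addr0.
    exact: lt_le_trans.
  by rewrite ltr_wpDl ?sqn_ge0// lt_neqAle eq_sym z0 enorm_ge0.
have D0 : 0 <= D by rewrite (le_trans (enorm_ge0 z)).
have ck : c <= kreg s x 1 z.
  apply: ler_powRNl => //; rewrite mul1r -enorm_sqr; apply: lerD => //.
  by rewrite lerXn2r ?nnegrE ?addr_ge0 ?enorm_ge0.
have c0 : 0 < c by rewrite powR_gt0// ltr_wpDr// exprn_gt0// ltr_wpDl.
rewrite -mulrDl -mulrA ler_pM2l//.
apply: (le_trans (kelvin_powR_le _ al0 al1 z)).
rewrite mulrCA ler_peMr ?addr_ge0 ?kelvin_ge0//.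
by rewrite ler_pdivlMl// mulr1.
Qed.

Lemma Ls_kelvin_powR : Ls s u.
Proof.
split; first exact: L1loc_kelvin_powR.
(* With [delta = 2 s] the weight is 1, and boundedness is enough: [kelvin <= |z|^(s - N) <= 1]
   outside the unit ball. *)
exists (2 * s); split => //; first exact: mulr_gt0.
apply: (@le_lt_trans _ _ lam%:E); last exact: ltry.
apply: (@le_trans _ _ (ereal_sup ((fun x => (`|u x| / enorm x `^ (2 * s - 2 * s))%:E) @`
    [set x : 'rV[R]_N | 1 < enorm x]))).
  by apply: ereal_inf_lbound; exists [set x | 1 < enorm x] => //; exists 1.
apply: ge_ereal_sup => _ [x /= x1 <-]; rewrite lee_fin subrr powRr0 divr1 ger0_norm//.
rewrite /u ler_piMr ?(ltW lam0)//.
have -> : 1 = 1 `^ al :> R by rewrite powR1.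
apply: ler_powRl; [exact: ltW|exact: kelvin_ge0|].
apply: (le_trans (kelvin_le_enorm _ _)) => //.
rewrite -[leRHS](powRr0 (enorm x)); apply: ler_powR; first exact: ltW.
by rewrite subr_le0 (le_trans (ltW s1))// ler1n.
Qed.

Lemma frac_laplacian_kelvin_powR x : half_space_pos x ->
  2 * cNs n s * (1 - al) * (9 * N%:R + 1) `^ (- (2^-1 * (N%:R + 2 * s))) *
    u x * x 0 ord_max `^ (- (2 * s)) <= frac_laplacian s u x.
Proof.
move=> x0; have [iw le] := kelvin_powR_second_diff_le s0 s1 al0 al1 x0.
have c0 := cNs_gt0 n s0 s1.
rewrite /frac_laplacian.
have -> : (fun y => (u (x + y) + u (x - y) - 2 * u x) / enorm y `^ (N%:R + 2 * s)) =
    (fun y => lam * (second_diff (kelvin_powR s al) x y * kern s y)).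
  apply/funext => y; rewrite div_enorm_powR /u /second_diff.
  by move: (kelvin_powR s al (x + y)) (kelvin_powR s al (x - y)) (kelvin_powR s al x) (kern s y) => a b c k; ring.
rewrite (RintegralZl _ measurableT iw).
have cl : 0 <= cNs n s * lam by rewrite mulr_ge0// ltW.
have := ler_wpM2l cl le; rewrite /u.
move: (\int[leb]_y _) (_ `^ (- (2^-1 * _))) (_ `^ (- (2 * s))) (kelvin_powR _ _ _) (cNs n s) => I C X K c.
rewrite (_ : 2 * c * _ * _ * _ * _ = c * lam * (2 * (1 - al) * C * K * X)); last by ring.
by rewrite (_ : - c * _ = c * lam * - I)//; ring.
Qed.

End half_space_solution.

Theorem theorem4p1 (R : realType) (n : nat) (s p : R)
  (hN : (2 <= n.+1)%N) (hs0 : 0 < s) (hs1 : s < 1)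
  (hp : (n.+1%:R + s) / (n.+1%:R - s) < p) :
  exists u : 'rV[R]_n.+1 -> R,
    [/\ Ck_on 2 (@half_space_pos R n) u /\ Ls s u,
        forall x, half_space_pos x -> 0 < u x,
        forall x, half_space_pos x -> u x `^ p <= frac_laplacian s u x &
        forall x, half_space_neg x -> u x = 0].
Proof.
have N1 : 1 <= n.+1%:R :> R by rewrite ler1n.
have Ns0 : 0 < n.+1%:R - s by rewrite subr_gt0 (lt_le_trans hs1).
have Np : n.+1%:R + s < p * (n.+1%:R - s) by rewrite -ltr_pdivrMr.
have p1 : 0 < p - 1.
  by rewrite -(pmulr_lgt0 _ Ns0) mulrBl mul1r subr_gt0; apply: lt_trans Np; lra.
(* The choice makes [(s - N) * al * (p - 1) = - 2 s], so that [u^(p - 1)] and the gain scale alike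
   in the last coordinate. *)
pose al := 2 * s / ((p - 1) * (n.+1%:R - s)).
have al0 : 0 < al by rewrite divr_gt0 ?mulr_gt0.
have al1 : al < 1.
  by rewrite ltr_pdivrMr ?mulr_gt0// mul1r mulrBl mul1r; move: Np; lra.
pose C := 2 * cNs n s * (1 - al) * (9 * n.+1%:R + 1) `^ (- (2^-1 * (n.+1%:R + 2 * s))).
have C0 : 0 < C by rewrite !mulr_gt0 ?cNs_gt0 ?subr_gt0// powR_gt0// addr_gt0// mulr_gt0.
(* Chosen so that [lam^(p - 1) = C], the constant gained in [frac_laplacian_kelvin_powR]. *)
pose lam := C `^ (p - 1)^-1.
have lam0 : 0 < lam by rewrite powR_gt0.
have scale (w T : R) : 0 < w -> w `^ (p - 1) <= T -> (lam * w) `^ p <= C * (lam * w) * T.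
  move=> w0 wT; have lw0 : 0 < lam * w by exact: mulr_gt0.
  have -> : (lam * w) `^ p = (lam * w) `^ (p - 1) * (lam * w).
    rewrite -[X in _ = _ * X](powRr1 (ltW lw0)) -powRD ?subrK//.
    by rewrite (gt_eqF lw0) implybT.
  rewrite mulrC -mulrA mulrCA ler_pM2l// powRM ?(ltW lam0) ?(ltW w0)//.
  by rewrite /lam -powRrM mulVf ?(gt_eqF p1)// powRr1 ?(ltW C0)// ler_pM2l.
exists (fun z => lam * kelvin_powR s al z); split.
- by split; [exact: Ck_on_kelvin_powR|exact: Ls_kelvin_powR].
- by move=> x x0; exact: mulr_gt0 lam0 (powR_gt0 _ (kelvin_gt0 s x0)).
- move=> x x0; apply: le_trans (frac_laplacian_kelvin_powR hs0 hs1 al0 al1 lam0 x0).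
  apply: scale; first exact: powR_gt0 (kelvin_gt0 s x0).
  rewrite /kelvin_powR -powRrM.
  apply: (@le_trans _ _ ((x 0 ord_max `^ (s - n.+1%:R)) `^ (al * (p - 1)))).
    apply: ler_powRl (kelvin_ge0 s x) (kelvin_le hs0 hs1 x0).
    exact: mulr_ge0 (ltW al0) (ltW p1).
  rewrite -powRrM (_ : (s - n.+1%:R) * _ = - (2 * s))//.
  by rewrite /al; field; rewrite nat1r (gt_eqF Ns0) (gt_eqF p1).
- move=> x /ltW x0; rewrite /kelvin_powR (kelvin_neg hs0 x0) powR0 ?mulr0//.
  by rewrite (gt_eqF al0).
Qed.
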